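(* Let $f$ be a transcendental entire function with a multiply connected wandering domain $U$ and let $z_0 \in U$. For large $n\in\mathbb{N}$ let $r_n=|f^n(z_0)|$, let $A(r_n^{a_n},r_n^{b_n})$ be the maximal annulus centred at $0$ that is contained in $U_n=f^n(U)$ and contains $f^n(z_0)$, and let $$C_n = A\left(r_n^{a_n+2\pi\delta_n},r_n^{b_n(1-3\pi\delta_n)}\right), \quad\text{where } \delta_n = 1/\sqrt{\log r_n}.$$ There exists $N\in\mathbb{N}$ such that, for all $n \geq N$ and $m \in \mathbb{N}$, there are no critical points of $f^m$ in $C_n$.
   Context: $A(r,R)=\{z\in\mathbb{C}:r<|z|<R\}$ for $0<r<R$. A transcendental entire function is an entire function $f:\mathbb{C}\to\mathbb{C}$ that is not a polynomial; $f^n$ denotes its $n$-th iterate, and $\mathbb{N}=\{1,2,\dots\}$. The Fatou set $F(f)$ is the set of points of $\mathbb{C}$ having a neighbourhood on which the iterates $f^n$ form a normal family (locally uniform convergence to $\infty$ being allowed). A Fatou component is a connected component of $F(f)$. For a Fatou component $U$, $U_n$ denotes the Fatou component containing $f^n(U)$, with $U_0=U$; $U$ is a wandering domain if the sequence $(U_n)$ is not eventually periodic. A domain is multiply connected if it is not simply connected. By results of Baker, if $U$ is a multiply connected wandering domain then each $U_n$ is bounded and multiply connected, $U_n=f^n(U)$, for all large $n$ both $U_n$ and $0$ lie in a bounded complementary component of $U_{n+1}$, and $\mathrm{dist}(U_n,0)\to\infty$ as $n\to\infty$. The maximal annulus is well defined for large $n$: there exists $\alpha>0$ such that, for all large $n$,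 the maximal annulus centred at $0$ that is contained in $U_n$ and contains $f^n(z_0)$ exists and has the form $A(r_n^{a_n},r_n^{b_n})$ with $0<a_n<1-\alpha<1+\alpha<b_n$; this defines $a_n$ and $b_n$. *)

(* Defs.v *)
From HB Require Import structures.
From mathcomp Require Import all_boot all_order all_algebra complex.
From mathcomp Require Import all_classical all_reals all_analysis.

Set Implicit Arguments.
Unset Strict Implicit.
Unset Printing Implicit Defensive.

Import Order.TTheory GRing.Theory Num.Theory.
Import numFieldTopology.Exports numFieldNormedType.Exports.

Local Open Scope classical_set_scope.
Local Open Scope ring_scope.

(* R[i] with its numClosedFieldType structure made apparent, so that the
   topology and the normed module structure that the library puts on every
   numClosedFieldType are found.  Note that `|z| is then an element of C R. *)
Definition C (R : realType) : numClosedFieldType := R[i].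

(* The modulus as an element of R. *)
Definition modulus (R : realType) (z : C R) : R := complex.Re `|z|.

Definition annulus (R : realType) (r s : R) : set (C R) :=
  [set z | r < modulus z < s].

Definition entire (R : realType) (f : C R -> C R) : Prop :=
  forall z, derivable f z 1.

Definition transcendental_entire (R : realType) (f : C R -> C R) : Prop :=
  entire f /\ ~ exists p : {poly C R}, forall z, f z = p.[z].

(* Locally uniform convergence on an open set V of the plane is uniform
   convergence on the compact subsets of V. *)
Definition cvg_loc_unif (R : realType) (V : set (C R))
    (g : nat -> C R -> C R) (h : C R -> C R) : Prop :=
  {family compactly_in V, g @ \oo --> h}.

Definition cvg_loc_unif_infty (R : realType) (V : set (C R))
    (g : nat -> C R -> C R) : Prop :=
  forall K, compactly_in V K ->
  forall M : R, \forall k \near \oo, forall z, K z -> M < modulus (g k z).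

Definition normal_family (R : realType) (F : set (C R -> C R))
    (V : set (C R)) : Prop :=
  forall g : nat -> C R -> C R, (forall k, F (g k)) ->
  exists phi : nat -> nat,
    {homo phi : i j / (i < j)%N} /\
    (cvg_loc_unif_infty V (g \o phi) \/
     exists h, cvg_loc_unif V (g \o phi) h).

Definition fatou_set (R : realType) (f : C R -> C R) : set (C R) :=
  [set z | exists2 V, open_nbhs z V &
    normal_family [set iter n f | n in [set n | (0 < n)%N]] V].

Definition fatou_component (R : realType) (f : C R -> C R)
    (V : set (C R)) : Prop :=
  exists2 z, fatou_set f z & V = connected_component (fatou_set f) z.

(* U_n: the Fatou component containing f^n(U).  When U is a Fatou component
   the union has exactly one member. *)
Definition component_iter (R : realType) (f : C R -> C R) (U : set (C R))
    (n : nat) : set (C R) :=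
  \bigcup_(V in [set V | fatou_component f V /\ iter n f @` U `<=` V]) V.

Definition eventually_periodic (T : Type) (u : nat -> T) : Prop :=
  exists p, (0 < p)%N /\ \forall n \near \oo, u (n + p)%N = u n.

Definition wandering_domain (R : realType) (f : C R -> C R)
    (U : set (C R)) : Prop :=
  fatou_component f U /\ ~ eventually_periodic (component_iter f U).

(* Simple connectedness of a domain: every loop is null-homotopic relatively
   to its base point. *)
Definition simply_connected (R : realType) (U : set (C R)) : Prop :=
  forall gamma : R -> C R,
    {within `[0, 1], continuous gamma} -> gamma @` `[0, 1] `<=` U ->
    gamma 0 = gamma 1 ->
  exists H : R * R -> C R,
    [/\ {within `[0, 1] `*` `[0, 1], continuous H},
        H @` (`[0, 1] `*` `[0, 1]) `<=` U,
        forall t : R, t \in `[0, 1] -> H (0, t) = gamma t,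
        forall t : R, t \in `[0, 1] -> H (1, t) = gamma 0 &
        forall s : R, s \in `[0, 1] -> H (s, 0) = gamma 0 /\ H (s, 1) = gamma 0].

Definition multiply_connected (R : realType) (U : set (C R)) : Prop :=
  ~ simply_connected U.

(* A(r, s) is the largest annulus centred at 0 contained in V and containing
   w.  Annuli have radii 0 < r' < s'; the union of two annuli containing w is
   again one, so that maximal and largest coincide. *)
Definition maximal_annulus (R : realType) (V : set (C R)) (w : C R)
    (r s : R) : Prop :=
  [/\ 0 < r < s, annulus r s `<=` V, annulus r s w &
      forall r' s' : R, 0 < r' < s' -> annulus r' s' `<=` V ->
        annulus r' s' w -> annulus r' s' `<=` annulus r s].

Definition critical_point (R : realType) (f : C R -> C R) (z : C R) : Prop :=
  derive1 f z = 0.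

(* Main.v *)
(* Write [r_n] for the modulus of the [n]-th iterate of [z0] and [U_n] for its Fatou component,
   which by hypothesis contains the circle [|z| = r_n].  The [U_n] are pairwise disjoint
   for large [n].  If [r_j < r_i] for some late [i < j], then by the maximum principle an
   iterate of [f] maps the disc of radius [r_i] into itself; as the iterates are normal on the
   circle, they are then normal on the disc, which would force [U_i = U_j].  So [r_n]
   increases, and the same argument shows that it is unbounded.  Hence [U_n] lies between the
   circles of radii [r_(n-1)] and [r_(n+1)], and [|f^m| > 1] on [U_n].

   Since [f] is not a polynomial, [ln r_(n+2) / ln r_n] tends to infinity, and this yields, by the
   three circles theorem, a radius beyond which [x |-> B(x) / x] is nondecreasing, uniformly
   in [m], where [B(x)] is the maximum of [ln |f^m|] on the circle of radius [expR x].

   Let finally [z] be a critical point of [f^m] in [C_n], and let [x = ln |z|].  In the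
   logarithmic coordinate [ln |f^m|] is a positive harmonic function on a strip in which [x]
   has distance [d] to the boundary, and its gradient vanishes at [z].  Harnack's inequality,
   improved to second order, bounds [B(x + pi)] by [B(x) * (1 + O(1 / d ^ 2))], whereas
   monotonicity gives [B(x + pi) >= B(x) * (1 + pi / x)].  The definition of [C_n] makes [d ^ 2]
   so large compared with [x] that these are incompatible. *)
Require Import Defs.
From mathcomp Require Import all_boot all_order all_algebra complex.
From mathcomp Require Import all_classical all_reals all_analysis.
From mathcomp Require Import ring lra.

Set Implicit Arguments.
Unset Strict Implicit.
Unset Printing Implicit Defensive.

Import Order.TTheory GRing.Theory Num.Theory.
Import numFieldTopology.Exports numFieldNormedType.Exports.

Local Open Scope classical_set_scope.
Local Open Scope ring_scope.

Local Notation Re := complex.Re.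
Local Notation Im := complex.Im.
Local Notation toC x := (real_complex _ x : C _).

(** * The complex plane as a metric space *)


(** All contour integrals are means over circles about 0. The exponential turns an annulus into a
    rectangle whose horizontal sides cancel by periodicity, so Goursat's lemma for rectangles yields
    Cauchy's formula without winding numbers.

    The obstacle is uniformity in [m]. Fix a late index [i]. On the circle of radius [r_i] the
    modulus of [f^m] stays below [r_(i+m+1)], while on that of radius [r_(i+3)] it reaches
    [r_(i+m+3)]. For large [m] the ratio of the logarithms of these two bounds exceeds the fixed
    number [ln r_(i+3) / ln r_i], so [B(x) / x] has grown between two radii that do not depend on
    [m].

    Monotonicity is used in contrapositive form: a small bound at [x + pi] gives, by three circles,
    a bound at [x] that is too small.

    The constants fit because [C_n] forces [x <= d ^ 2 / (4 * pi ^ 2) + d]. The Harnack factor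
    exceeds 1 by at most [257 / 50 * pi ^ 2 / d ^ 2]; multiplied by [x], this excess is about 1.3,
    hence below [pi]. *)

Lemma norm_modulus (R : realType) (z : C R) : `|z| = toC (modulus z).
Proof. by rewrite /modulus RRe_real ?normr_real. Qed.

Lemma modulusE (R : realType) (z : C R) : modulus z = Num.sqrt (Re z ^+ 2 + Im z ^+ 2).
Proof. by rewrite /modulus normc_def. Qed.

Lemma modulus_ge0 (R : realType) (z : C R) : 0 <= modulus z.
Proof. by rewrite modulusE sqrtr_ge0. Qed.

Lemma modulus0 (R : realType) : modulus (0 : C R) = 0.
Proof. by rewrite /modulus normr0. Qed.

Lemma modulus1 (R : realType) : modulus (1 : C R) = 1.
Proof. by rewrite /modulus normr1. Qed.

Lemma modulus_eq0 (R : realType) (z : C R) : (modulus z == 0) = (z == 0).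
Proof.
rewrite -(normr_eq0 z) norm_modulus -[in RHS](rmorph0 (real_complex R)).
by apply/eqP/eqP => [->//|/complexI].
Qed.

Lemma modulus_gt0 (R : realType) (z : C R) : (0 < modulus z) = (z != 0).
Proof. by rewrite lt0r modulus_eq0 modulus_ge0 andbT. Qed.

Lemma modulusM (R : realType) (z w : C R) : modulus (z * w) = modulus z * modulus w.
Proof. by apply: complexI; rewrite rmorphM -!norm_modulus normrM. Qed.

Lemma modulusX (R : realType) (z : C R) n : modulus (z ^+ n) = modulus z ^+ n.
Proof. by apply: complexI; rewrite rmorphXn -!norm_modulus normrX. Qed.

Lemma modulusV (R : realType) (z : C R) : modulus z^-1 = (modulus z)^-1.
Proof. by apply: complexI; rewrite fmorphV -!norm_modulus normfV. Qed.

Lemma modulusN (R : realType) (z : C R) : modulus (- z) = modulus z.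
Proof. by rewrite /modulus normrN. Qed.

Lemma modulus_distC (R : realType) (z w : C R) : modulus (z - w) = modulus (w - z).
Proof. by rewrite -opprB modulusN. Qed.

Lemma ler_modulusD (R : realType) (z w : C R) : modulus (z + w) <= modulus z + modulus w.
Proof. by rewrite -lecR rmorphD -!norm_modulus ler_normD. Qed.

Lemma ler_modulusB (R : realType) (z w : C R) : modulus (z - w) <= modulus z + modulus w.
Proof. by rewrite -(modulusN w) ler_modulusD. Qed.

Lemma lerB_modulus (R : realType) (z w : C R) : modulus z - modulus w <= modulus (z - w).
Proof. by rewrite lerBlDr -{1}(subrK w z) ler_modulusD. Qed.

Lemma ler_modulus_distD (R : realType) (u z w : C R) :
  modulus (z - w) <= modulus (z - u) + modulus (u - w).
Proof. by rewrite -{1}(subrK u z) -addrA ler_modulusD. Qed.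

Lemma modulus_real (R : realType) (x : R) : modulus (toC x) = `|x|.
Proof. by rewrite modulusE /= expr0n addr0 sqrtr_sqr. Qed.

Lemma modulus_nat (R : realType) n : modulus (n%:R : C R) = n%:R.
Proof. by apply: complexI; rewrite -norm_modulus normr_nat rmorph_nat. Qed.

Lemma ler_Re_modulus (R : realType) (z : C R) : `|Re z| <= modulus z.
Proof. by rewrite modulusE -sqrtr_sqr ler_wsqrtr// lerDl sqr_ge0. Qed.

Lemma ler_Im_modulus (R : realType) (z : C R) : `|Im z| <= modulus z.
Proof. by rewrite modulusE -sqrtr_sqr ler_wsqrtr// lerDr sqr_ge0. Qed.

Lemma modulusi (R : realType) : modulus ('i%C : C R) = 1.
Proof. by rewrite modulusE /= expr0n add0r expr1n sqrtr1. Qed.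

Lemma complex_ReIm (R : realType) (z : C R) :
  z = toC (Re z) + 'i%C * toC (Im z).
Proof. exact: complexE. Qed.

Lemma ReD (R : realType) (z w : C R) : Re (z + w) = Re z + Re w.
Proof. by case: z => ? ?; case: w. Qed.

Lemma ReB (R : realType) (z w : C R) : Re (z - w) = Re z - Re w.
Proof. by case: z => ? ?; case: w. Qed.

Lemma ImD (R : realType) (z w : C R) : Im (z + w) = Im z + Im w.
Proof. by case: z => ? ?; case: w. Qed.

Lemma ImB (R : realType) (z w : C R) : Im (z - w) = Im z - Im w.
Proof. by case: z => ? ?; case: w. Qed.

Lemma ler_modulus_ReIm (R : realType) (z : C R) : modulus z <= `|Re z| + `|Im z|.
Proof.
rewrite {1}(complex_ReIm z) (le_trans (ler_modulusD _ _))//.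
by rewrite modulusM modulusi mul1r !modulus_real.
Qed.

(* Balls of [C R] have radii in [C R], here traded for real ones. *)
Lemma nbhs_modulus (R : realType) (z : C R) (P : set (C R)) :
  nbhs z P <-> exists2 e : R, 0 < e & forall w, modulus (w - z) < e -> P w.
Proof.
split=> [/nbhs_ballP[e /= e0 sP]|[e e0 sP]].
  have eE : e = toC (Re e) by rewrite RRe_real ?gtr0_real.
  exists (Re e) => [|w wz]; first by rewrite -ltcR -[X in _ < X]eE.
  by apply: sP; rewrite /ball /= distrC norm_modulus eE ltcR.
apply/nbhs_ballP; exists (toC e); first by rewrite /= ltcR.
by move=> w; rewrite /ball /= distrC norm_modulus ltcR; exact: sP.
Qed.

Lemma nbhs_realP (R : realType) (x : R) (P : set R) :
  nbhs x P <-> exists2 e : R, 0 < e & forall y, `|y - x| < e -> P y.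
Proof.
split=> [/nbhs_ballP[e /= e0 sP]|[e e0 sP]].
  by exists e => // w wz; apply: sP; rewrite /ball /= distrC.
by apply/nbhs_ballP; exists e => //= y; rewrite /ball /= distrC; exact: sP.
Qed.

Lemma cvg_modulus (R : realType) (T : Type) (F : set_system T) (g : T -> C R) (l : C R)
    {FF : Filter F} :
  g @ F --> l <-> forall e : R, 0 < e -> \forall x \near F, modulus (g x - l) < e.
Proof.
split=> [gl e e0|H P /nbhs_modulus[e e0 sP]].
  by apply: (gl [set w | modulus (w - l) < e]); apply/nbhs_modulus; exists e.
by have := H e e0; apply: filterS => x; exact: sP.
Qed.

Lemma continuous_modulusP (R : realType) (T : topologicalType) (g : T -> C R) (x : T) :
  {for x, continuous g} <->
  forall e : R, 0 < e -> \forall y \near x, modulus (g y - g x) < e.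
Proof. by split=> [H|H]; apply/cvg_modulus. Qed.

Lemma continuous_CP (R : realType) (g : C R -> C R) (z : C R) :
  {for z, continuous g} <-> forall e : R, 0 < e ->
    exists2 d : R, 0 < d & forall w, modulus (w - z) < d -> modulus (g w - g z) < e.
Proof.
split=> [/continuous_modulusP H e e0|H]; [|apply/continuous_modulusP => e e0];
  have := H e e0.
  by move/nbhs_modulus.
by move=> ?; apply: (nbhs_modulus z _).2.
Qed.

Lemma continuous_RCP (R : realType) (g : R -> C R) (x : R) :
  {for x, continuous g} <-> forall e : R, 0 < e ->
    exists2 d : R, 0 < d & forall y, `|y - x| < d -> modulus (g y - g x) < e.
Proof.
split=> [/continuous_modulusP H e e0|H]; [|apply/continuous_modulusP => e e0];
  have := H e e0.
  by move/nbhs_realP.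
by move=> ?; apply: (nbhs_realP x _).2.
Qed.

Lemma continuous_modulus (R : realType) : continuous (@modulus R).
Proof.
move=> z P /nbhs_realP[e e0 sP]; apply: (nbhs_modulus z _).2.
exists e => // w wz; apply: sP; apply: le_lt_trans wz; rewrite ler_norml lerNl opprB lerB_modulus.
by rewrite modulus_distC lerB_modulus.
Qed.

Lemma continuous_toC (R : realType) : continuous (fun x : R => toC x).
Proof.
move=> x; apply/continuous_RCP => e e0; exists e => // y.
by rewrite -rmorphB modulus_real.
Qed.

Lemma dnbhs_modulus (R : realType) (z : C R) (P : set (C R)) :
  dnbhs z P <->
  exists2 e : R, 0 < e & forall w, modulus (w - z) < e -> w != z -> P w.
Proof. exact: nbhs_modulus. Qed.

(** Without a quotient the point [w = z] need not be excluded, and estimates compose by the triangle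
    inequality alone. *)
Lemma derivable_modulusP (R : realType) (f : C R -> C R) (z l : C R) :
  is_derive z (1 : C R) f l <-> forall e : R, 0 < e ->
    exists2 d : R, 0 < d & forall w, modulus (w - z) < d ->
      modulus (f w - f z - l * (w - z)) <= e * modulus (w - z).
Proof.
split=> [[df dfl] e e0|H].
  have cl : (fun h : C R => h^-1 *: ((f \o shift z) (h *: (1 : C R)) - f z)) @ 0^' --> l.
    by case: _ / dfl; exact: df.
  have := (cvg_modulus (FF := dnbhs_filter _) _ _).1 cl e e0.
  move=> /dnbhs_modulus[d d0 dP]; exists d => // w wz.
  have [->|wz0] := eqVneq w z; first by rewrite !subrr mulr0 subrr modulus0 mulr0.
  have := dP (w - z); rewrite subr0 => /(_ wz); rewrite subr_eq0 => /(_ wz0) /ltW.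
  rewrite /= [(w - z) *: 1]mulr1.
  rewrite subrK => le; have -> : f w - f z - l * (w - z) = ((w - z)^-1 * (f w - f z) - l) * (w - z).
    by rewrite mulrBl mulrAC mulVf ?mul1r// subr_eq0.
  by rewrite modulusM ler_wpM2r ?modulus_ge0.
have cl : (fun h : C R => h^-1 *: ((f \o shift z) (h *: 1) - f z)) @ 0^' --> l.
  apply/cvg_modulus => e e0; have [d d0 dP] := H (e / 2) (divr_gt0 e0 (ltr0n _ 2)).
  apply/dnbhs_modulus; exists d => // h; rewrite subr0 => hd h0.
  rewrite /GRing.scale /= mulr1.
  have := dP (h + z); rewrite addrK => /(_ hd).
  have -> : h^-1 * (f (h + z) - f z) - l = (f (h + z) - f z - l * h) * h^-1.
    by rewrite [RHS]mulrBl mulfK// mulrC.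
  rewrite modulusM modulusV => le.
  apply: (@le_lt_trans _ _ (e / 2)); last by lra.
  by rewrite ler_pdivrMr// modulus_gt0.
split; first by apply/cvg_ex; exists l.
by rewrite /derive; apply: cvg_lim cl; exact: norm_hausdorff.
Qed.

Lemma derivable_ex (R : realType) (f : C R -> C R) (z : C R) :
  derivable f z 1 <-> exists l : C R, is_derive z (1 : C R) f l.
Proof. by split=> [/derivableP df|[l []//]]; eexists; exact: df. Qed.

Lemma derivable_continuousC (R : realType) (f : C R -> C R) (z : C R) :
  derivable f z 1 -> {for z, continuous f}.
Proof. by move=> /derivable1_diffP; exact: differentiable_continuous. Qed.

Lemma derivable_compC (R : realType) (f g : C R -> C R) (z : C R) :
  derivable f z 1 -> derivable g (f z) 1 -> derivable (g \o f) z 1.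
Proof.
move=> /derivable1_diffP df /derivable1_diffP dg.
have dgf := differentiable_comp df dg.
by move/derivable1_diffP : dgf.
Qed.

Lemma derivableDC (R : realType) (f g : C R -> C R) (z : C R) :
  derivable f z 1 -> derivable g z 1 -> derivable (fun w => f w + g w) z 1.
Proof. exact: derivableD. Qed.

Lemma derivableBC (R : realType) (f g : C R -> C R) (z : C R) :
  derivable f z 1 -> derivable g z 1 -> derivable (fun w => f w - g w) z 1.
Proof. exact: derivableB. Qed.

Lemma derivableMC (R : realType) (f g : C R -> C R) (z : C R) :
  derivable f z 1 -> derivable g z 1 -> derivable (fun w => f w * g w) z 1.
Proof. exact: derivableM. Qed.

Lemma derivableVC (R : realType) (f : C R -> C R) (z : C R) :
  f z != 0 -> derivable f z 1 -> derivable (fun w => (f w)^-1) z 1.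
Proof. exact: derivableV. Qed.

Lemma derivableXC (R : realType) (f : C R -> C R) (z : C R) n :
  derivable f z 1 -> derivable (fun w => f w ^+ n) z 1.
Proof.
move=> df; elim: n => [|n IH].
  by under [fun w => _]funext do rewrite expr0; exact: derivable_cst.
by under [fun w => _]funext do rewrite exprS; exact: derivableMC.
Qed.

Lemma derivable_cstC (R : realType) (c z : C R) : derivable (fun=> c) z 1.
Proof. exact: derivable_cst. Qed.

Lemma derivable_idC (R : realType) (z : C R) : derivable (fun w : C R => w) z 1.
Proof. exact: derivable_id. Qed.

Lemma continuousMC (R : realType) (f g : C R -> C R) (z : C R) :
  {for z, continuous f} -> {for z, continuous g} ->
  {for z, continuous (fun w => f w * g w)}.
Proof. by move=> cf cg; exact: (cvgM cf cg). Qed.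

Lemma continuous_idC (R : realType) (z : C R) : {for z, continuous (fun w : C R => w)}.
Proof. exact: cvg_id. Qed.

Ltac derivC :=
  cbv beta;
  match goal with
  | H : derivable ?f ?z _ |- derivable ?f ?z _ => exact H
  | |- derivable (fun _ => ?c) _ _ => exact (@derivable_cstC _ c _)
  | |- derivable (fun w => w) _ _ => exact (@derivable_idC _ _)
  | |- derivable (fun w => @?f w - @?g w) ?z _ =>
      refine (@derivableBC _ f g z _ _); derivC
  | |- derivable (fun w => @?f w + @?g w) ?z _ =>
      refine (@derivableDC _ f g z _ _); derivC
  | |- derivable (fun w => @?f w * @?g w) ?z _ =>
      refine (@derivableMC _ f g z _ _); derivC
  | |- derivable (fun w => @?f w ^+ ?n) ?z _ =>
      refine (@derivableXC _ f z n _); derivC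
  | |- derivable (fun w => (@?f w)^-1) ?z _ =>
      refine (@derivableVC _ f z _ _); [cbv beta|derivC]
  | |- derivable (fun w => ?f w) ?z _ => change (derivable f z 1); derivC
  | _ => idtac
  end.

(** * Integration over a segment *)

(** If [P K] failed, the sets whose complement in [K] satisfies [P] would form a proper filter, and
    a cluster point in [K] would contradict the local hypothesis. This induction over a compact set
    replaces the extraction of finite subcovers. *)
Lemma compact_local (T : topologicalType) (K : set T) (P : set T -> Prop) :
  compact K -> P set0 -> (forall A B, A `<=` B -> P B -> P A) ->
  (forall A B, P A -> P B -> P (A `|` B)) ->
  (forall x, K x -> exists2 V, nbhs x V & P V) -> P K.
Proof.
move=> cK P0 Psub PU Ploc; apply: contrapT => nPK.
pose F : set_system T := [set S | P (K `\` S)].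
have FF : ProperFilter F.
  split; first by rewrite /F /= setD0.
  split.
  - by rewrite /F /= setDT.
  - by move=> A B; rewrite /F /= setDIr; exact: PU.
  - by move=> A B AB; apply: Psub => x [Kx nBx]; split=> // /AB.
have [|x [Kx clx]] := cK F FF.
  by rewrite /F /= setDv.
have [V Vx PV] := Ploc x Kx.
have FV : F (~` V).
  by apply: Psub PV => y [_ /contrapT].
by have [y [nVy Vy]] := clx _ _ FV Vx.
Qed.

(** An abstract [dist] serves both [R] and [C R]. The point [y] may lie outside [K], which permits
    comparing a circle with its neighbours. *)
Lemma compact_uniform (R : realType) (T : topologicalType) (dist : T -> T -> R)
    (nbhsE : forall x (P : set T), nbhs x P <->
       exists2 e : R, 0 < e & forall y, dist y x < e -> P y)
    (distD : forall x y z, dist x z <= dist x y + dist y z)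
    (K : set T) (h : T -> C R) :
  compact K -> (forall x, K x -> {for x, continuous h}) ->
  forall e : R, 0 < e -> exists2 d : R, 0 < d &
    forall x, K x -> forall y, dist y x < d -> modulus (h y - h x) < e.
Proof.
move=> cK ch e e0; pose P (S : set T) := exists2 d : R, 0 < d &
    forall x, S x -> forall y, dist y x < d -> modulus (h y - h x) < e.
apply: (@compact_local T K P) => //.
- by exists 1.
- by move=> A B AB [d d0 Bd]; exists d => // x /AB; exact: Bd.
- move=> A B [d d0 Ad] [d' d'0 Bd]; exists (Num.min d d').
    by rewrite lt_min d0.
  by move=> x [Ax|Bx] y; rewrite lt_min => /andP[? ?]; [apply: Ad|apply: Bd].
move=> x /ch /continuous_modulusP /(_ (e / 2) (divr_gt0 e0 (ltr0n _ 2))).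
move=> /nbhsE[d d0 dP]; exists [set y | dist y x < d / 2].
  by apply/nbhsE; exists (d / 2) => //; rewrite divr_gt0.
exists (d / 2); rewrite ?divr_gt0// => y /= yx z zy.
have zx : modulus (h z - h x) < e / 2.
  by apply: dP; apply: le_lt_trans (distD z y x) _; rewrite [d]splitr ltrD.
have yx' : modulus (h y - h x) < e / 2.
  by apply: dP; apply: lt_trans yx _; rewrite ltr_pdivrMr// mulr_natr mulr2n ltrDl.
rewrite modulus_distC in yx'.
by have := ler_modulus_distD (h x) (h z) (h y); lra.
Qed.

Lemma uniform_segment (R : realType) (h : R -> C R) :
  (forall s, 0 <= s <= 1 -> {for s, continuous h}) ->
  forall e : R, 0 < e -> exists2 d : R, 0 < d &
    forall s, 0 <= s <= 1 -> forall t, `|t - s| < d -> modulus (h t - h s) < e.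
Proof.
move=> ch e e0.
have [|d d0 dP] := @compact_uniform R R (fun x y => `|x - y|) (@nbhs_realP R)
  (fun x y z => ler_distD y x z) `[0, 1] h (@segment_compact _ _ _) _ e e0.
  by move=> s; rewrite /= in_itv /=; exact: ch.
by exists d => // s s01; apply: dP; rewrite /= in_itv.
Qed.

Lemma uniform_compactC (R : realType) (K : set (C R)) (h : C R -> C R) :
  compact K -> (forall x, K x -> {for x, continuous h}) ->
  forall e : R, 0 < e -> exists2 d : R, 0 < d &
    forall x, K x -> forall y, modulus (y - x) < d -> modulus (h y - h x) < e.
Proof.
exact: (@compact_uniform R (C R) (fun x y => modulus (x - y)) (@nbhs_modulus R)
  (fun x y z => ler_modulus_distD y x z)).
Qed.

Lemma compact_bounded_modulus (R : realType) (T : topologicalType) (K : set T) (h : T -> C R) :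
  compact K -> (forall x, K x -> {for x, continuous h}) ->
  exists2 M : R, 0 < M & forall x, K x -> modulus (h x) <= M.
Proof.
move=> cK ch.
apply: (@compact_local T K (fun S => exists2 M : R, 0 < M & forall x, S x -> modulus (h x) <= M)) => //.
- by exists 1.
- by move=> A B AB [M M0 BM]; exists M => // x /AB; exact: BM.
- move=> A B [d d0 Ad] [d' d'0 Bd]; exists (Num.max d d').
    by rewrite lt_max d0.
  by move=> x [Ax|Bx]; rewrite le_max; apply/orP; [left; apply: Ad|right; apply: Bd].
move=> x /ch /continuous_modulusP /(_ 1 ltr01) V.
exists [set y | modulus (h y - h x) < 1] => //.
exists (modulus (h x) + 1); first by rewrite ltr_wpDl ?modulus_ge0.
by move=> y /= hyx; have := lerB_modulus (h y) (h x); lra.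
Qed.

(** * Limits of sequences and dyadic means *)

Definition cvg_seqC (R : realType) (u : nat -> C R) (l : C R) :=
  forall e : R, 0 < e -> exists N, forall n, (N <= n)%N -> modulus (u n - l) < e.

Definition cauchy_seqC (R : realType) (u : nat -> C R) :=
  forall e : R, 0 < e -> exists N, forall n m, (N <= n)%N -> (N <= m)%N ->
    modulus (u n - u m) < e.

Lemma cvg_seqRP (R : realType) (u : nat -> R) (l : R) :
  u @ \oo --> l <->
  forall e : R, 0 < e -> exists N, forall n, (N <= n)%N -> `|u n - l| < e.
Proof.
split=> [/cvgrPdist_lt H e /H[N _ NP]|H].
  by exists N => n Nn; rewrite distrC; exact: NP.
apply/cvgrPdist_lt => e /H[N NP]; exists N => // n Nn.
by rewrite distrC; exact: NP.
Qed.

Lemma cauchy_seqR_cvg (R : realType) (u : nat -> R) :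
  (forall e : R, 0 < e -> exists N, forall n m, (N <= n)%N -> (N <= m)%N ->
    `|u n - u m| < e) -> exists l : R, u @ \oo --> l.
Proof.
move=> H; suff : cvg (u @ \oo) by move=> ?; exists (lim (u @ \oo)).
apply/cauchy_cvgP/cauchy_ballP => e e0; have [N NP] := H e e0.
exists ([set u n | n in [set n | (N <= n)%N]], [set u n | n in [set n | (N <= n)%N]]).
  by split; exists N => // n Nn; exists n.
by move=> [x y] [/= [n Nn <-] [m Nm <-]]; exact: NP.
Qed.

Lemma cauchy_seqC_cvg (R : realType) (u : nat -> C R) :
  cauchy_seqC u -> exists l, cvg_seqC u l.
Proof.
move=> H.
have [|a /cvg_seqRP ua] := @cauchy_seqR_cvg R (fun n => Re (u n)).
  move=> e /H[N NP]; exists N => n m Nn Nm.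
  by rewrite -ReB (le_lt_trans (ler_Re_modulus _))// NP.
have [|b /cvg_seqRP ub] := @cauchy_seqR_cvg R (fun n => Im (u n)).
  move=> e /H[N NP]; exists N => n m Nn Nm.
  by rewrite -ImB (le_lt_trans (ler_Im_modulus _))// NP.
exists (Complex a b) => e e0.
have [N NP] := ua _ (divr_gt0 e0 (ltr0n _ 2)).
have [M MP] := ub _ (divr_gt0 e0 (ltr0n _ 2)).
exists (maxn N M) => n; rewrite geq_max => /andP[/NP un /MP vn].
rewrite (le_lt_trans (ler_modulus_ReIm _))// ReB ImB /=; lra.
Qed.

Lemma cvg_seqC_unique (R : realType) (u : nat -> C R) (l l' : C R) :
  cvg_seqC u l -> cvg_seqC u l' -> l = l'.
Proof.
move=> ul ul'; apply/eqP; rewrite -subr_eq0 -modulus_eq0; apply/eqP/le_anti.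
rewrite modulus_ge0 andbT leNgt; apply/negP => e0.
have [N NP] := ul _ (divr_gt0 e0 (ltr0n _ 2)).
have [M MP] := ul' _ (divr_gt0 e0 (ltr0n _ 2)).
have := NP _ (leq_maxl N M); have := MP _ (leq_maxr N M).
have := ler_modulus_distD (u (maxn N M)) l l'.
by rewrite (modulus_distC l (u _)); lra.
Qed.

Lemma cvg_seqCD (R : realType) (u v : nat -> C R) (l m : C R) :
  cvg_seqC u l -> cvg_seqC v m -> cvg_seqC (fun n => u n + v n) (l + m).
Proof.
move=> ul vm e e0.
have [N NP] := ul _ (divr_gt0 e0 (ltr0n _ 2)).
have [M MP] := vm _ (divr_gt0 e0 (ltr0n _ 2)).
exists (maxn N M) => n; rewrite geq_max => /andP[/NP un /MP vn].
rewrite opprD addrACA (le_lt_trans (ler_modulusD _ _))//; lra.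
Qed.

Lemma cvg_seqCZ (R : realType) (u : nat -> C R) (c l : C R) :
  cvg_seqC u l -> cvg_seqC (fun n => c * u n) (c * l).
Proof.
move=> ul e e0; have c0 : 0 < modulus c + 1 by rewrite ltr_wpDl ?modulus_ge0.
have [N NP] := ul _ (divr_gt0 e0 c0).
exists N => n /NP; rewrite -mulrBr modulusM ltr_pdivlMr// mulrC; apply: le_lt_trans.
by rewrite ler_wpM2r ?modulus_ge0// lerDl.
Qed.

Lemma cvg_seqC_cst (R : realType) (l : C R) : cvg_seqC (fun=> l) l.
Proof. by move=> e e0; exists 0%N => n _; rewrite subrr modulus0. Qed.

Lemma cvg_seqC_le (R : realType) (u : nat -> C R) (l : C R) (M : R) :
  cvg_seqC u l -> (forall n, modulus (u n) <= M) -> modulus l <= M.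
Proof.
move=> ul uM; rewrite leNgt; apply/negP => lM.
have [N NP] := ul (modulus l - M) ltac:(lra).
have := NP _ (leqnn N); have := uM N; rewrite modulus_distC.
by have := lerB_modulus l (u N); lra.
Qed.

(* [dyadic_mean n h] is the mean of [h] over the points [j / 2 ^ n] with [j < 2 ^ n]. *)
Fixpoint dyadic_mean (R : realType) (n : nat) (h : R -> C R) : C R :=
  if n is m.+1 then
    2^-1 * (dyadic_mean m (fun s => h (s / 2)) + dyadic_mean m (fun s => h ((s + 1) / 2)))
  else h 0.

Lemma modulus_half (R : realType) : modulus (2^-1 : C R) = 2^-1.
Proof. by rewrite modulusV modulus_nat. Qed.

Lemma half_in01 (R : realType) (s : R) : 0 <= s <= 1 -> 0 <= s / 2 <= 1.
Proof. lra. Qed.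

Lemma half1_in01 (R : realType) (s : R) : 0 <= s <= 1 -> 0 <= (s + 1) / 2 <= 1.
Proof. lra. Qed.

Lemma dyadic_mean_le (R : realType) n (h : R -> C R) (M : R) :
  (forall s, 0 <= s <= 1 -> modulus (h s) <= M) -> modulus (dyadic_mean n h) <= M.
Proof.
elim: n h => [|n IH] h hM /=; first by apply: hM; rewrite lexx ler01.
rewrite modulusM modulus_half.
have := ler_modulusD (dyadic_mean n (fun s => h (s / 2))) (dyadic_mean n (fun s => h ((s + 1) / 2))).
have := IH (fun s => h (s / 2)) (fun s s01 => hM _ (half_in01 s01)).
have := IH (fun s => h ((s + 1) / 2)) (fun s s01 => hM _ (half1_in01 s01)).
by lra.
Qed.

Lemma dyadic_meanD (R : realType) n (h k : R -> C R) :
  dyadic_mean n (fun s => h s + k s) = dyadic_mean n h + dyadic_mean n k.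
Proof. by elim: n h k => [//|n IH] h k /=; rewrite !IH; ring. Qed.

Lemma dyadic_meanZ (R : realType) n (c : C R) (h : R -> C R) :
  dyadic_mean n (fun s => c * h s) = c * dyadic_mean n h.
Proof. by elim: n h => [//|n IH] h /=; rewrite !IH; ring. Qed.

Lemma dyadic_mean_cst (R : realType) n (c : C R) :
  dyadic_mean n (fun _ : R => c) = c.
Proof. by elim: n => [//|n IH] /=; rewrite !IH; field. Qed.

Lemma dyadic_mean_id (R : realType) n :
  dyadic_mean n (fun s : R => toC s) = 2^-1 * (1 - 2^-1 ^+ n).
Proof.
elim: n => [|n IH] /=; first by rewrite rmorph0 expr0 subrr mulr0.
have -> : (fun s : R => toC (s / 2)) = (fun s => 2^-1 * toC s).
  by apply/funext => s; rewrite rmorphM fmorphV rmorph_nat mulrC.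
have -> : (fun s : R => toC ((s + 1) / 2)) = (fun s => 2^-1 * (toC s + 1)).
  by apply/funext => s; rewrite rmorphM fmorphV rmorph_nat rmorphD rmorph1 mulrC.
by rewrite !dyadic_meanZ dyadic_meanD dyadic_mean_cst IH exprS; field.
Qed.

Lemma dyadic_meanB (R : realType) n (h k : R -> C R) :
  dyadic_mean n (fun s => h s - k s) = dyadic_mean n h - dyadic_mean n k.
Proof. by elim: n h k => [//|n IH] h k /=; rewrite !IH; ring. Qed.

(** On each of the [2 ^ n] subintervals, a mean over finer points is compared with the value at the
    left end. In the induction, passing to one half of the interval doubles the scale on which the
    oscillation is controlled. *)
Lemma dyadic_mean_cauchy (R : realType) n k (h : R -> C R) (e : R) :
  (forall s t, 0 <= s <= 1 -> 0 <= t <= 1 -> `|t - s| <= 2^-1 ^+ n ->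
    modulus (h t - h s) <= e) ->
  modulus (dyadic_mean (n + k) h - dyadic_mean n h) <= e.
Proof.
elim: n h => [|n IH] h he.
  rewrite add0n /= -(dyadic_mean_cst k (h 0)) -dyadic_meanB.
  apply: dyadic_mean_le => s s01; apply: he => //; first by rewrite lexx ler01.
  by rewrite expr0 subr0 ger0_norm; lra.
rewrite addSn /= -mulrBr modulusM modulus_half opprD addrACA.
have step (g : R -> R) : (forall s, 0 <= s <= 1 -> 0 <= g s <= 1) ->
    (forall s t, g t - g s = (t - s) / 2) ->
    modulus (dyadic_mean (n + k) (h \o g) - dyadic_mean n (h \o g)) <= e.
  move=> g01 gE; apply: IH => s t s01 t01 st; apply: he; rewrite ?g01//.
  by rewrite gE normrM exprS [`|2^-1|]ger0_norm ?invr_ge0//; lra.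
have A := step (fun s => s / 2) (@half_in01 R) (fun s t => esym (mulrBl _ _ _)).
have B : modulus (dyadic_mean (n + k) (h \o (fun s => (s + 1) / 2)) -
    dyadic_mean n (h \o (fun s => (s + 1) / 2))) <= e.
  by apply: step (@half1_in01 R) _ => s t; lra.
have := ler_modulusD (dyadic_mean (n + k) (h \o (fun s => s / 2)) - dyadic_mean n (h \o (fun s => s / 2)))
  (dyadic_mean (n + k) (h \o (fun s => (s + 1) / 2)) - dyadic_mean n (h \o (fun s => (s + 1) / 2))).
rewrite /comp in A B *; lra.
Qed.

Definition seg_continuous (R : realType) (h : R -> C R) :=
  forall s : R, 0 <= s <= 1 -> {for s, continuous h}.

Lemma half_expn_small (R : realType) (e : R) : 0 < e -> exists n, (2^-1 : R) ^+ n < e.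
Proof.
move=> e0; have /cvg_seqRP/(_ e e0)[N NP] := @cvg_geometric R 1 2^-1 ltac:(rewrite ger0_norm; lra).
by exists N; have := NP N (leqnn N); rewrite subr0 /geometric /= mul1r; apply: le_lt_trans; exact: ler_norm.
Qed.

Lemma dyadic_mean_cvg (R : realType) (h : R -> C R) :
  seg_continuous h -> exists l, cvg_seqC (fun n => dyadic_mean n h) l.
Proof.
move=> ch; apply: cauchy_seqC_cvg => e e0.
have [d d0 dP] := uniform_segment ch (divr_gt0 e0 (ltr0n _ 3)).
have [N Nd] := half_expn_small d0.
have H n : (N <= n)%N -> modulus (dyadic_mean n h - dyadic_mean N h) <= e / 3.
  move=> /subnKC <-; apply: dyadic_mean_cauchy => s t s01 t01 st.
  by apply/ltW/dP => //; exact: le_lt_trans Nd.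
exists N => n m /H nN /H; rewrite modulus_distC => mN.
by have := ler_modulus_distD (dyadic_mean N h) (dyadic_mean n h) (dyadic_mean m h); lra.
Qed.

(* The integral over [[0, 1]]. *)
Definition mean (R : realType) (h : R -> C R) : C R :=
  xget 0 [set l | cvg_seqC (fun n => dyadic_mean n h) l].

Lemma mean_cvg (R : realType) (h : R -> C R) :
  seg_continuous h -> cvg_seqC (fun n => dyadic_mean n h) (mean h).
Proof.
by move=> /dyadic_mean_cvg[l hl]; rewrite /mean; apply: (@xgetI _ 0 [set l | cvg_seqC _ l] l).
Qed.

Lemma mean_eq (R : realType) (h : R -> C R) (l : C R) :
  cvg_seqC (fun n => dyadic_mean n h) l -> mean h = l.
Proof.
move=> hl; apply: (cvg_seqC_unique _ hl).
by rewrite /mean; apply: (@xgetI _ 0 [set l | cvg_seqC _ l] l).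
Qed.

Lemma meanD (R : realType) (h k : R -> C R) :
  seg_continuous h -> seg_continuous k ->
  mean (fun s => h s + k s) = mean h + mean k.
Proof.
move=> /mean_cvg ch /mean_cvg ck; apply: mean_eq.
under [fun n => _]funext do rewrite dyadic_meanD.
exact: cvg_seqCD.
Qed.

Lemma meanZ (R : realType) (c : C R) (h : R -> C R) :
  seg_continuous h -> mean (fun s => c * h s) = c * mean h.
Proof.
move=> /mean_cvg ch; apply: mean_eq.
under [fun n => _]funext do rewrite dyadic_meanZ.
exact: cvg_seqCZ.
Qed.

Lemma meanB (R : realType) (h k : R -> C R) :
  seg_continuous h -> seg_continuous k ->
  mean (fun s => h s - k s) = mean h - mean k.
Proof.
move=> /mean_cvg ch /mean_cvg ck; apply: mean_eq.
under [fun n => _]funext do rewrite dyadic_meanB -[- dyadic_mean _ k]mulN1r.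
by rewrite -[- mean k]mulN1r; apply: cvg_seqCD => //; exact: cvg_seqCZ.
Qed.

Lemma mean_cst (R : realType) (c : C R) : mean (fun _ : R => c) = c.
Proof.
apply: mean_eq; under [fun n => _]funext do rewrite dyadic_mean_cst.
exact: cvg_seqC_cst.
Qed.

Lemma mean_id (R : realType) : mean (fun s : R => toC s) = 2^-1.
Proof.
apply: mean_eq => e e0; have [N Ne] := half_expn_small e0.
exists N => n Nn; rewrite dyadic_mean_id mulrBr mulr1 addrAC subrr add0r modulusN.
rewrite modulusM modulusX modulus_half; apply: le_lt_trans Ne.
have := @ler_wiXn2l R 2^-1 ltac:(lra) ltac:(lra) _ _ Nn.
have : 0 <= (2^-1 : R) ^+ n by rewrite exprn_ge0// invr_ge0.
lra.
Qed.

Lemma mean_le (R : realType) (h : R -> C R) (M : R) : seg_continuous h ->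
  (forall s, 0 <= s <= 1 -> modulus (h s) <= M) -> modulus (mean h) <= M.
Proof.
by move=> /mean_cvg ch hM; apply: cvg_seqC_le ch _ => n; exact: dyadic_mean_le.
Qed.

Lemma seg_continuousB (R : realType) (h k : R -> C R) :
  seg_continuous h -> seg_continuous k -> seg_continuous (fun s => h s - k s).
Proof. by move=> ch ck s s01; apply: cvgB; [exact: ch|exact: ck]. Qed.

Lemma seg_continuousM (R : realType) (h k : R -> C R) :
  seg_continuous h -> seg_continuous k -> seg_continuous (fun s => h s * k s).
Proof. by move=> ch ck s s01; apply: cvgM; [exact: ch|exact: ck]. Qed.

Lemma seg_continuous_cst (R : realType) (c : C R) : seg_continuous (fun=> c).
Proof. by move=> s s01; exact: cvg_cst. Qed.

(** The dyadic sums agree exactly, so the two values chosen by [xget] coincide even where no limit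
    exists. *)
Lemma eq_mean (R : realType) (h k : R -> C R) :
  (forall s, 0 <= s <= 1 -> h s = k s) -> mean h = mean k.
Proof.
move=> hk; rewrite /mean; suff -> : (fun n => dyadic_mean n h) = (fun n => dyadic_mean n k) by [].
apply/funext => n; apply/eqP; rewrite -subr_eq0 -dyadic_meanB -modulus_eq0.
apply/eqP/le_anti; rewrite modulus_ge0 andbT; apply: dyadic_mean_le => s s01.
by rewrite hk// subrr modulus0.
Qed.

Lemma seg_continuous_affine (R : realType) (h : R -> C R) (a b : R) :
  seg_continuous h -> 0 <= b <= 1 -> 0 <= a + b <= 1 ->
  seg_continuous (fun s => h (s * a + b)).
Proof.
move=> ch b01 ab01 s s01.
have cf : {for s, continuous (fun s : R => s * a + b)}.
  by apply: cvgD; [apply: cvgM; [exact: cvg_id|exact: cvg_cst]|exact: cvg_cst].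
have cg : {for s * a + b, continuous h} by apply: ch; nra.
exact: (@continuous_comp R R (C R) _ h s cf cg).
Qed.

(** The recursion of [dyadic_mean] is this identity at every level; dyadic sums make the bisection
    in Goursat's lemma immediate. *)
Lemma mean_split (R : realType) (h : R -> C R) : seg_continuous h ->
  mean h = 2^-1 * (mean (fun s => h (s / 2)) + mean (fun s => h ((s + 1) / 2))).
Proof.
move=> ch.
have c1 : seg_continuous (fun s => h (s / 2)).
  have := seg_continuous_affine ch (a := 2^-1) (b := 0) ltac:(lra) ltac:(lra).
  by under [fun s => h (s * _ + 0)]funext do rewrite addr0.
have c2 : seg_continuous (fun s => h ((s + 1) / 2)).
  have := seg_continuous_affine ch (a := 2^-1) (b := 2^-1) ltac:(lra) ltac:(lra).
  by under [fun s => h (s * _ + _)]funext do rewrite -[X in _ + X]mul1r -mulrDl.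
apply: (@cvg_seqC_unique _ (fun n => dyadic_mean n.+1 h)).
  move=> e e0; have [N NP] := mean_cvg ch e0.
  by exists N => n Nn; apply: NP; exact: leqW.
by apply: cvg_seqCZ; apply: cvg_seqCD; exact: mean_cvg.
Qed.

(** * The complex exponential *)

Definition cexp (R : realType) (t : C R) : C R :=
  Complex (expR (Re t) * cos (Im t)) (expR (Re t) * sin (Im t)).

Lemma cexpD (R : realType) (t u : C R) : cexp (t + u) = cexp t * cexp u.
Proof.
rewrite /cexp ReD ImD expRD cosD sinD.
by apply/eqP; rewrite eq_complex /=; apply/andP; split; apply/eqP; ring.
Qed.

Lemma cexp0 (R : realType) : cexp (0 : C R) = 1.
Proof. by rewrite /cexp /= expR0 cos0 sin0 mulr1 mulr0. Qed.

Lemma modulus_cexp (R : realType) (t : C R) : modulus (cexp t) = expR (Re t).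
Proof.
rewrite modulusE /= !exprMn -mulrDr cos2Dsin2 mulr1 sqrtr_sqr ger0_norm// expR_ge0.
Qed.

Lemma cexp_neq0 (R : realType) (t : C R) : cexp t != 0.
Proof. by rewrite -modulus_gt0 modulus_cexp expR_gt0. Qed.

Lemma cexp_real (R : realType) (x : R) : cexp (toC x) = toC (expR x).
Proof. by rewrite /cexp /= cos0 sin0 mulr1 mulr0. Qed.

Lemma Re_i_real (R : realType) (u : R) : Re ('i%C * toC u) = 0.
Proof. by rewrite /= mul0r mul1r subr0. Qed.

Lemma Im_i_real (R : realType) (u : R) : Im ('i%C * toC u) = u.
Proof. by rewrite /= mul0r mul1r add0r. Qed.

Lemma cexp_i (R : realType) (u : R) :
  cexp ('i%C * toC u : C R) = Complex (cos u) (sin u).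
Proof. by rewrite /cexp Re_i_real Im_i_real expR0 !mul1r. Qed.

Lemma cexp_2pi (R : realType) : cexp ('i%C * toC (pi *+ 2) : C R) = 1.
Proof. by rewrite cexp_i cos2pi sin2pi. Qed.

Lemma cexp_periodic (R : realType) (t : C R) : cexp (t + 'i%C * toC (pi *+ 2)) = cexp t.
Proof. by rewrite cexpD cexp_2pi mulr1. Qed.

Lemma unit_circle_angle (R : realType) (x y : R) : x ^+ 2 + y ^+ 2 = 1 ->
  exists2 u : R, - pi <= u <= pi & cos u = x /\ sin u = y.
Proof.
move=> xy1; have x1 : -1 <= x <= 1 by apply/andP; split; nra.
have cx : cos (acos x) = x by rewrite acosK// in_itv.
have sx : sin (acos x) = `|y|.
  by rewrite sin_acos// -xy1 addrAC subrr add0r sqrtr_sqr.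
have [a0 api] := (acos_ge0 x1, acos_lepi x1); have := @pi_ge0 R => p0.
have [y0|y0] := leP 0 y.
  exists (acos x); first lra.
  by rewrite cx sx ger0_norm.
exists (- acos x); first lra.
by rewrite cosN sinN cx sx ltr0_norm// opprK.
Qed.

Lemma toCM_complex (R : realType) (m x y : R) :
  toC m * Complex x y = Complex (m * x) (m * y).
Proof. by apply/eqP; rewrite eq_complex /= !mul0r subr0 addr0 !eqxx. Qed.

(** The normalisation of the angle to absolute value at most [pi] later bounds the vertical
    displacement in the Harnack estimate. *)
Lemma polarP (R : realType) (z : C R) : z != 0 ->
  exists2 u : R, - pi <= u <= pi & z = toC (modulus z) * cexp ('i%C * toC u).
Proof.
move=> z0; have m0 : 0 < modulus z by rewrite modulus_gt0.
have [|u ub [cu su]] := @unit_circle_angle R (Re z / modulus z) (Im z / modulus z).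
  rewrite !exprMn -mulrDl modulusE exprVn sqr_sqrtr ?addr_ge0 ?sqr_ge0// divff//.
  by rewrite -[X in X != 0]sqr_sqrtr ?addr_ge0 ?sqr_ge0// -modulusE expf_neq0// gt_eqF.
exists u => //; rewrite cexp_i cu su.
have mk (t : R) : modulus z * (t / modulus z) = t by rewrite mulrC divfK ?gt_eqF.
by rewrite toCM_complex !mk; case: (z).
Qed.

Lemma is_derive_realP (R : realType) (f : R -> R) (x l : R) :
  is_derive x 1 f l -> forall e : R, 0 < e ->
    exists2 d : R, 0 < d & forall h, `|h| < d ->
      `|f (x + h) - f x - l * h| <= e * `|h|.
Proof.
move=> [df dfl] e e0.
have cl : (fun h : R => h^-1 *: ((f \o shift x) (h *: (1 : R)) - f x)) @ 0^' --> l.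
  by case: _ / dfl; exact: df.
have /(nbhs_realP (0 : R) _).1[d d0 dP] :=
  (cvgrPdist_lt (FF := dnbhs_filter _) _ _).1 cl e e0.
exists d => // h hd; have [->|h0] := eqVneq h 0.
  by rewrite addr0 mulr0 subrr subr0 normr0 mulr0.
have := dP h; rewrite subr0 => /(_ hd h0) /ltW.
rewrite /= [h *: 1]mulr1 distrC [h + x]addrC => le.
have -> : f (x + h) - f x - l * h = (h^-1 *: (f (x + h) - f x) - l) * h.
  by rewrite mulrBl /GRing.scale /= mulrAC mulVf ?mul1r.
by rewrite normrM ler_wpM2r.
Qed.

(** The real derivatives at 0 are enough, since the addition formula transports the estimate to
    every other point. *)
Lemma cexp_derive0 (R : realType) (e : R) : 0 < e ->
  exists2 d : R, 0 < d & forall h : C R, modulus h < d ->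
    modulus (cexp h - 1 - h) <= e * modulus h.
Proof.
wlog e1 : e / e <= 1.
  move=> H e0; have [||d d0 dP] := H (Num.min e 1).
    by rewrite ge_min lexx orbT.
    by rewrite lt_min e0 ltr01.
  exists d => // h /dP /le_trans; apply; rewrite ler_wpM2r ?modulus_ge0//.
  by rewrite ge_min lexx.
move=> e0; have e8 : 0 < e / 8 by rewrite divr_gt0.
have [d1 d10 P1] := is_derive_realP (is_derive_expR (0 : R)) e8.
have [d2 d20 P2] := is_derive_realP (is_derive_cos (0 : R)) e8.
have [d3 d30 P3] := is_derive_realP (is_derive_sin (0 : R)) e8.
(* The bound [e / 16] on [modulus h] makes [expR x - 1] at most [e / 8] and keeps [expR x] below 2.
   The real and imaginary parts then contribute at most [3 * (e / 8)] each. *)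
pose d := Num.min (Num.min d1 d2) (Num.min d3 (e / 16)).
exists d; first by rewrite /d !lt_min d10 d20 d30 divr_gt0.
move=> h; rewrite /d !lt_min => /andP[/andP[h1 h2] /andP[h3 h4]].
have hx := ler_Re_modulus h; have hy := ler_Im_modulus h.
set x := Re h in hx *; set y := Im h in hy *; set m := modulus h in hx hy h1 h2 h3 h4 *.
have := P1 x (le_lt_trans hx h1); rewrite add0r expR0 mul1r => Ex.
have := P2 y (le_lt_trans hy h2); rewrite add0r cos0 sin0 oppr0 mul0r subr0 => Cy.
have := P3 y (le_lt_trans hy h3); rewrite add0r cos0 sin0 mul1r subr0 => Sy.
apply: le_trans (ler_modulus_ReIm _) _; rewrite !ReB !ImB /= -/x -/y subr0.
have m0 : 0 <= m by apply: modulus_ge0.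
have nx0 := normr_ge0 x; have ny0 := normr_ge0 y.
have E2 : `|expR x| <= 2.
  have -> : expR x = (expR x - 1 - x) + (1 + x) by ring.
  have := ler_normD (expR x - 1 - x) (1 + x); have := ler_normD 1 x.
  rewrite normr1; nra.
have E1 : `|expR x - 1| <= e / 8.
  have -> : expR x - 1 = (expR x - 1 - x) + x by ring.
  have := ler_normD (expR x - 1 - x) x; nra.
have A : `|expR x * cos y - 1 - x| <= 3 * (e / 8) * m.
  have -> : expR x * cos y - 1 - x = expR x * (cos y - 1) + (expR x - 1 - x) by ring.
  have := ler_normD (expR x * (cos y - 1)) (expR x - 1 - x).
  rewrite normrM; have := normr_ge0 (cos y - 1); have := normr_ge0 (expR x); nra.
have B : `|expR x * sin y - y| <= 3 * (e / 8) * m.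
  have -> : expR x * sin y - y = expR x * (sin y - y) + (expR x - 1) * y by ring.
  have := ler_normD (expR x * (sin y - y)) ((expR x - 1) * y).
  rewrite !normrM; have := normr_ge0 (sin y - y); have := normr_ge0 (expR x).
  have := normr_ge0 (expR x - 1); nra.
nra.
Qed.

Lemma is_derive_cexp (R : realType) (t : C R) : is_derive t (1 : C R) (@cexp R) (cexp t).
Proof.
apply/derivable_modulusP => e e0.
have c0 : 0 < modulus (cexp t) by rewrite modulus_gt0 cexp_neq0.
have [d d0 dP] := cexp_derive0 (divr_gt0 e0 c0).
exists d => // w /dP.
have -> : cexp w - cexp t - cexp t * (w - t) = cexp t * (cexp (w - t) - 1 - (w - t)).
  by rewrite -{1}(subrK t w) cexpD; ring.
move=> le; rewrite modulusM mulrC -ler_pdivlMr//.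
by rewrite mulrAC.
Qed.

Lemma derivable_cexp (R : realType) (t : C R) : derivable (@cexp R) t 1.
Proof. by apply: ex_derive; exact: is_derive_cexp. Qed.

Lemma continuous_cexp (R : realType) : continuous (@cexp R).
Proof. by move=> t; apply: derivable_continuousC; exact: derivable_cexp. Qed.

(** * Goursat's lemma *)

(* When [Phi] is [F] composed with an affine parametrisation of an [a]-by-[b] rectangle by
   the unit square, this is the contour integral of [F] along the image of the boundary of
   [[x, x + l] * [y, y + l]]. *)
Definition sq_int (R : realType) (Phi : R -> R -> C R) (a b x y l : R) : C R :=
  toC l * (toC a * (mean (fun s => Phi (x + l * s) y) - mean (fun s => Phi (x + l * s) (y + l)))
    + 'i%C * toC b * (mean (fun s => Phi (x + l) (y + l * s)) - mean (fun s => Phi x (y + l * s)))).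

(** Separate continuity is the right notion here: only restrictions to horizontal and vertical
    segments are integrated. *)
Definition unit_cont (R : realType) (Phi : R -> R -> C R) :=
  (forall y : R, 0 <= y <= 1 -> seg_continuous (fun s => Phi s y)) /\
  (forall x : R, 0 <= x <= 1 -> seg_continuous (Phi x)).

Lemma seg_continuous_sub (R : realType) (h : R -> C R) (x l : R) :
  seg_continuous h -> 0 <= x -> 0 <= l -> x + l <= 1 ->
  seg_continuous (fun s => h (x + l * s)).
Proof.
move=> ch x0 l0 xl.
have := seg_continuous_affine ch (a := l) (b := x).
rewrite (_ : (fun s => h (s * l + x)) = (fun s => h (x + l * s))).
  by apply; lra.
by apply/funext => s; rewrite addrC mulrC.
Qed.

Lemma mean_split_sub (R : realType) (h : R -> C R) (x l : R) :
  seg_continuous h -> 0 <= x -> 0 <= l -> x + l <= 1 ->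
  mean (fun s => h (x + l * s)) =
  2^-1 * (mean (fun s => h (x + l / 2 * s)) + mean (fun s => h (x + l / 2 + l / 2 * s))).
Proof.
move=> ch x0 l0 xl; rewrite mean_split; last exact: seg_continuous_sub.
by congr (_ * (mean _ + mean _)); apply/funext => s; congr h; field.
Qed.

(** Each inner side is traversed twice, in opposite directions. *)
Lemma sq_int_split (R : realType) (Phi : R -> R -> C R) (a b x y l : R) :
  unit_cont Phi -> 0 <= x -> 0 <= y -> 0 <= l -> x + l <= 1 -> y + l <= 1 ->
  sq_int Phi a b x y l =
    (sq_int Phi a b x y (l / 2) + sq_int Phi a b (x + l / 2) y (l / 2)) +
    (sq_int Phi a b x (y + l / 2) (l / 2) + sq_int Phi a b (x + l / 2) (y + l / 2) (l / 2)).
Proof.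
move=> [cx cy] x0 y0 l0 xl yl; rewrite /sq_int.
have x1 : 0 <= x <= 1 by lra.
have y1 : 0 <= y <= 1 by lra.
have xl1 : 0 <= x + l <= 1 by lra.
have yl1 : 0 <= y + l <= 1 by lra.
rewrite (mean_split_sub (cx _ y1) x0 l0 xl) (mean_split_sub (cx _ yl1) x0 l0 xl).
rewrite (mean_split_sub (cy _ x1) y0 l0 yl) (mean_split_sub (cy _ xl1) y0 l0 yl).
have -> : x + l / 2 + l / 2 = x + l by field.
have -> : y + l / 2 + l / 2 = y + l by field.
by rewrite rmorphM fmorphV rmorph_nat; field.
Qed.

(** Opposite sides differ by constants that cancel between the two directions. This is the case to
    which differentiability at a point reduces Goursat's lemma. *)
Lemma sq_int_affine (R : realType) (a b x y l : R) (A B : C R) :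
  sq_int (fun s u => A + B * (toC (a * s) + 'i%C * toC (b * u))) a b x y l = 0.
Proof.
have mean_aff (c d : C R) : mean (fun s : R => c + d * toC s) = c + d / 2.
  rewrite meanD ?meanZ ?mean_id ?mean_cst//.
  - by move=> s _; exact: continuous_toC.
  - exact: seg_continuous_cst.
  apply: seg_continuousM; first exact: seg_continuous_cst.
  by move=> s _; exact: continuous_toC.
rewrite /sq_int.
rewrite (_ : mean _ = (A + B * (toC (a * x) + 'i%C * toC (b * y))) + B * toC (a * l) / 2); last first.
  rewrite -mean_aff; congr mean; apply/funext => s.
  by rewrite !(rmorphM, rmorphD) /=; ring.
rewrite (_ : mean (fun s => A + B * (toC (a * (x + l * s)) + 'i%C * toC (b * (y + l)))) =
   (A + B * (toC (a * x) + 'i%C * toC (b * (y + l)))) + B * toC (a * l) / 2); last first.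
  rewrite -mean_aff; congr mean; apply/funext => s.
  by rewrite !(rmorphM, rmorphD) /=; ring.
rewrite (_ : mean (fun s => A + B * (toC (a * (x + l)) + 'i%C * toC (b * (y + l * s)))) =
   (A + B * (toC (a * (x + l)) + 'i%C * toC (b * y))) + B * 'i%C * toC (b * l) / 2); last first.
  rewrite -mean_aff; congr mean; apply/funext => s.
  by rewrite !(rmorphM, rmorphD) /=; ring.
rewrite (_ : mean (fun s => A + B * (toC (a * x) + 'i%C * toC (b * (y + l * s)))) =
   (A + B * (toC (a * x) + 'i%C * toC (b * y))) + B * 'i%C * toC (b * l) / 2); last first.
  rewrite -mean_aff; congr mean; apply/funext => s.
  by rewrite !(rmorphM, rmorphD) /=; ring.
by rewrite !(rmorphM, rmorphD) /=; field.
Qed.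

Lemma unit_contB (R : realType) (Phi Psi : R -> R -> C R) :
  unit_cont Phi -> unit_cont Psi -> unit_cont (fun s u => Phi s u - Psi s u).
Proof.
by move=> [p1 p2] [q1 q2]; split=> t t01; apply: seg_continuousB; auto.
Qed.

Lemma sq_intB (R : realType) (Phi Psi : R -> R -> C R) (a b x y l : R) :
  unit_cont Phi -> unit_cont Psi ->
  0 <= x -> 0 <= y -> 0 <= l -> x + l <= 1 -> y + l <= 1 ->
  sq_int (fun s u => Phi s u - Psi s u) a b x y l =
  sq_int Phi a b x y l - sq_int Psi a b x y l.
Proof.
move=> [p1 p2] [q1 q2] x0 y0 l0 xl yl; rewrite /sq_int.
have x1 : 0 <= x <= 1 by lra.
have y1 : 0 <= y <= 1 by lra.
have xl1 : 0 <= x + l <= 1 by lra.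
have yl1 : 0 <= y + l <= 1 by lra.
have P1 := fun y y01 => seg_continuous_sub (p1 y y01) x0 l0 xl.
have P2 := fun x x01 => seg_continuous_sub (p2 x x01) y0 l0 yl.
have Q1 := fun y y01 => seg_continuous_sub (q1 y y01) x0 l0 xl.
have Q2 := fun x x01 => seg_continuous_sub (q2 x x01) y0 l0 yl.
rewrite (meanB (P1 _ y1) (Q1 _ y1)) (meanB (P1 _ yl1) (Q1 _ yl1)).
rewrite (meanB (P2 _ x1) (Q2 _ x1)) (meanB (P2 _ xl1) (Q2 _ xl1)).
ring.
Qed.

(** The factor in front of [M] is the perimeter of the image rectangle. *)
Lemma sq_int_le (R : realType) (Phi : R -> R -> C R) (a b x y l M : R) :
  unit_cont Phi -> 0 <= a -> 0 <= b ->
  0 <= x -> 0 <= y -> 0 <= l -> x + l <= 1 -> y + l <= 1 ->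
  (forall s u, x <= s <= x + l -> y <= u <= y + l -> modulus (Phi s u) <= M) ->
  modulus (sq_int Phi a b x y l) <= 2 * l * (a + b) * M.
Proof.
move=> [p1 p2] a0 b0 x0 y0 l0 xl yl PM; rewrite /sq_int.
have x1 : 0 <= x <= 1 by lra.
have y1 : 0 <= y <= 1 by lra.
have xl1 : 0 <= x + l <= 1 by lra.
have yl1 : 0 <= y + l <= 1 by lra.
have sub (z s : R) : 0 <= s <= 1 -> z <= z + l * s <= z + l by move=> ?; nra.
have M1 : modulus (mean (fun s => Phi (x + l * s) y)) <= M.
  apply: mean_le (seg_continuous_sub (p1 y y1) x0 l0 xl) _ => s s01; apply: PM; [exact: sub|lra].
have M2 : modulus (mean (fun s => Phi (x + l * s) (y + l))) <= M.
  apply: mean_le (seg_continuous_sub (p1 _ yl1) x0 l0 xl) _ => s s01; apply: PM; [exact: sub|lra].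
have M3 : modulus (mean (fun s => Phi (x + l) (y + l * s))) <= M.
  apply: mean_le (seg_continuous_sub (p2 _ xl1) y0 l0 yl) _ => s s01; apply: PM; [lra|exact: sub].
have M4 : modulus (mean (fun s => Phi x (y + l * s))) <= M.
  apply: mean_le (seg_continuous_sub (p2 _ x1) y0 l0 yl) _ => s s01; apply: PM; [lra|exact: sub].
set m1 := mean _ in M1 *; set m2 := mean _ in M2 *; set m3 := mean _ in M3 *; set m4 := mean _ in M4 *.
have B1 := le_trans (ler_modulusB m1 m2) (lerD M1 M2).
have B2 := le_trans (ler_modulusB m3 m4) (lerD M3 M4).
rewrite modulusM modulus_real ger0_norm//.
have : modulus (toC a * (m1 - m2) + 'i%C * toC b * (m3 - m4)) <= a * (M + M) + b * (M + M).
  apply: le_trans (ler_modulusD _ _) _; rewrite !modulusM modulusi mul1r !modulus_real !ger0_norm//.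
  by apply: lerD; apply: ler_wpM2l.
move=> /(ler_wpM2l l0) /le_trans; apply; nra.
Qed.

(** Dependent choice: a successor is chosen for all pairs at once, arbitrary where [Q] fails, and
    then iterated. *)
Lemma nested_choice (T : Type) (Q : nat -> T -> Prop) (S : nat -> T -> T -> Prop) (x0 : T) :
  Q 0%N x0 -> (forall n x, Q n x -> exists2 y, Q n.+1 y & S n x y) ->
  exists u : nat -> T, forall n, Q n (u n) /\ S n (u n) (u n.+1).
Proof.
move=> Q0 H.
have /choice[nxt nxtP] : forall p : nat * T, exists y,
    Q p.1 p.2 -> Q p.1.+1 y /\ S p.1 p.2 y.
  move=> [n x] /=; have [/H[y Qy Sy]|nQ] := pselect (Q n x); first by exists y.
  by exists x => /nQ.
pose u := fix u n := if n is m.+1 then nxt (m, u m) else x0.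
have Qu n : Q n (u n) by elim: n => [//|n /(nxtP (n, u n))[]].
by exists u => n; split=> //; have [] := nxtP (n, u n) (Qu n).
Qed.

Lemma nested_intervals (R : realType) (x l : nat -> R) :
  (forall n, x n <= x n.+1) -> (forall n, x n.+1 + l n.+1 <= x n + l n) ->
  (forall n, 0 <= l n) -> exists c : R, forall n, x n <= c <= x n + l n.
Proof.
move=> xnd yni l0.
have x_le n k : x n <= x (n + k)%N.
  by elim: k => [|k IH]; rewrite ?addn0// addnS (le_trans IH).
have y_le n k : x (n + k)%N + l (n + k)%N <= x n + l n.
  by elim: k => [|k IH]; rewrite ?addn0// addnS (le_trans (yni _)).
have ub n m : x m <= x n + l n.
  have := l0 m; have := l0 n; have [nm|mn] := leqP n m.
    by have := y_le n (m - n)%N; rewrite subnKC//; lra.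
  by have := x_le m (n - m)%N; rewrite (subnKC (ltnW mn)); lra.
exists (sup (range x)) => n; apply/andP; split.
  apply: ub_le_sup; last by exists n.
  by exists (x 0%N + l 0%N) => _ [m _ <-].
by apply: ge_sup => [|_ [m _ <-]//]; exists (x 0%N); exists 0%N.
Qed.

Lemma real_le_small (R : realType) (x c : R) : (forall e : R, 0 < e -> x <= c * e) -> x <= 0.
Proof.
move=> H; rewrite leNgt; apply/negP => x0.
have c1 : 0 < `|c| + 1 by rewrite ltr_wpDl.
have := H (x / (`|c| + 1) / 2) ltac:(by rewrite !divr_gt0).
have : c * (x / (`|c| + 1) / 2) <= x / 2; last lra.
rewrite mulrA ler_pM2r ?invr_gt0//.
rewrite mulrCA; apply: ler_piMr; first exact: ltW.
rewrite ler_pdivrMr// mul1r.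
by have := ler_norm c; lra.
Qed.

Lemma affine_shift (R : realType) (f L p X z : C R) :
  f + L * (p + X - z) = f + L * (p - z) + L * X.
Proof. by rewrite -[in RHS]addrA -mulrDr [p - z + X]addrAC. Qed.

(** One of the four quarters always carries at least a quarter of the integral. The nested squares
    shrink to a point near which [F] is affine up to [e] times the distance; the affine part
    integrates to 0, and both error and perimeter are of order [l n]. Hence [eta * l n ^ 2] is at
    most a constant times [e * l n ^ 2]. *)
Lemma goursat_square (R : realType) (F : C R -> C R) (p : C R) (a b : R) :
  0 < a -> 0 < b ->
  (forall s u, 0 <= s <= 1 -> 0 <= u <= 1 ->
    derivable F (p + (toC (a * s) + 'i%C * toC (b * u))) 1) ->
  sq_int (fun s u => F (p + (toC (a * s) + 'i%C * toC (b * u)))) a b 0 0 1 = 0.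
Proof.
move=> a0 b0 dF; set Phi := (fun s u : R => F _).
pose pt (s u : R) := p + (toC (a * s) + 'i%C * toC (b * u)).
have ptB s u s' u' : pt s u - pt s' u' = toC (a * (s - s')) + 'i%C * toC (b * (u - u')).
  by rewrite /pt !(rmorphM, rmorphB) /=; ring.
have pt_le s u s' u' : modulus (pt s u - pt s' u') <= a * `|s - s'| + b * `|u - u'|.
  rewrite ptB; apply: le_trans (ler_modulusD _ _) _.
  by rewrite modulusM modulusi mul1r !modulus_real !normrM (ger0_norm (ltW a0)) (ger0_norm (ltW b0)).
have cPhi (G : C R -> C R) : (forall s u, 0 <= s <= 1 -> 0 <= u <= 1 -> {for pt s u, continuous G}) ->
    unit_cont (fun s u => G (pt s u)).
  move=> cG; split=> t t01 s s01; apply/continuous_RCP => e e0.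
    have /continuous_CP/(_ e e0)[d d0 dP] := cG s t s01 t01.
    exists (d / a); first by rewrite divr_gt0.
    move=> s' ss'; apply: dP; apply: le_lt_trans (pt_le _ _ _ _) _.
    by rewrite subrr normr0 mulr0 addr0 mulrC -ltr_pdivlMr.
  have /continuous_CP/(_ e e0)[d d0 dP] := cG t s t01 s01.
  exists (d / b); first by rewrite divr_gt0.
  move=> s' ss'; apply: dP; apply: le_lt_trans (pt_le _ _ _ _) _.
  by rewrite subrr normr0 mulr0 add0r mulrC -ltr_pdivlMr.
have cP : unit_cont Phi.
  by apply: cPhi => s u s01 u01; apply: derivable_continuousC; exact: dF.
apply/eqP; rewrite -modulus_eq0; apply/eqP/le_anti; rewrite modulus_ge0 andbT.
set eta := modulus _.
pose l n : R := 2^-1 ^+ n.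
have l0 n : 0 < l n by rewrite exprn_gt0.
have lS n : l n.+1 = l n / 2 by rewrite /l exprSr.
pose Q n (q : R * R) := [/\ 0 <= q.1, 0 <= q.2, q.1 + l n <= 1, q.2 + l n <= 1 &
  eta * (l n * l n) <= modulus (sq_int Phi a b q.1 q.2 (l n))].
pose S n (q r : R * R) := [/\ q.1 <= r.1, q.2 <= r.2,
  r.1 + l n.+1 <= q.1 + l n & r.2 + l n.+1 <= q.2 + l n].
have [||q qP] := @nested_choice (R * R)%type Q S (0, 0).
- by rewrite /Q /l /= expr0 !mulr1 add0r; split.
- move=> n [x y] [/= x0 y0 xl yl].
  rewrite (sq_int_split a b cP x0 y0 (ltW (l0 n)) xl yl).
  set I1 := sq_int _ _ _ _ _ _; set I2 := sq_int _ _ _ _ _ _.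
  set I3 := sq_int _ _ _ _ _ _; set I4 := sq_int _ _ _ _ _ _ => le.
  have := l0 n => ln0; rewrite /Q /S lS.
  have : [\/ eta * (l n / 2 * (l n / 2)) <= modulus I1, eta * (l n / 2 * (l n / 2)) <= modulus I2,
     eta * (l n / 2 * (l n / 2)) <= modulus I3 | eta * (l n / 2 * (l n / 2)) <= modulus I4].
    have A := ler_modulusD (I1 + I2) (I3 + I4).
    have B := ler_modulusD I1 I2; have B' := ler_modulusD I3 I4.
    set t := eta * (l n / 2 * (l n / 2)).
    have {}le : 4 * t <= modulus (I1 + I2 + (I3 + I4)).
      by apply: le_trans le; rewrite /t; rewrite le_eqVlt; apply/orP; left; apply/eqP; field.
    have [|h1] := leP t (modulus I1); first by constructor 1.
    have [|h2] := leP t (modulus I2); first by constructor 2.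
    have [|h3] := leP t (modulus I3); first by constructor 3.
    have [|h4] := leP t (modulus I4); first by constructor 4.
    by exfalso; clear -A B B' le h1 h2 h3 h4; lra.
  case=> h.
  + by exists (x, y); split=> //=; clear -x0 y0 xl yl ln0; lra.
  + by exists (x + l n / 2, y); split=> //=; clear -x0 y0 xl yl ln0; lra.
  + by exists (x, y + l n / 2); split=> //=; clear -x0 y0 xl yl ln0; lra.
  + by exists (x + l n / 2, y + l n / 2); split=> //=; clear -x0 y0 xl yl ln0; lra.
have [||n|c cP1] := @nested_intervals R (fun n => (q n).1) l; [| |exact: ltW|].
- by move=> n; have [_ []] := qP n.
- by move=> n; have [_ []] := qP n.
have [||n|d dP1] := @nested_intervals R (fun n => (q n).2) l; [| |exact: ltW|].
- by move=> n; have [_ []] := qP n.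
- by move=> n; have [_ []] := qP n.
have c01 : 0 <= c <= 1.
  by have [[q1 _ q2 _ _] _] := qP 0%N; have := cP1 0%N; lra.
have d01 : 0 <= d <= 1.
  by have [[_ q1 _ q2 _] _] := qP 0%N; have := dP1 0%N; lra.
have /derivable_ex[L /derivable_modulusP dL] := dF c d c01 d01.
apply: (@real_le_small _ _ (2 * (a + b) * (a + b))) => e e0.
have [r r0 rP] := dL e e0.
have ab0 : 0 < a + b by rewrite addr_gt0.
have [n] := half_expn_small (divr_gt0 r0 ab0); rewrite -/(l n) ltr_pdivlMr// => ln.
have [[x0 y0 xl yl le] _] := qP n; set x := (q n).1 in x0 xl le *; set y := (q n).2 in y0 yl le *.
pose z0 := pt c d.
pose Psi s u := F z0 + L * (pt s u - z0).
have cPsi : unit_cont Psi.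
  apply: (cPhi (fun z => F z0 + L * (z - z0))) => s u _ _.
  by apply: derivable_continuousC; derivC.
have l0' := ltW (l0 n).
have Psi0 : sq_int Psi a b x y (l n) = 0.
  rewrite -(@sq_int_affine R a b x y (l n) (F z0 + L * (p - z0)) L).
  suff -> : Psi = (fun s u : R => F z0 + L * (p - z0) + L * (toC (a * s) + 'i%C * toC (b * u))) by [].
  by apply/funext => s; apply/funext => u; exact: affine_shift.
have E : sq_int Phi a b x y (l n) = sq_int (fun s u => Phi s u - Psi s u) a b x y (l n).
  by rewrite sq_intB// Psi0 subr0.
have bnd : modulus (sq_int Phi a b x y (l n)) <= 2 * l n * (a + b) * (e * ((a + b) * l n)).
  rewrite E; apply: sq_int_le (unit_contB cP cPsi) (ltW a0) (ltW b0) x0 y0 l0' xl yl _ => s u s1 u1.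
  have zz : modulus (pt s u - z0) <= (a + b) * l n.
    apply: le_trans (pt_le _ _ _ _) _; rewrite mulrDl.
    apply: lerD; [apply: ler_wpM2l (ltW a0) _ _ _|apply: ler_wpM2l (ltW b0) _ _ _].
      by rewrite ler_norml; have := cP1 n; rewrite -/x; lra.
    by rewrite ler_norml; have := dP1 n; rewrite -/y; lra.
  have zr : modulus (pt s u - z0) < r by apply: le_lt_trans zz _; rewrite mulrC.
  have H := rP (pt s u) zr.
  rewrite /Phi -/(pt s u) /Psi opprD addrA; apply: le_trans H _.
  by rewrite ler_wpM2l// ltW.
have := le_trans le bnd.
have -> : 2 * l n * (a + b) * (e * ((a + b) * l n)) = 2 * (a + b) * (a + b) * e * (l n * l n) by ring.
by rewrite ler_pM2r// mulr_gt0.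
Qed.

(** * Means over circles about the origin *)

Definition circle_pt (R : realType) (r s : R) : C R :=
  toC r * cexp ('i%C * toC (pi *+ 2 * s)).

(** This is the contour integral of [g z / z] divided by [2 * pi * i], so the Cauchy kernel takes
    the form [z / (z - w)] below. *)
Definition circle_mean (R : realType) (g : C R -> C R) (r : R) : C R :=
  mean (fun s => g (circle_pt r s)).

Lemma modulus_circle_pt (R : realType) (r s : R) : 0 <= r -> modulus (circle_pt r s) = r.
Proof.
move=> r0; rewrite modulusM modulus_cexp Re_i_real expR0 mulr1 modulus_real.
by rewrite ger0_norm.
Qed.

Lemma circle_pt_expR (R : realType) (x s : R) :
  circle_pt (expR x) s = cexp (toC x + 'i%C * toC (pi *+ 2 * s)).
Proof. by rewrite cexpD cexp_real. Qed.

Lemma continuous_circle_pt (R : realType) (r : R) : continuous (circle_pt r).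
Proof.
move=> s; apply/continuous_RCP => e e0.
have := @continuous_cexp R ('i%C * toC (pi *+ 2 * s)).
have r1 : 0 < `|r| + 1 by rewrite ltr_wpDl.
have q0 : 0 < pi *+ 2 :> R by rewrite pmulrn_lgt0// pi_gt0.
move=> /continuous_CP/(_ _ (divr_gt0 e0 r1))[d d0 dP].
exists (d / (pi *+ 2)); first by rewrite divr_gt0.
move=> y ys; have := dP ('i%C * toC (pi *+ 2 * y)).
rewrite -mulrBr -rmorphB -mulrBr modulusM modulusi mul1r modulus_real normrM.
rewrite (ger0_norm (ltW q0)) mulrC -ltr_pdivlMr// => /(_ ys).
rewrite /circle_pt -mulrBr modulusM modulus_real ltr_pdivlMr// mulrC.
by apply: le_lt_trans; rewrite ler_wpM2r ?modulus_ge0// lerDl.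
Qed.

Lemma seg_continuous_circle (R : realType) (g : C R -> C R) (r : R) :
  0 <= r -> (forall z, modulus z = r -> {for z, continuous g}) ->
  seg_continuous (fun s => g (circle_pt r s)).
Proof.
move=> r0 cg s s01.
have c1 := @continuous_circle_pt R r s.
have c2 := cg _ (modulus_circle_pt s r0).
exact: (@continuous_comp R (C R) (C R) _ g s c1 c2).
Qed.

Lemma compact_circle (R : realType) (r : R) :
  compact [set circle_pt r s | s in `[0, 1]].
Proof.
apply: continuous_compact; last exact: segment_compact.
by apply: continuous_subspaceT; exact: continuous_circle_pt.
Qed.

Lemma circle_ptP (R : realType) (z : C R) :
  exists2 s : R, 0 <= s <= 1 & z = circle_pt (modulus z) s.
Proof.
have [->|z0] := eqVneq z 0.
  by exists 0; rewrite ?lexx ?ler01// /circle_pt modulus0 rmorph0 mul0r.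
have p0 := @pi_gt0 R; have q1 : 0 < pi *+ 2 :> R by rewrite pmulrn_lgt0.
have q0 : pi *+ 2 != 0 :> R by rewrite gt_eqF.
have [u ub uE] := polarP z0.
have [u0|u0] := leP 0 u.
  exists (u / (pi *+ 2)); last by rewrite /circle_pt [pi *+ 2 * _]mulrC divfK.
  by apply/andP; split; [apply: divr_ge0|rewrite ler_pdivrMr ?mul1r]; lra.
exists ((u + pi *+ 2) / (pi *+ 2)).
  by apply/andP; split; [apply: divr_ge0|rewrite ler_pdivrMr ?mul1r]; lra.
by rewrite /circle_pt [pi *+ 2 * _]mulrC divfK// rmorphD mulrDr cexp_periodic.
Qed.

(** The exponential maps a rectangle of height [2 * pi] onto the annulus. In Goursat's lemma the
    horizontal sides cancel by periodicity and the vertical sides become the two circles. *)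
Lemma circle_mean_const (R : realType) (g : C R -> C R) (r1 r2 : R) :
  0 < r1 -> r1 <= r2 ->
  (forall z, r1 <= modulus z <= r2 -> derivable g z 1) ->
  circle_mean g r1 = circle_mean g r2.
Proof.
move=> r10; rewrite le_eqVlt => /orP[/eqP->//|r12] dg.
have r20 : 0 < r2 := lt_trans r10 r12.
have q0 : 0 < pi *+ 2 :> R by rewrite pmulrn_lgt0// pi_gt0.
pose x := ln r1; pose a := ln r2 - ln r1.
have a0 : 0 < a by rewrite subr_gt0 ltr_ln// posrE.
have E1 : expR x = r1 by rewrite lnK// posrE.
have E2 : expR (x + a) = r2 by rewrite /x /a addrC subrK lnK// posrE.
have mE s u : modulus (cexp (toC x + (toC (a * s) + 'i%C * toC (pi *+ 2 * u)))) = expR (x + a * s).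
  by rewrite modulus_cexp !ReD Re_i_real addr0.
have dF s u : 0 <= s <= 1 -> 0 <= u <= 1 ->
    derivable (g \o @cexp R) (toC x + (toC (a * s) + 'i%C * toC (pi *+ 2 * u))) 1.
  move=> s01 u01; apply: derivable_compC; first exact: derivable_cexp.
  apply: dg; rewrite mE -{1}E1 -E2 !ler_expR; nra.
have := goursat_square a0 q0 dF.
rewrite /sq_int rmorph1 mul1r !add0r.
rewrite (_ : (fun s => _ (toC x + (toC (a * (0 + 1 * s)) + 'i%C * toC (pi *+ 2 * 1)))) =
  (fun s => (g \o @cexp R) (toC x + (toC (a * (0 + 1 * s)) + 'i%C * toC (pi *+ 2 * 0))))); last first.
  apply/funext => s /=; congr g.
  by rewrite mulr1 addrA cexp_periodic mulr0 rmorph0 mulr0 addr0.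
rewrite subrr mulr0 add0r.
rewrite (_ : (fun s => _ (toC x + (toC (a * 1) + 'i%C * toC (pi *+ 2 * (0 + 1 * s))))) =
  (fun s => g (circle_pt r2 s))); last first.
  apply/funext => s /=; congr g.
  have -> : toC x + (toC (a * 1) + 'i%C * toC (pi *+ 2 * (0 + 1 * s))) =
      toC (x + a) + 'i%C * toC (pi *+ 2 * s) by rewrite mulr1 mul1r add0r addrA -rmorphD.
  by rewrite -circle_pt_expR E2.
rewrite (_ : (fun s => _ (toC x + (toC (a * 0) + 'i%C * toC (pi *+ 2 * (0 + 1 * s))))) =
  (fun s => g (circle_pt r1 s))); last first.
  apply/funext => s /=; congr g.
  by rewrite -E1 circle_pt_expR mulr0 rmorph0 add0r mul1r add0r.
have iq0 : 'i%C * toC (pi *+ 2) != 0 :> C R.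
  by rewrite -modulus_gt0 modulusM modulusi mul1r modulus_real normr_gt0 gt_eqF.
by move/eqP; rewrite mulf_eq0 (negbTE iq0) orFb subr_eq0 => /eqP E; exact/esym.
Qed.

Lemma circle_mean_continuous (R : realType) (g : C R -> C R) (r eta : R) :
  0 <= r -> 0 < eta ->
  (forall z, `|modulus z - r| < eta -> {for z, continuous g}) ->
  forall e : R, 0 < e -> exists2 d : R, 0 < d &
    forall r', 0 <= r' -> `|r' - r| < d -> modulus (circle_mean g r' - circle_mean g r) <= e.
Proof.
move=> r0 eta0 cg e e0.
have [|d d0 dP] := @uniform_compactC R _ g (@compact_circle R r) _ e e0.
  move=> _ [s _ <-]; apply: cg.
  by rewrite modulus_circle_pt// subrr normr0.
exists (Num.min d eta); first by rewrite lt_min d0.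
move=> r' r'0; rewrite lt_min => /andP[rd reta].
have S' : seg_continuous (fun s => g (circle_pt r' s)).
  by apply: seg_continuous_circle => // z zr; apply: cg; rewrite zr.
have S : seg_continuous (fun s => g (circle_pt r s)).
  by apply: seg_continuous_circle => // z zr; apply: cg; rewrite zr subrr normr0.
rewrite /circle_mean -meanB//; apply: mean_le; first exact: seg_continuousB.
move=> s s01; apply/ltW/dP; first by exists s.
by rewrite -mulrBl -rmorphB modulusM modulus_cexp Re_i_real expR0 mulr1 modulus_real.
Qed.

Lemma circle_mean_le (R : realType) (g : C R -> C R) (r M : R) :
  0 <= r -> (forall z, modulus z = r -> {for z, continuous g}) ->
  (forall z, modulus z = r -> modulus (g z) <= M) -> modulus (circle_mean g r) <= M.
Proof.
move=> r0 cg gM; apply: mean_le; first exact: seg_continuous_circle.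
by move=> s _; apply: gM; rewrite modulus_circle_pt.
Qed.

Lemma eq_circle_mean (R : realType) (g h : C R -> C R) (r : R) :
  0 <= r -> (forall z, modulus z = r -> g z = h z) -> circle_mean g r = circle_mean h r.
Proof. by move=> r0 gh; apply: eq_mean => s _; apply: gh; rewrite modulus_circle_pt. Qed.

Lemma circle_mean0 (R : realType) (g : C R -> C R) : circle_mean g 0 = g 0.
Proof.
rewrite /circle_mean -[RHS]mean_cst; congr mean; apply/funext => s.
by rewrite /circle_pt rmorph0 mul0r.
Qed.

(** * Cauchy's formula *)

Lemma real_le_eps (R : realType) (x : R) : (forall e : R, 0 < e -> x <= e) -> x <= 0.
Proof. by move=> H; apply: (@real_le_small R x 1) => e /H; rewrite mul1r. Qed.

Lemma complex_eq_eps (R : realType) (z w : C R) :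
  (forall e : R, 0 < e -> modulus (z - w) <= e) -> z = w.
Proof.
move=> /real_le_eps H; apply/eqP; rewrite -subr_eq0 -modulus_eq0.
by apply/eqP/le_anti; rewrite H modulus_ge0.
Qed.

Lemma near_derivableC (R : realType) (f g : C R -> C R) (z : C R) (e : R) :
  0 < e -> (forall w, modulus (w - z) < e -> f w = g w) ->
  derivable f z 1 -> derivable g z 1.
Proof.
move=> e0 fg /derivable_ex[L /derivable_modulusP dL]; apply/derivable_ex; exists L.
apply/derivable_modulusP => e1 /dL[d d0 dP]; exists (Num.min d e); first by rewrite lt_min d0.
move=> w; rewrite lt_min => /andP[wd we]; rewrite -!fg ?dP//.
by rewrite subrr modulus0.
Qed.

(** The mean is constant in the radius and tends to [g 0] as the radius shrinks. At the centre
    itself continuity suffices. *)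
Lemma circle_mean_center (R : realType) (g : C R -> C R) (r : R) : 0 < r ->
  (forall z, modulus z < r -> {for z, continuous g}) ->
  (forall z, 0 < modulus z <= r -> derivable g z 1) ->
  circle_mean g r = g 0.
Proof.
move=> r0 cg dg; apply: complex_eq_eps => e e0.
have [|d d0 dP] := @circle_mean_continuous R g 0 r (lexx 0) r0 _ e e0.
  by move=> z; rewrite subr0 ger0_norm ?modulus_ge0//; exact: cg.
pose r' := Num.min (d / 2) r.
have r'0 : 0 < r' by rewrite lt_min r0 divr_gt0.
have r'd : r' < d.
  have : r' <= d / 2 by rewrite ge_min lexx.
  lra.
rewrite -(@circle_mean_const R g r' r)//.
- rewrite -(circle_mean0 g); apply: dP; first exact: ltW.
  by rewrite subr0 ger0_norm// ltW.
- by rewrite ge_min lexx orbT.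
by move=> z /andP[z1 z2]; apply: dg; rewrite z2 (lt_le_trans r'0 z1).
Qed.

(** The mean is constant on either side of the exceptional circle and continuous across it. That
    circle will pass through the point [w] of Cauchy's formula, where the difference quotient is
    only known to be continuous. *)
Lemma circle_mean_const_except (R : realType) (g : C R -> C R) (r1 r2 rho : R) :
  0 < r1 -> r1 < rho < r2 ->
  (forall z, r1 < modulus z < r2 -> {for z, continuous g}) ->
  (forall z, r1 <= modulus z <= r2 -> modulus z != rho -> derivable g z 1) ->
  circle_mean g r1 = circle_mean g r2.
Proof.
move=> r10 /andP[r1p pr2] cg dg; apply: complex_eq_eps => e e0.
pose eta := Num.min (rho - r1) (r2 - rho).
have eta0 : 0 < eta by rewrite lt_min !subr_gt0 r1p.
have eta1 : eta <= rho - r1 by rewrite ge_min lexx.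
have eta2 : eta <= r2 - rho by rewrite ge_min lexx orbT.
have rho0 := ltW (lt_trans r10 r1p).
have [|d d0 dP] := @circle_mean_continuous R g rho eta rho0 eta0 _ (e / 2) (divr_gt0 e0 (ltr0n _ 2)).
  by move=> z; rewrite ltr_norml => zr; apply: cg; clear -zr eta1 eta2; lra.
pose t := Num.min (d / 2) (eta / 2).
have t0 : 0 < t by rewrite lt_min !divr_gt0.
have td : t < d.
  have : t <= d / 2 by rewrite ge_min lexx.
  by clear -d0; lra.
have te : t < eta.
  have : t <= eta / 2 by rewrite ge_min lexx orbT.
  by clear -eta0; lra.
rewrite (@circle_mean_const R g r1 (rho - t))//; last 2 first.
- by clear -te eta1; lra.
- move=> z zr; apply: dg; first by clear -zr te eta2 eta1 t0; lra.
  by apply/eqP => E; move: zr; rewrite E; clear -t0; lra.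
rewrite -(@circle_mean_const R g (rho + t) r2)//; last 3 first.
- by clear -t0 rho0; lra.
- by clear -te eta2; lra.
- move=> z zr; apply: dg; first by clear -zr te eta2 eta1 t0; lra.
  by apply/eqP => E; move: zr; rewrite E; clear -t0; lra.
have A : modulus (circle_mean g (rho - t) - circle_mean g rho) <= e / 2.
  apply: dP; first by clear -te eta1 r10; lra.
  by rewrite addrAC subrr add0r normrN ger0_norm// ltW.
have B : modulus (circle_mean g (rho + t) - circle_mean g rho) <= e / 2.
  apply: dP; first by clear -t0 rho0; lra.
  by rewrite addrAC subrr add0r ger0_norm// ltW.
apply: le_trans (ler_modulus_distD (circle_mean g rho) _ _) _.
by rewrite [modulus (circle_mean g rho - _)]modulus_distC [leRHS]splitr lerD.
Qed.

Lemma circle_meanB (R : realType) (g h : C R -> C R) (r : R) : 0 <= r ->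
  (forall z, modulus z = r -> {for z, continuous g}) ->
  (forall z, modulus z = r -> {for z, continuous h}) ->
  circle_mean (fun z => g z - h z) r = circle_mean g r - circle_mean h r.
Proof. by move=> r0 cg ch; apply: meanB; exact: seg_continuous_circle. Qed.

Lemma circle_meanD (R : realType) (g h : C R -> C R) (r : R) : 0 <= r ->
  (forall z, modulus z = r -> {for z, continuous g}) ->
  (forall z, modulus z = r -> {for z, continuous h}) ->
  circle_mean (fun z => g z + h z) r = circle_mean g r + circle_mean h r.
Proof. by move=> r0 cg ch; apply: meanD; exact: seg_continuous_circle. Qed.

Lemma circle_meanZ (R : realType) (c : C R) (g : C R -> C R) (r : R) : 0 <= r ->
  (forall z, modulus z = r -> {for z, continuous g}) ->
  circle_mean (fun z => c * g z) r = c * circle_mean g r.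
Proof. by move=> r0 cg; apply: meanZ; exact: seg_continuous_circle. Qed.

Lemma modulus_neq (R : realType) (z w : C R) : modulus z != modulus w -> z - w != 0.
Proof. by apply: contra; rewrite subr_eq0 => /eqP ->. Qed.

Lemma derivable_kernel (R : realType) (w z : C R) : z - w != 0 ->
  derivable (fun z : C R => z / (z - w)) z 1.
Proof. by move=> zw; derivC; exact: zw. Qed.

(** The circle may be enlarged without changing the mean, and on huge circles the kernel is close to
    1. *)
Lemma circle_mean_kernel_in (R : realType) (w : C R) (r : R) : modulus w < r ->
  circle_mean (fun z => z / (z - w)) r = 1.
Proof.
move=> wr; have w0 := modulus_ge0 w; have r0 : 0 < r := le_lt_trans w0 wr.
apply: complex_eq_eps => e e0.
(* Chosen so that [modulus w / (r' - modulus w)], which bounds the distance of the kernel to 1, is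
   at most [e]. *)
pose r' := Num.max r (modulus w + modulus w / e + 1).
have r'r : r <= r' by rewrite le_max lexx.
have r'w : modulus w + modulus w / e + 1 <= r' by rewrite le_max lexx orbT.
have we0 : 0 <= modulus w / e by rewrite divr_ge0// ltW.
have r'0 := lt_le_trans r0 r'r.
rewrite (@circle_mean_const R _ r r')//; last first.
  move=> z /andP[rz _]; apply/derivable_kernel/modulus_neq.
  by rewrite gt_eqF// (lt_le_trans wr).
have neq z : modulus z = r' -> z - w != 0.
  by move=> zr; apply: modulus_neq; rewrite zr gt_eqF// (lt_le_trans wr).
have ck z : modulus z = r' -> {for z, continuous (fun z : C R => z / (z - w))}.
  by move=> /neq zr; apply/derivable_continuousC/derivable_kernel.
have c1 z : modulus z = r' -> {for z, continuous (fun _ : C R => 1 : C R)}.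
  by move=> _; apply/derivable_continuousC/derivable_cstC.
have := circle_meanB (ltW r'0) ck c1.
rewrite [circle_mean (fun=> 1) r']mean_cst => <-.
apply: circle_mean_le; first exact: ltW.
  by move=> z zr; apply: derivable_continuousC; have zw := neq z zr; derivC; exact: zw.
move=> z zr; have zw := neq z zr.
have -> : z / (z - w) - 1 = w / (z - w) by field.
rewrite modulusM modulusV ler_pdivrMr ?modulus_gt0//.
have := lerB_modulus z w; rewrite zr => H.
have : modulus w / e * e <= e * (r' - modulus w).
  by rewrite mulrC ler_pM2l//; clear -r'w; lra.
rewrite divfK ?gt_eqF// => /le_trans; apply.
by rewrite ler_pM2l.
Qed.

(** The kernel is holomorphic on the disc and vanishes at its centre. *)
Lemma circle_mean_kernel_out (R : realType) (w : C R) (r : R) : 0 < r < modulus w ->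
  circle_mean (fun z => z / (z - w)) r = 0.
Proof.
move=> /andP[r0 rw]; rewrite circle_mean_center ?mul0r//.
- move=> z zr; apply/derivable_continuousC/derivable_kernel/modulus_neq.
  by rewrite lt_eqF// (lt_trans zr).
- move=> z /andP[_ zr]; apply/derivable_kernel/modulus_neq.
  by rewrite lt_eqF// (le_lt_trans zr).
Qed.

Definition diff_quot (R : realType) (f : C R -> C R) (w L z : C R) : C R :=
  if z == w then L else (f z - f w) / (z - w).

Lemma continuous_diff_quot (R : realType) (f : C R -> C R) (w L : C R) :
  is_derive w (1 : C R) f L -> {for w, continuous (diff_quot f w L)}.
Proof.
move=> /derivable_modulusP dL; apply/continuous_CP => e e0.
have [d d0 dP] := dL _ (divr_gt0 e0 (ltr0n _ 2)).
exists d => // z zw; rewrite /diff_quot eqxx; case: eqP => [_|/eqP zNw].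
  by rewrite subrr modulus0.
have z0 : z - w != 0 by rewrite subr_eq0.
have -> : (f z - f w) / (z - w) - L = (f z - f w - L * (z - w)) / (z - w).
  by rewrite [RHS]mulrBl mulfK.
rewrite modulusM modulusV ltr_pdivrMr ?modulus_gt0//.
apply: le_lt_trans (dP z zw) _; rewrite ltr_pM2r ?modulus_gt0//.
by clear -e0; lra.
Qed.

Lemma derivable_diff_quot (R : realType) (f : C R -> C R) (w L z : C R) :
  z != w -> derivable f z 1 -> derivable (diff_quot f w L) z 1.
Proof.
move=> zw df.
have z0 : z - w != 0 by rewrite subr_eq0.
apply: (@near_derivableC R (fun z : C R => (f z - f w) / (z - w)) _ z (modulus (z - w))).
- by rewrite modulus_gt0.
- move=> u uz; rewrite /diff_quot; case: eqP => // uw.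
  by move: uz; rewrite uw modulus_distC ltxx.
by derivC; exact: z0.
Qed.

Lemma circle_mean_diff_quot (R : realType) (f : C R -> C R) (w L : C R) (r : R) :
  0 < r -> r != modulus w -> (forall z, modulus z = r -> derivable f z 1) ->
  circle_mean (fun z => z * diff_quot f w L z) r =
  circle_mean (fun z => f z * (z / (z - w))) r - f w * circle_mean (fun z => z / (z - w)) r.
Proof.
move=> r0 rw df; have r0' := ltW r0.
have neq z : modulus z = r -> z - w != 0.
  by move=> zr; apply: modulus_neq; rewrite zr.
have ck z : modulus z = r -> {for z, continuous (fun z : C R => z / (z - w))}.
  by move=> /neq zr; apply/derivable_continuousC/derivable_kernel.
have cfk z : modulus z = r -> {for z, continuous (fun z : C R => f z * (z / (z - w)))}.
  move=> zr; apply: derivable_continuousC; have zw := neq z zr; have dfz := df z zr.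
  by derivC; exact: zw.
have cwk z : modulus z = r -> {for z, continuous (fun z : C R => f w * (z / (z - w)))}.
  move=> zr; apply: derivable_continuousC; have zw := neq z zr.
  by derivC; exact: zw.
have <- := circle_meanZ (f w) r0' ck.
have <- := circle_meanB r0' cfk cwk.
apply: eq_circle_mean; first exact: r0'.
move=> z zr; have zw := neq z zr.
by rewrite /diff_quot -subr_eq0 (negbTE zw) -mulrBl mulrCA.
Qed.

(** The function [z * diff_quot f w L z] has the same mean on both circles; since the kernel has
    mean 1 on the outer and 0 on the inner one, the term [f w] survives once. *)
Lemma cauchy_annulus (R : realType) (f : C R -> C R) (r1 r2 : R) (w : C R) :
  0 < r1 -> r1 < modulus w < r2 ->
  (forall z, r1 <= modulus z <= r2 -> derivable f z 1) ->
  f w = circle_mean (fun z => f z * (z / (z - w))) r2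
      - circle_mean (fun z => f z * (z / (z - w))) r1.
Proof.
move=> r10 wr df; have /andP[r1w wr2] := wr.
have /derivable_ex[L dL] : derivable f w 1 by apply: df; rewrite !ltW.
have r20 := lt_trans r10 (lt_trans r1w wr2).
have := @circle_mean_const_except R (fun z => z * diff_quot f w L z) r1 r2 (modulus w) r10 wr.
have dq z : r1 <= modulus z <= r2 -> z != w -> derivable (fun z : C R => z * diff_quot f w L z) z 1.
  by move=> /df dfz zw; have := @derivable_diff_quot R f w L z zw dfz => H; derivC.
have cq z : r1 < modulus z < r2 -> {for z, continuous (fun z : C R => z * diff_quot f w L z)}.
  move=> /andP[z1 z2]; have [->|zw] := eqVneq z w.
    have c1 := continuous_diff_quot dL.
    exact: (continuousMC (@continuous_idC R w) c1).
  by apply: derivable_continuousC; apply: dq => //; rewrite !ltW.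
move=> /(_ cq) H.
have {}H := H (fun z z12 zw => dq z z12 (contra_neq (@congr1 _ _ (@modulus R) z w) zw)).
have w1 : r1 != modulus w by rewrite lt_eqF.
have w2 : r2 != modulus w by rewrite gt_eqF.
rewrite !circle_mean_diff_quot// in H; last 2 first.
- by move=> z zr; apply: df; rewrite zr lexx andbT ltW// (lt_trans r1w).
- by move=> z zr; apply: df; rewrite zr lexx ltW// (lt_trans r1w).
rewrite (circle_mean_kernel_in wr2) circle_mean_kernel_out ?r10// mulr0 subr0 mulr1 in H.
by rewrite H opprB addrCA subrr addr0.
Qed.

Lemma cauchy_disc (R : realType) (f : C R -> C R) (r : R) (w : C R) :
  modulus w < r -> (forall z, modulus z <= r -> derivable f z 1) ->
  f w = circle_mean (fun z => f z * (z / (z - w))) r.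
Proof.
move=> wr df; have w0 := modulus_ge0 w; have r0 := le_lt_trans w0 wr.
have /derivable_ex[L dL] : derivable f w 1 by apply: df; exact: ltW.
have dq z : modulus z <= r -> z != w -> derivable (fun z : C R => z * diff_quot f w L z) z 1.
  by move=> /df dfz zw; have H := @derivable_diff_quot R f w L z zw dfz; derivC.
have cq z : modulus z <= r -> {for z, continuous (fun z : C R => z * diff_quot f w L z)}.
  move=> z1; have [->|zw] := eqVneq z w.
    have c1 := continuous_diff_quot dL.
    exact: (continuousMC (@continuous_idC R w) c1).
  by apply: derivable_continuousC; exact: dq.
have H : circle_mean (fun z => z * diff_quot f w L z) r = 0.
  (* For [w = 0] the exceptional circle degenerates to the centre. Otherwise the mean vanishes on
     the circle of radius [modulus w / 2], inside which the function is holomorphic, and is carried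
     across the circle through [w]. *)
  have [w00|wN0] := eqVneq w 0.
    rewrite circle_mean_center ?mul0r//.
      by move=> z /ltW; exact: cq.
    move=> z /andP[z0 zr]; apply: dq => //.
    by rewrite w00 -modulus_eq0 gt_eqF.
  have m0 : 0 < modulus w by rewrite modulus_gt0.
  rewrite -(@circle_mean_const_except R _ (modulus w / 2) r (modulus w)).
  - have h : modulus w / 2 < modulus w by clear -m0; lra.
    rewrite circle_mean_center ?mul0r ?divr_gt0//.
      by move=> z zw; apply: cq; rewrite ltW// (lt_trans zw)// (lt_trans h).
    move=> z /andP[_ zw]; apply: dq.
      by rewrite (le_trans zw)// ltW// (lt_trans h).
    by apply/eqP => E; move: zw; rewrite E leNgt h.
  - by rewrite divr_gt0.
  - by rewrite wr andbT; clear -m0; lra.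
  - by move=> z /andP[_ /ltW]; exact: cq.
  - by move=> z /andP[_ zr] zw; apply: dq => //; apply: contra_neq zw => ->.
have wNr : r != modulus w by rewrite gt_eqF.
rewrite circle_mean_diff_quot// in H; last by move=> z zr; apply: df; rewrite zr.
rewrite (circle_mean_kernel_in wr) mulr1 in H.
by apply/esym/eqP; rewrite -subr_eq0 H.
Qed.

(** * Consequences of Cauchy's formula *)

Lemma expn_small (R : realType) (q e : R) : 0 <= q < 1 -> 0 < e -> exists n, q ^+ n < e.
Proof.
move=> /andP[q0 q1] e0.
have q1' : `|q| < 1 by rewrite ger0_norm.
have /cvg_seqRP/(_ e e0)[N NP] := @cvg_geometric R 1 q q1'.
exists N; have := NP N (leqnn N); rewrite subr0 /geometric /= mul1r; apply: le_lt_trans.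
exact: ler_norm.
Qed.

(** A constant factor disappears when roots of growing order are taken. *)
Lemma le_of_expn_le (R : realType) (x M K : R) : 0 <= x -> 0 <= M ->
  (forall n, x ^+ n <= K * M ^+ n) -> x <= M.
Proof.
move=> x0 M0 H; rewrite leNgt; apply/negP => Mx.
have x1 : 0 < x := le_lt_trans M0 Mx.
have K1 : 0 < `|K| + 1 by rewrite ltr_wpDl.
have K2 : 0 < (`|K| + 1)^-1 by rewrite invr_gt0.
have [|n] := @expn_small R (M / x) _ _ K2.
  by rewrite divr_ge0// ltr_pdivrMr// mul1r.
rewrite expr_div_n ltr_pdivrMr ?exprn_gt0// ltNge => /negP; apply.
rewrite ler_pdivrMl//; apply: le_trans (H n) _.
rewrite ler_wpM2r ?exprn_ge0//; have := ler_norm K; clear; lra.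
Qed.

Lemma kernel_bound (R : realType) (z w : C R) (r : R) :
  modulus z = r -> r != modulus w -> modulus (z / (z - w)) <= r / `|r - modulus w|.
Proof.
move=> zr rw; rewrite modulusM modulusV zr.
have r0 : 0 <= r by rewrite -zr modulus_ge0.
rewrite ler_wpM2l// lef_pV2 ?posrE ?normr_gt0 ?modulus_gt0 ?subr_eq0//.
  rewrite ler_norml -zr lerB_modulus andbT lerNl opprB modulus_distC.
  exact: lerB_modulus.
by apply: contra rw => /eqP <-; rewrite zr.
Qed.

Lemma cauchy_kernel_continuous (R : realType) (g : C R -> C R) (w z : C R) :
  z - w != 0 -> derivable g z 1 -> {for z, continuous (fun z : C R => g z * (z / (z - w)))}.
Proof. by move=> zw dg; apply: derivable_continuousC; derivC; exact: zw. Qed.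

Lemma cauchy_mean_bound (R : realType) (g : C R -> C R) (w : C R) (r M : R) :
  0 < r -> r != modulus w -> (forall z, modulus z = r -> derivable g z 1) ->
  (forall z, modulus z = r -> modulus (g z) <= M) ->
  modulus (circle_mean (fun z => g z * (z / (z - w))) r) <= M * (r / `|r - modulus w|).
Proof.
move=> r0 rw dg gM; apply: circle_mean_le; first exact: ltW.
  move=> z zr; apply: cauchy_kernel_continuous; last exact: dg.
  by apply: modulus_neq; rewrite zr.
move=> z zr; rewrite modulusM; apply: ler_pM; rewrite ?modulus_ge0//; first exact: gM.
exact: kernel_bound.
Qed.

(* Landau's trick: apply Cauchy's formula to the powers of [f] and take roots. *)
Lemma maximum_modulus (R : realType) (f : C R -> C R) (r M : R) : 0 <= M ->
  (forall z, modulus z <= r -> derivable f z 1) ->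
  (forall z, modulus z = r -> modulus (f z) <= M) ->
  forall w, modulus w <= r -> modulus (f w) <= M.
Proof.
move=> M0 df fM w; rewrite le_eqVlt => /orP[/eqP/fM//|wr].
have r0 := le_lt_trans (modulus_ge0 w) wr.
apply: (@le_of_expn_le _ _ _ (r / `|r - modulus w|)); rewrite ?modulus_ge0// => n.
rewrite -modulusX.
have E := @cauchy_disc R (fun z => f z ^+ n) r w wr.
rewrite [f w ^+ n]E; last by move=> z /df dfz; exact: derivableXC.
rewrite mulrC; apply: cauchy_mean_bound => //.
- by rewrite gt_eqF.
- by move=> z zr; apply: derivableXC; apply: df; rewrite zr.
- by move=> z zr; rewrite modulusX lerXn2r ?nnegrE ?modulus_ge0// fM.
Qed.

(* The exponent [beta] need not be an integer: [f ^+ n] is compared with the power [p] of the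
   variable, where [p] is the integral part of [beta * n]. *)
Lemma three_circles (R : realType) (f : C R -> C R) (x1 x2 beta : R) :
  0 <= x1 -> 0 <= beta ->
  (forall z, expR x1 <= modulus z <= expR x2 -> derivable f z 1) ->
  (forall z, modulus z = expR x1 -> modulus (f z) <= expR (beta * x1)) ->
  (forall z, modulus z = expR x2 -> modulus (f z) <= expR (beta * x2)) ->
  forall x w, x1 <= x <= x2 -> modulus w = expR x -> modulus (f w) <= expR (beta * x).
Proof.
move=> x10 b0 df f1 f2 x w /andP[]; rewrite le_eqVlt => /orP[/eqP <- _ /f1//|x1x].
rewrite le_eqVlt => /orP[/eqP -> /f2//|xx2 wx].
have w12 : expR x1 < modulus w < expR x2 by rewrite wx !ltr_expR x1x.
have /andP[w1 w2] := w12.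
have wE : 0 <= expR x by exact: expR_ge0.
pose K1 := expR x1 / `|expR x1 - modulus w|; pose K2 := expR x2 / `|expR x2 - modulus w|.
apply: (@le_of_expn_le _ _ _ (expR x2 * K2 + expR x2 * K1)); rewrite ?modulus_ge0 ?expR_ge0// => n.
have bn0 : 0 <= beta * n%:R by rewrite mulr_ge0.
(* The inequality [beta * n < p + 1] bounds [g] on the two circles independently of [n];
   [p <= beta * n] is used to return from [g] to [f] at [w]. *)
have /andP[p1 p2] := truncn_itv bn0; set p := Num.truncn _ in p1 p2.
pose g (z : C R) := f z ^+ n * (z ^+ p)^-1.
have dg z : expR x1 <= modulus z <= expR x2 -> derivable g z 1.
  move=> z12; have dfz := df z z12; rewrite /g; derivC.
  apply: expf_neq0; rewrite -modulus_gt0; have /andP[z1 _] := z12.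
  exact: lt_le_trans (expR_gt0 x1) z1.
have gb y z : 0 <= y -> y <= x2 -> modulus z = expR y -> modulus (f z) <= expR (beta * y) ->
    modulus (g z) <= expR x2.
  move=> y0 y2 zy fz; rewrite modulusM modulusV !modulusX zy.
  have : modulus (f z) ^+ n <= expR (beta * y) ^+ n.
    by rewrite lerXn2r ?nnegrE ?modulus_ge0 ?expR_ge0.
  rewrite -expRM_natl -[expR y ^+ p]expRM_natl => le.
  rewrite ler_pdivrMr ?expR_gt0// -expRD; apply: le_trans le _.
  rewrite ler_expR; move: p2; rewrite -natr1 => p2.
  have : beta * n%:R * y <= (p%:R + 1) * y by rewrite ler_wpM2r// ltW.
  by clear -y2; lra.
have x20 : 0 <= x2 by rewrite ltW// (le_lt_trans x10)// (lt_trans x1x).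
have gw : modulus (g w) <= expR x2 * K2 + expR x2 * K1.
  rewrite (@cauchy_annulus R g (expR x1) (expR x2) w (expR_gt0 _) w12 dg).
  apply: le_trans (ler_modulusB _ _) _; apply: lerD; apply: cauchy_mean_bound; rewrite ?expR_gt0//.
  - by rewrite gt_eqF.
  - by move=> z zr; apply: dg; rewrite zr lexx andbT ltW// (lt_trans w1).
  - by move=> z zr; apply: (gb x2) => //; exact: f2.
  - by rewrite lt_eqF.
  - by move=> z zr; apply: dg; rewrite zr lexx ltW// (lt_trans w1).
  - by move=> z zr; apply: (gb x1) => //; [rewrite ltW// (lt_trans x1x)|exact: f1].
have K0 : 0 <= expR x2 * K2 + expR x2 * K1.
  exact: le_trans (modulus_ge0 _) gw.
have -> : modulus (f w) ^+ n = modulus (g w) * expR x ^+ p.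
  rewrite /g modulusM modulusV !modulusX wx divfK//.
  by rewrite expf_neq0// gt_eqF// expR_gt0.
apply: ler_pM; rewrite ?modulus_ge0 ?exprn_ge0//.
rewrite -!expRM_natl ler_expR [leRHS]mulrA [n%:R * _]mulrC ler_wpM2r//.
by rewrite (le_trans x10)// ltW.
Qed.

(** The Taylor remainder after [n] terms, divided by [w ^+ n]: it arises by splitting [n] terms of
    the geometric series in [w / z] off the Cauchy kernel. *)
Definition taylor_rest (R : realType) (f : C R -> C R) (r : R) (n : nat) (w : C R) : C R :=
  circle_mean (fun z => (f z * z^-1 ^+ n) * (z / (z - w))) r.

Definition taylor_coef (R : realType) (f : C R -> C R) (r : R) (n : nat) : C R :=
  circle_mean (fun z => f z * z^-1 ^+ n) r.

Lemma derivable_taylor (R : realType) (f : C R -> C R) (n : nat) (z : C R) :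
  z != 0 -> derivable f z 1 -> derivable (fun z : C R => f z * z^-1 ^+ n) z 1.
Proof. by move=> z0 df; derivC. Qed.

Lemma taylor_rest0 (R : realType) (f : C R -> C R) (r : R) (w : C R) :
  modulus w < r -> (forall z, modulus z <= r -> derivable f z 1) ->
  f w = taylor_rest f r 0 w.
Proof.
move=> wr df; rewrite (cauchy_disc wr df); apply: eq_circle_mean.
  exact: ltW (le_lt_trans (modulus_ge0 w) wr).
by move=> z _; rewrite expr0 mulr1.
Qed.

(** The kernel [k = z / (z - w)] satisfies [k = 1 + w * z^-1 * k]. *)
Lemma taylor_restS (R : realType) (f : C R -> C R) (r : R) (n : nat) (w : C R) :
  modulus w < r -> (forall z, modulus z = r -> derivable f z 1) ->
  taylor_rest f r n w = taylor_coef f r n + w * taylor_rest f r n.+1 w.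
Proof.
move=> wr df; have r0 := le_lt_trans (modulus_ge0 w) wr; have r0' := ltW r0.
have zN0 z : modulus z = r -> z != 0 by move=> zr; rewrite -modulus_gt0 zr.
have zw z : modulus z = r -> z - w != 0.
  by move=> zr; apply: modulus_neq; rewrite zr gt_eqF.
have c1 z : modulus z = r -> {for z, continuous (fun z : C R => f z * z^-1 ^+ n)}.
  move=> zr; apply: derivable_continuousC.
  by apply: derivable_taylor; [exact: zN0|exact: df].
have c2 z : modulus z = r ->
    {for z, continuous (fun z : C R => (f z * z^-1 ^+ n.+1) * (z / (z - w)))}.
  move=> zr; apply: cauchy_kernel_continuous; first exact: zw.
  by apply: derivable_taylor; [exact: zN0|exact: df].
have c3 z : modulus z = r ->
    {for z, continuous (fun z : C R => w * ((f z * z^-1 ^+ n.+1) * (z / (z - w))))}.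
  move=> zr; have h1 : {for z, continuous (fun _ : C R => w)}.
    by apply/derivable_continuousC/derivable_cstC.
  exact: (continuousMC h1 (c2 z zr)).
rewrite /taylor_rest /taylor_coef.
have <- := circle_meanZ w r0' c2.
have <- := circle_meanD r0' c1 c3.
apply: eq_circle_mean; first exact: r0'.
move=> z zr; have z0 := zN0 z zr; have zw0 := zw z zr.
rewrite exprS.
set t := z^-1 ^+ n.
field.
by rewrite z0 zw0.
Qed.

Lemma taylor_rest_bound (R : realType) (f : C R -> C R) (r M : R) (n : nat) (w : C R) :
  modulus w < r -> (forall z, modulus z = r -> derivable f z 1) ->
  (forall z, modulus z = r -> modulus (f z) <= M) ->
  modulus (taylor_rest f r n w) <= M * r^-1 ^+ n * (r / (r - modulus w)).
Proof.
move=> wr df fM; have r0 := le_lt_trans (modulus_ge0 w) wr.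
rewrite -[r - _]ger0_norm; last by rewrite subr_ge0 ltW.
have rw : r != modulus w by rewrite gt_eqF.
have dg z : modulus z = r -> derivable (fun z : C R => f z * z^-1 ^+ n) z 1.
  move=> zr; apply: derivable_taylor; last exact: df.
  by rewrite -modulus_gt0 zr.
apply: (cauchy_mean_bound r0 rw dg).
move=> z zr; rewrite modulusM modulusX modulusV zr ler_wpM2r ?fM//.
by rewrite exprn_ge0// invr_ge0 ltW.
Qed.

Lemma taylor_expansion (R : realType) (f : C R -> C R) (r : R) (n : nat) (w : C R) :
  modulus w < r -> (forall z, modulus z <= r -> derivable f z 1) ->
  f w = \sum_(i < n) taylor_coef f r i * w ^+ i + w ^+ n * taylor_rest f r n w.
Proof.
move=> wr df; elim: n => [|n IH].
  by rewrite big_ord0 add0r expr0 mul1r -taylor_rest0.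
rewrite {1}IH big_ord_recr /= -addrA; congr (_ + _).
rewrite taylor_restS//; last by move=> z zr; apply: df; rewrite zr.
by rewrite mulrDr [w ^+ n * _]mulrC mulrA -exprSr.
Qed.

Lemma taylor_coef_const (R : realType) (f : C R -> C R) (r s : R) (n : nat) :
  entire f -> 0 < r -> 0 < s -> taylor_coef f r n = taylor_coef f s n.
Proof.
move=> ef; wlog rs : r s / r <= s.
  by move=> H r0 s0; have [rs|/ltW sr] := leP r s; [exact: H|apply/esym/H].
move=> r0 s0; apply: circle_mean_const => // z /andP[rz _].
apply: derivable_taylor; last exact: ef.
by rewrite -modulus_gt0 (lt_le_trans r0).
Qed.

Lemma power_ratio (F : fieldType) (r d : F) (k : nat) : r != 0 ->
  r ^+ k * r^-1 ^+ k.+1 * (r / d) = d^-1.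
Proof.
move=> r0; have rk0 : r ^+ k != 0 by rewrite expf_neq0.
by rewrite exprVn exprSr invfM [r ^+ k * (_ * _)]mulrA divff// mul1r mulrA mulVf// mul1r.
Qed.

Lemma div_small (R : realFieldType) (a b r e : R) :
  0 < e -> 0 < r - b -> b + 1 + a / e <= r -> a * (r - b)^-1 <= e.
Proof.
move=> e0 rb0 h; rewrite ler_pdivrMr// mulrC -ler_pdivrMr//.
by clear -h; lra.
Qed.

(** Liouville's argument: the coefficients do not depend on the radius, and the remainder beyond
    degree [k] tends to 0 as the radius grows. *)
Lemma entire_growth_polynomial (R : realType) (f : C R -> C R) (R0 : R) (k : nat) :
  entire f -> (forall z, R0 <= modulus z -> modulus (f z) <= modulus z ^+ k) ->
  exists p : {poly C R}, forall z, f z = p.[z].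
Proof.
move=> ef fk; exists (\poly_(i < k.+1) taylor_coef f 1 i) => w.
rewrite horner_poly; apply: complex_eq_eps => e e0.
(* The remainder will be at most [modulus w ^+ k.+1 / (r - modulus w)], which this radius brings
   below [e]. *)
pose r := Num.max (Num.max R0 1) (modulus w + 1 + modulus w ^+ k.+1 / e).
have rR0 : R0 <= r by rewrite !le_max lexx.
have r1 : 1 <= r by rewrite !le_max lexx orbT.
have r0 : 0 < r by exact: lt_le_trans r1.
have rw : modulus w + 1 + modulus w ^+ k.+1 / e <= r by rewrite !le_max lexx !orbT.
have we0 : 0 <= modulus w ^+ k.+1 / e by rewrite divr_ge0 ?exprn_ge0 ?modulus_ge0// ltW.
have wr : modulus w < r by clear -rw we0; lra.
clearbody r; have E := @taylor_expansion _ f r k.+1 w wr (fun z _ => ef z).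
have coefE i : taylor_coef f r i = taylor_coef f 1 i by exact: taylor_coef_const.
have sumE : \sum_(i < k.+1) taylor_coef f r i * w ^+ i = \sum_(i < k.+1) taylor_coef f 1 i * w ^+ i.
  by apply: eq_bigr => i _; rewrite coefE.
rewrite sumE in E; rewrite E.
rewrite addrAC subrr add0r modulusM modulusX.
have := @taylor_rest_bound _ f r (r ^+ k) k.+1 w wr (fun z _ => ef z).
have fb z : modulus z = r -> modulus (f z) <= r ^+ k.
  by move=> zr; rewrite -zr; apply: fk; rewrite zr.
have d0 : 0 < r - modulus w by rewrite subr_gt0.
rewrite power_ratio; last exact: lt0r_neq0.
move=> /(_ fb) le.
apply: le_trans (ler_wpM2l _ le) _; first by rewrite exprn_ge0 ?modulus_ge0.
exact: (div_small e0 d0 rw).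
Qed.

Lemma taylor_coef0 (R : realType) (f : C R -> C R) (r : R) : 0 < r ->
  (forall z, modulus z <= r -> derivable f z 1) -> taylor_coef f r 0 = f 0.
Proof.
move=> r0 df; have w0 : modulus (0 : C R) < r by rewrite modulus0.
rewrite (taylor_rest0 w0 df) taylor_restS//; last by move=> z zr; apply: df; rewrite zr.
by rewrite mul0r addr0.
Qed.

Lemma entire_shift (R : realType) (f : C R -> C R) (z : C R) :
  entire f -> entire (fun h => f (z + h)).
Proof.
move=> ef h; apply: (@derivable_compC R (fun h => z + h) f); last exact: ef.
by derivC.
Qed.

(** If all higher coefficients vanish, the remainder at a fixed [w] decays geometrically in its
    order, so [f] is constant. Otherwise the first nonzero coefficient dominates on all small
    circles. *)
Lemma entire_const_or_isolated (R : realType) (f : C R -> C R) (e : R) :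
  entire f -> 0 < e -> (forall z, f z = f 0) \/
  exists2 r : R, 0 < r < e & forall h, modulus h = r -> f h != f 0.
Proof.
move=> ef e0; have df1 (z : C R) : modulus z <= 1 -> derivable f z 1 by move=> _; exact: ef.
have [allz|] := pselect (forall n, (0 < n)%N -> taylor_coef f 1 n = 0).
  left=> w; apply: complex_eq_eps => e1 e10.
  pose r := modulus w * 2 + 1; have w0 := modulus_ge0 w.
  have r0 : 0 < r by rewrite /r; clear -w0; lra.
  have wr : modulus w < r by rewrite /r; clear -w0; lra.
  have [M M0 fM] := compact_bounded_modulus (@compact_circle R r)
    (fun z _ => derivable_continuousC (ef z)).
  have fb z : modulus z = r -> modulus (f z) <= M.
    by move=> zr; apply: fM; have [s s01 ->] := circle_ptP z; exists s; rewrite ?zr//= in_itv.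
  have rest n : f w - f 0 = w ^+ n.+1 * taylor_rest f r n.+1 w.
    rewrite (@taylor_expansion _ f r n.+1 w wr) => [|z _]; last exact: ef.
    rewrite big_ord_recl big1 => [|i _].
      rewrite expr0 mulr1 addr0 [taylor_coef _ _ _](@taylor_coef0 _ f r r0) => [|z _]; last exact: ef.
      by rewrite addrAC subrr add0r.
    by rewrite (@taylor_coef_const _ f r 1 _ ef r0 ltr01) allz// mul0r.
  have d0 : 0 < r - modulus w by rewrite subr_gt0.
  pose K := M * (r / (r - modulus w)).
  have K0 : 0 < K by rewrite !mulr_gt0// invr_gt0.
  have [|n nP] := @expn_small R (modulus w / r) (e1 / K) _ (divr_gt0 e10 K0).
    by rewrite divr_ge0 ?(ltW r0)//= ltr_pdivrMr// mul1r.
  have q01 : 0 <= modulus w / r <= 1 by rewrite divr_ge0 ?(ltW r0)//= ler_pdivrMr// mul1r ltW.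
  rewrite (rest n) modulusM modulusX.
  have := @taylor_rest_bound _ f r M n.+1 w wr (fun z _ => ef z) fb => le.
  apply: le_trans (ler_wpM2l _ le) _; first by rewrite exprn_ge0.
  rewrite [X in X <= _](_ : _ = (modulus w / r) ^+ n.+1 * K); last first.
    by rewrite exprMn /K !mulrA; congr (_ * _ * _); rewrite mulrAC.
  rewrite -ler_pdivlMr//; apply: le_trans (ltW nP); rewrite exprS ler_piMl//.
    by rewrite exprn_ge0//; have /andP[] := q01.
  by have /andP[] := q01.
move=> /existsNP[n0 /not_implyP[n00 /eqP cn0]].
have ex : exists n, (0 < n)%N && (taylor_coef f 1 n != 0) by exists n0; rewrite n00.
right; case: (ex_minnP ex) => k /andP[k0 ck] kmin.
have [M M0 fM] := compact_bounded_modulus (@compact_circle R 1)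
  (fun z _ => derivable_continuousC (ef z)).
have fb z : modulus z = 1 -> modulus (f z) <= M.
  by move=> zr; apply: fM; have [s s01 ->] := circle_ptP z; exists s; rewrite ?zr//= in_itv.
have expand h : modulus h < 1 ->
    f h - f 0 = h ^+ k * (taylor_coef f 1 k + h * taylor_rest f 1 k.+1 h).
  move=> h1; rewrite (@taylor_expansion _ f 1 k h h1 df1).
  rewrite -(prednK k0) big_ord_recl big1 => [|i _].
    rewrite expr0 mulr1 addr0 [taylor_coef _ _ ord0](@taylor_coef0 _ f 1 ltr01 df1).
    rewrite addrAC subrr add0r; congr (_ * _).
    by rewrite prednK// taylor_restS// => z _; exact: ef.
  apply/eqP; rewrite mulf_eq0; apply/orP; left.
  apply/negPn/negP => ci.
  have := kmin (lift ord0 i); rewrite ci /= => /(_ isT).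
  have := ltn_ord i; rewrite -ltnS prednK// => lt.
  by rewrite /bump /= add1n leqNgt lt.
have d0 : 0 < modulus (taylor_coef f 1 k) by rewrite modulus_gt0.
pose M2 := M * 2 + 1.
have M20 : 0 < M2 by rewrite /M2; clear -M0; lra.
pose r := Num.min (Num.min (e / 2) 2^-1) (modulus (taylor_coef f 1 k) / M2 / 2).
have r0 : 0 < r by rewrite !lt_min !divr_gt0// invr_gt0 ltr0n.
have re : r <= e / 2 by rewrite !ge_min lexx.
have r2 : r <= 2^-1 by rewrite !ge_min lexx orbT.
have rd : r <= modulus (taylor_coef f 1 k) / M2 / 2 by rewrite !ge_min lexx orbT.
exists r; first by rewrite r0; clear -e0 re; lra.
move=> h hr; have h1 : modulus h < 1 by rewrite hr; clear -r2; lra.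
rewrite -subr_eq0 (expand h h1) mulf_neq0//.
  by rewrite expf_neq0// -modulus_gt0 hr.
have := @taylor_rest_bound _ f 1 M k.+1 h h1 (fun z _ => ef z) fb.
rewrite invr1 expr1n mulr1 hr => le.
have le2 : modulus (taylor_rest f 1 k.+1 h) <= M2.
  apply: le_trans le _; rewrite /M2.
  have : 1 / (1 - r) <= 2 by rewrite ler_pdivrMr; clear -r2; lra.
  by move=> /(ler_wpM2l (ltW M0)); clear; lra.
rewrite -modulus_gt0; apply: lt_le_trans (_ : modulus (taylor_coef f 1 k) -
   modulus (h * taylor_rest f 1 k.+1 h) <= _).
  rewrite subr_gt0 modulusM hr.
  apply: le_lt_trans (ler_wpM2l (ltW r0) le2) _.
  apply: le_lt_trans (ler_wpM2r (ltW M20) rd) _.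
  rewrite mulrAC divfK ?gt_eqF//; clear -d0; lra.
by rewrite -[in leRHS](opprK (h * _)) -(modulusN (h * _)); exact: lerB_modulus.
Qed.

(* Otherwise the reciprocal of [f - c] would violate the maximum principle on the disc. *)
Lemma open_mapping (R : realType) (f : C R -> C R) (e : R) :
  entire f -> (exists z, f z != f 0) -> 0 < e ->
  exists2 d : R, 0 < d & forall c, modulus (c - f 0) < d ->
    exists2 h, modulus h < e & f h = c.
Proof.
move=> ef [z1 fz1] e0; have [fc|[r /andP[r0 re] rP]] := entire_const_or_isolated ef e0.
  by rewrite fc eqxx in fz1.
have dinv c z : f z != c -> derivable (fun z : C R => (f z - c)^-1) z 1.
  by move=> fzc; have dfz := ef z; derivC; rewrite subr_eq0.
have [|M M0 MP] := @compact_bounded_modulus R _ _ (fun z => (f z - f 0)^-1) (@compact_circle R r).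
  move=> _ [s _ <-]; apply/derivable_continuousC/dinv/rP.
  by rewrite modulus_circle_pt// ltW.
have lb z : modulus z = r -> M^-1 <= modulus (f z - f 0).
  move=> zr; rewrite -[leRHS]invrK lef_pV2 ?posrE ?invr_gt0 ?modulus_gt0 ?subr_eq0 ?rP//.
  rewrite -modulusV; apply: MP; have [s s01 ->] := circle_ptP z.
  by exists s; rewrite ?zr//= in_itv.
have Mi0 : 0 < M^-1 by rewrite invr_gt0.
(* On the circle [f] has distance at least [M^-1] from [f 0]. A value [c] closer than half of this
   is at distance at least [M^-1 / 2] from [f] on the circle but less at the centre. *)
exists (M^-1 / 2); first by rewrite divr_gt0.
move=> c cd; apply: contrapT => nc.
have lb2 z : modulus z = r -> M^-1 / 2 <= modulus (f z - c).
  move=> /lb le; have := ler_modulus_distD c (f z) (f 0); clear -le cd; lra.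
have fc z : modulus z <= r -> f z != c.
  rewrite le_eqVlt => /orP[/eqP zr|zr].
    by rewrite -subr_eq0 -modulus_gt0; apply: lt_le_trans (lb2 z zr); rewrite divr_gt0.
  by apply/eqP => fzc; apply: nc; exists z => //; exact: lt_trans re.
have := @maximum_modulus R (fun z => (f z - c)^-1) r (M^-1 / 2)^-1.
have b0 : 0 <= (M^-1 / 2)^-1 by rewrite invr_ge0 divr_ge0// ltW.
move=> /(_ b0 (fun z zr => dinv c z (fc z zr))) H.
have fr z : modulus z = r -> modulus (f z - c)^-1 <= (M^-1 / 2)^-1.
  move=> zr; rewrite modulusV lef_pV2 ?posrE ?divr_gt0// ?lb2//.
  by rewrite modulus_gt0 subr_eq0 fc// zr.
have := H fr 0; rewrite modulus0 modulusV => /(_ (ltW r0)).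
have p0 : 0 < modulus (f 0 - c).
  by rewrite modulus_gt0 subr_eq0 fc// modulus0 ltW.
rewrite lef_pV2 ?posrE ?divr_gt0// leNgt modulus_distC.
by move/negP; apply.
Qed.

(** * Logarithms and critical points *)

Lemma is_derive_compC (R : realType) (f g : C R -> C R) (z a b : C R) :
  is_derive z (1 : C R) f a -> is_derive (f z) (1 : C R) g b ->
  is_derive z (1 : C R) (fun w => g (f w)) (b * a).
Proof.
move=> /derivable_modulusP df dg'; have /derivable_modulusP dg := dg'.
apply/derivable_modulusP => e e0.
have a0 := modulus_ge0 a; have b0 := modulus_ge0 b.
have half (m : R) : 0 < m -> m * (e / (2 * m)) = e / 2.
  by move=> m0; field; rewrite gt_eqF.
pose e1 := e / (2 * (modulus a + 1)); pose e2 := Num.min 1 (e / (2 * (modulus b + 1))).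
have e10 : 0 < e1 by rewrite divr_gt0// mulr_gt0// ltr_wpDl.
have e20 : 0 < e2 by rewrite lt_min ltr01 divr_gt0// mulr_gt0// ltr_wpDl.
have e21 : e2 <= 1 by rewrite ge_min lexx.
have e22 : modulus b * e2 <= e / 2.
  have h : e2 <= e / (2 * (modulus b + 1)) by rewrite ge_min lexx orbT.
  have h1 : modulus b * e2 <= (modulus b + 1) * (e / (2 * (modulus b + 1))).
    by rewrite ler_pM// ?(ltW e20)// lerDl.
  by apply: le_trans h1 _; rewrite half// ltr_wpDl.
have e11 : e1 * (modulus a + 1) = e / 2.
  by rewrite mulrC half// ltr_wpDl.
have [d1 d10 P1] := dg e1 e10; have [d2 d20 P2] := df e2 e20.
exists (Num.min d2 (d1 / (modulus a + 1))).
  by rewrite lt_min d20 divr_gt0// ltr_wpDl.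
move=> w; rewrite lt_min => /andP[wd2]; rewrite ltr_pdivlMr ?ltr_wpDl// => wd1.
have Q2 := P2 w wd2; have m0 := modulus_ge0 (w - z).
have fw : modulus (f w - f z) <= (modulus a + 1) * modulus (w - z).
  have -> : f w - f z = (f w - f z - a * (w - z)) + a * (w - z) by rewrite subrK.
  apply: le_trans (ler_modulusD _ _) _; rewrite modulusM.
  have : e2 * modulus (w - z) <= 1 * modulus (w - z) by rewrite ler_wpM2r.
  by clear -Q2; lra.
have Q1 := P1 (f w); have {}Q1 := Q1 (le_lt_trans fw _).
rewrite mulrC in wd1; have {}Q1 := Q1 wd1.
have -> : g (f w) - g (f z) - b * a * (w - z) =
  (g (f w) - g (f z) - b * (f w - f z)) + b * (f w - f z - a * (w - z)).
  by rewrite [b * (_ - _ - _)]mulrBr mulrA addrA subrK.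
apply: le_trans (ler_modulusD _ _) _; rewrite modulusM.
have h1 : e1 * modulus (f w - f z) <= e / 2 * modulus (w - z).
  by rewrite -e11 -mulrA ler_wpM2l// ltW.
have h2 : modulus b * modulus (f w - f z - a * (w - z)) <= e / 2 * modulus (w - z).
  apply: le_trans (ler_wpM2l b0 Q2) _.
  by rewrite mulrA ler_wpM2r.
by clear -Q1 h1 h2; lra.
Qed.

Lemma is_derive_uniqueC (R : realType) (f : C R -> C R) (z a b : C R) :
  is_derive z (1 : C R) f a -> is_derive z (1 : C R) f b -> a = b.
Proof. by move=> [_ <-] [_ <-]. Qed.

(** The derivative of the exponential never vanishes, so a continuous local inverse inherits
    differentiability. *)
Lemma derivable_log_branch (R : realType) (L : C R -> C R) (z : C R) (e : R) : 0 < e ->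
  (forall w, modulus (w - z) < e -> cexp (L w) = w) ->
  {for z, continuous L} -> derivable L z 1.
Proof.
move=> e0 LK /continuous_CP cL; apply/derivable_ex; exists z^-1.
have zK : cexp (L z) = z by apply: LK; rewrite subrr modulus0.
have z0 : z != 0 by rewrite -zK cexp_neq0.
have m0 : 0 < modulus z by rewrite modulus_gt0.
have /derivable_modulusP dE := is_derive_cexp (L z).
apply/derivable_modulusP => e1 e10.
(* The first entry yields [modulus z * modulus u <= 2 * modulus (w - z)]; the second then brings the
   error down to [e1]. *)
pose t := Num.min (modulus z / 2) (e1 * modulus z * modulus z / 2).
have t0 : 0 < t by rewrite lt_min !divr_gt0// !mulr_gt0.
have t1 : t <= modulus z / 2 by rewrite ge_min lexx.
have t2 : t <= e1 * modulus z * modulus z / 2 by rewrite ge_min lexx orbT.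
have [d1 d10 P1] := dE t t0; have [d2 d20 P2] := cL d1 d10.
exists (Num.min e d2); first by rewrite lt_min e0.
move=> w; rewrite lt_min => /andP[we wd2].
have := P1 (L w) (P2 w wd2); rewrite zK (LK w we).
set u := L w - L z => H.
have mu : modulus z * modulus u <= 2 * modulus (w - z).
  have := lerB_modulus (z * u) (w - z); rewrite modulusM [modulus (z * u - _)]modulus_distC.
  have : t * modulus u <= modulus z / 2 * modulus u by rewrite ler_wpM2r ?modulus_ge0.
  by clear -H; lra.
have -> : u - z^-1 * (w - z) = - (z^-1 * (w - z - z * u)).
  by rewrite [in RHS]mulrBr mulKf// opprB.
rewrite modulusN modulusM modulusV mulrC ler_pdivrMr//.
apply: le_trans H _; apply: le_trans (ler_wpM2r (modulus_ge0 _) t2) _.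
have -> : e1 * modulus z * modulus z / 2 * modulus u =
    (e1 * modulus z / 2) * (modulus z * modulus u) by ring.
apply: le_trans (ler_wpM2l _ mu) _; first by rewrite divr_ge0// mulr_ge0// ltW.
by rewrite le_eqVlt; apply/orP; left; apply/eqP; field.
Qed.

(** The principal logarithm, correct on the right half-plane, where the argument is the arcsine of
    its sine. *)
Definition clog (R : realType) (z : C R) : C R :=
  Complex (ln (modulus z)) (asin (Im z / modulus z)).

Lemma near_one_Re (R : realType) (z : C R) : modulus (z - 1) < 1 -> 0 < Re z.
Proof.
move=> z1; have := le_lt_trans (ler_Re_modulus (z - 1)) z1.
by rewrite ReB /= ltr_norml; lra.
Qed.

Lemma clogK (R : realType) (z : C R) : 0 < Re z -> cexp (clog z) = z.
Proof.
move=> z0; have zN0 : z != 0 by apply: contraTneq z0 => ->; rewrite ltxx.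
have m0 : 0 < modulus z by rewrite modulus_gt0.
have i1 : -1 <= Im z / modulus z <= 1.
  by rewrite -ler_norml normrM normfV (ger0_norm (ltW m0)) ler_pdivrMr// mul1r ler_Im_modulus.
have sq : (Re z / modulus z) ^+ 2 = 1 - (Im z / modulus z) ^+ 2.
  have m2 : modulus z ^+ 2 = Re z ^+ 2 + Im z ^+ 2.
    by rewrite modulusE sqr_sqrtr// addr_ge0// sqr_ge0.
  rewrite !expr_div_n m2 -[X in X - _](@divff _ (Re z ^+ 2 + Im z ^+ 2)).
    by rewrite -mulrBl addrK.
  by rewrite -m2 expf_neq0// gt_eqF.
rewrite /cexp /= lnK ?posrE// cos_asin// -sq sqrtr_sqr ger0_norm; last first.
  by rewrite divr_ge0// ltW.
rewrite asinK ?in_itv//= ![modulus z * _]mulrC !divfK ?gt_eqF//.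
by case: (z).
Qed.

Lemma clog1 (R : realType) : clog (1 : C R) = 0.
Proof.
have p0 := @pi_gt0 R.
by rewrite /clog modulus1 ln1 /= mul0r -[X in asin X]sin0 sinK// in_itv /=; clear -p0; lra. Qed.

Lemma continuous_clog (R : realType) (z : C R) : 0 < Re z -> {for z, continuous (@clog R)}.
Proof.
move=> z0; have zN0 : z != 0 by apply: contraTneq z0 => ->; rewrite ltxx.
have m0 : 0 < modulus z by rewrite modulus_gt0.
have cln : {for z, continuous (fun z : C R => ln (modulus z))}.
  have c1 : {for z, continuous (@modulus R)} by exact: continuous_modulus.
  have c2 : {for modulus z, continuous (@ln R)} by exact: continuous_ln.
  exact: (@continuous_comp (C R) R R _ _ z c1 c2).
have cIm : {for z, continuous (@Im R : C R -> R)}.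
  move=> P /nbhs_realP[e e0 sP]; apply: (nbhs_modulus z _).2.
  by exists e => // w wz; apply: sP; rewrite -ImB; apply: le_lt_trans (ler_Im_modulus _) wz.
have casin : {for z, continuous (fun z : C R => asin (Im z / modulus z))}.
  have c1 : {for z, continuous (@modulus R)} by exact: continuous_modulus.
  have c1V : {for z, continuous (fun z : C R => (modulus z)^-1)}.
    exact: (cvgV (lt0r_neq0 m0) c1).
  have c2 : {for z, continuous (fun z : C R => Im z / modulus z)}.
    exact: (cvgM cIm c1V).
  have c3 : {for Im z / modulus z, continuous (@asin R)}.
    apply: continuous_asin; rewrite -ltr_norml normrM normfV (ger0_norm (ltW m0)).
    rewrite ltr_pdivrMr// mul1r modulusE -sqrtr_sqr ltr_sqrt ?ltrDr ?exprn_gt0//.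
    by rewrite ltr_wpDr ?sqr_ge0// exprn_gt0.
  exact: (@continuous_comp (C R) R R _ _ z c2 c3).
apply/continuous_CP => e e0; have e20 : 0 < e / 2 by rewrite divr_gt0.
have /(nbhs_modulus z _).1[d1 d10 P1] := cln _ (nbhsx_ballx _ _ e20).
have /(nbhs_modulus z _).1[d2 d20 P2] := casin _ (nbhsx_ballx _ _ e20).
exists (Num.min d1 d2); first by rewrite lt_min d10.
move=> w; rewrite lt_min => /andP[/P1 H1 /P2 H2].
apply: le_lt_trans (ler_modulus_ReIm _) _; rewrite ReB ImB /=.
move: H1 H2; rewrite /ball /= => H1 H2.
by rewrite distrC [X in _ + X]distrC [ltRHS]splitr ltrD.
Qed.

Lemma derivable_clog (R : realType) (z : C R) : modulus (z - 1) < 1 -> derivable (@clog R) z 1.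
Proof.
move=> z1; apply: (@derivable_log_branch R _ z (1 - modulus (z - 1))).
- by rewrite subr_gt0.
- move=> w wz; apply/clogK/near_one_Re.
  by have := ler_modulus_distD z w 1; clear -wz; lra.
- exact/continuous_clog/near_one_Re.
Qed.

(** Squares stand in for closed discs: they are compact as products of two segments and still
    star-shaped about the centre. *)
Definition box (R : realType) (p : C R) (r : R) : set (C R) :=
  [set z | `|Re z - Re p| <= r /\ `|Im z - Im p| <= r].

Lemma compact_box (R : realType) (p : C R) (r : R) : compact (box p r).
Proof.
pose h (q : R * R) : C R := Complex q.1 q.2.
have -> : box p r = h @` (`[Re p - r, Re p + r] `*` `[Im p - r, Im p + r]).
  apply/seteqP; split=> [z [z1 z2]|_ [[x y] [/= xr yr] <-]].
    exists (Re z, Im z); last by case: (z).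
    split; rewrite /= in_itv /=.
      by move: z1; rewrite ler_norml; lra.
    by move: z2; rewrite ler_norml; lra.
  move: xr yr; rewrite !in_itv /= => xr yr; split=> /=; rewrite ler_norml; lra.
apply: continuous_compact; last by apply: compact_setX; exact: segment_compact.
apply: continuous_subspaceT => -[x y] P /nbhs_modulus[e e0 sP].
have e20 : 0 < e / 2 by rewrite divr_gt0.
exists (ball x (e / 2), ball y (e / 2)).
  by split; exact: nbhsx_ballx.
move=> [x' y'] [/= H1 H2]; apply: sP; apply: le_lt_trans (ler_modulus_ReIm _) _.
rewrite ReB ImB /=; move: H1 H2; rewrite /ball /= => H1 H2.
by rewrite distrC [X in _ + X]distrC [ltRHS]splitr ltrD.
Qed.

Lemma ball_sub_box (R : realType) (p z : C R) (r : R) : modulus (z - p) <= r -> box p r z.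
Proof.
by move=> zr; split; rewrite -?ReB -?ImB; apply: le_trans zr;
  [exact: ler_Re_modulus|exact: ler_Im_modulus].
Qed.

Lemma box_sub_ball (R : realType) (p z : C R) (r : R) : box p r z -> modulus (z - p) <= 2 * r.
Proof.
move=> [z1 z2]; apply: le_trans (ler_modulus_ReIm _) _.
by rewrite ReB ImB; clear -z1 z2; lra.
Qed.

Lemma box_segment (R : realType) (p z : C R) (r l : R) : 0 <= l <= 1 ->
  box p r z -> box p r (p + toC l * (z - p)).
Proof.
move=> l01 [z1 z2].
have E : toC l * (z - p) = Complex (l * (Re z - Re p)) (l * (Im z - Im p)).
  by rewrite -toCM_complex; case: (z) (p) => [? ?] [? ?].
rewrite /box /= E ReD ImD /= ![_ + _ - _]addrAC !subrr !add0r !normrM.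
have -> : `|l| = l by rewrite ger0_norm; lra.
have n1 := normr_ge0 (Re z - Re p); have n2 := normr_ge0 (Im z - Im p).
by split; clear -l01 z1 z2 n1 n2; nra.
Qed.

Lemma derivable_bigsum (R : realType) (n : nat) (g : nat -> C R -> C R) (z : C R) :
  (forall i, (i < n)%N -> derivable (g i) z 1) ->
  derivable (fun w => \sum_(i < n) g i w) z 1.
Proof.
elim: n => [|n IH] dg.
  by under [fun w => _]funext do rewrite big_ord0; exact: derivable_cstC.
have h1 := IH (fun i hi => dg i (ltnW hi)).
have h2 := dg n (leqnn n.+1).
have -> : (fun w : C R => \sum_(i < n.+1) g i w) = (fun w => (\sum_(i < n) g i w) + g n w).
  by apply/funext => w; rewrite big_ord_recr.
exact: (derivableDC h1 h2).
Qed.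

Lemma cexp_sum (R : realType) (n : nat) (a : nat -> C R) :
  cexp (\sum_(i < n) a i) = \prod_(i < n) cexp (a i).
Proof.
elim: n => [|n IH]; first by rewrite !big_ord0 cexp0.
by rewrite !big_ord_recr /= cexpD IH.
Qed.

Lemma telescope_ratio (F : fieldType) (n : nat) (a : nat -> F) :
  (forall i, (i <= n)%N -> a i != 0) -> \prod_(i < n) (a i.+1 / a i) = a n / a 0%N.
Proof.
elim: n => [|n IH] aN; first by rewrite big_ord0 divff// aN.
rewrite big_ord_recr /= IH => [|i hi]; last by apply: aN; exact: leqW.
by rewrite mulrC mulrA divfK// aN.
Qed.

(* Cutting the segment from [t0] to [t] into short pieces, the ratios of consecutive values
   of [G] are close to 1, where the principal logarithm is available. *)
Lemma holomorphic_log (R : realType) (G : C R -> C R) (t0 : C R) (r : R) : 0 < r ->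
  (forall t, box t0 r t -> derivable G t 1) -> (forall t, box t0 r t -> G t != 0) ->
  exists F : C R -> C R,
    [/\ forall t, box t0 r t -> derivable F t 1,
        forall t, box t0 r t -> cexp (F t) = G t / G t0 & F t0 = 0].
Proof.
move=> r0 dG GN.
have cK := @compact_box R t0 r.
have [M M0 GM] := compact_bounded_modulus cK
  (fun t Kt => derivable_continuousC (derivableVC (GN t Kt) (dG t Kt))).
(* Since [M] bounds [1 / G], increments of [G] below [(2 * M)^-1] keep the ratios within 1/2 of
   1. *)
have M20 : 0 < (2 * M)^-1 by rewrite invr_gt0 mulr_gt0.
have [d d0 dP] := uniform_compactC cK (fun t Kt => derivable_continuousC (dG t Kt)) M20.
(* A segment from [t0] inside the box has length at most [2 * r], so [2 ^ n] equal pieces are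
   shorter than [d]. *)
have [n] := half_expn_small (divr_gt0 d0 (mulr_gt0 (ltr0n R 2) r0)).
rewrite ltr_pdivlMr ?mulr_gt0// => nd.
pose N := (2 ^ n)%N; have N0 : (0 < N)%N by rewrite expn_gt0.
have NR : N%:R^-1 = 2^-1 ^+ n :> R by rewrite natrX exprVn.
pose x (i : nat) (t : C R) := t0 + toC (i%:R / N%:R) * (t - t0).
have xK i t : (i <= N)%N -> box t0 r t -> box t0 r (x i t).
  move=> iN; apply: box_segment; rewrite divr_ge0//=.
  by rewrite ler_pdivrMr ?ltr0n// mul1r ler_nat.
have dx i t : derivable (x i) t 1 by rewrite /x; derivC.
have close i t : (i < N)%N -> box t0 r t -> modulus (G (x i.+1 t) / G (x i t) - 1) < 1.
  move=> iN Kt; have Kx := xK i t (ltnW iN) Kt; have G0 := GN _ Kx.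
  have -> : G (x i.+1 t) / G (x i t) - 1 = (G (x i.+1 t) - G (x i t)) * (G (x i t))^-1.
    by rewrite mulrBl divff.
  have H1 : modulus (G (x i.+1 t) - G (x i t)) < (2 * M)^-1.
    apply: dP => //.
    have -> : x i.+1 t - x i t = toC N%:R^-1 * (t - t0).
      rewrite /x opprD addrACA subrr add0r -mulrBl -rmorphB -mulrBl.
      by rewrite -natr1 addrAC subrr add0r mul1r.
    rewrite modulusM modulus_real NR ger0_norm ?exprn_ge0 ?invr_ge0//.
    apply: le_lt_trans nd; rewrite ler_wpM2l ?exprn_ge0 ?invr_ge0//.
    exact: box_sub_ball.
  have H2 := GM _ Kx; rewrite modulusM.
  have : modulus (G (x i.+1 t) - G (x i t)) * modulus (G (x i t))^-1 <= (2 * M)^-1 * M.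
    by rewrite ler_pM ?modulus_ge0// ltW.
  rewrite invfM -mulrA mulVf ?mulr1 ?gt_eqF// => /le_lt_trans; apply.
  by clear; lra.
exists (fun t => \sum_(i < N) clog (G (x i.+1 t) / G (x i t))); split.
- move=> t Kt; apply: (@derivable_bigsum R N (fun i t => clog (G (x i.+1 t) / G (x i t)))) => i iN.
  apply: (@derivable_compC R (fun t => G (x i.+1 t) / G (x i t))).
    have d1 := derivable_compC (dx i.+1 t) (dG _ (xK _ _ iN Kt)).
    have d2 := derivable_compC (dx i t) (dG _ (xK _ _ (ltnW iN) Kt)).
    apply: derivableMC; first exact: d1.
    apply: derivableVC; last exact: d2.
    exact: GN (xK _ _ (ltnW iN) Kt).
  by apply: derivable_clog; exact: close.
- move=> t Kt; rewrite (@cexp_sum R N (fun i => clog (G (x i.+1 t) / G (x i t)))).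
  rewrite (eq_bigr (fun i : 'I_N => G (x i.+1 t) / G (x i t))); last first.
    move=> i _; apply: clogK; apply: near_one_Re; apply: close => //; exact: ltn_ord.
  rewrite (@telescope_ratio _ N (fun i => G (x i t))) => [|i iN]; last exact: GN (xK _ _ iN Kt).
  rewrite /x divff ?pnatr_eq0 -?lt0n// rmorph1 mul1r mul0r rmorph0 mul0r addr0.
  by rewrite addrC subrK.
- rewrite big1// => i _.
  rewrite /x subrr !mulr0 addr0 divff ?clog1// GN//.
  by apply: ball_sub_box; rewrite subrr modulus0 ltW.
Qed.

Lemma near_is_deriveC (R : realType) (f g : C R -> C R) (z L : C R) (e : R) :
  0 < e -> (forall w, modulus (w - z) < e -> g w = f w) ->
  is_derive z (1 : C R) f L -> is_derive z (1 : C R) g L.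
Proof.
move=> e0 fg /derivable_modulusP dL.
apply/derivable_modulusP => e1 /dL[d d0 dP]; exists (Num.min d e); first by rewrite lt_min d0.
move=> w; rewrite lt_min => /andP[wd we]; rewrite !fg ?dP//.
by rewrite subrr modulus0.
Qed.

Lemma is_derive_scale (R : realType) (c z : C R) :
  is_derive z (1 : C R) (fun w => w * c) c.
Proof.
apply/derivable_modulusP => e e0; exists 1 => // w _.
by rewrite -mulrBl mulrC subrr modulus0 mulr_ge0 ?modulus_ge0// ltW.
Qed.

(** Differentiating the relation gives [L * cexp (F z) = 0], and the exponential does not vanish. *)
Lemma log_derivative0 (R : realType) (F G : C R -> C R) (z c L : C R) (e : R) : 0 < e ->
  (forall w, modulus (w - z) < e -> cexp (F w) = G w * c) ->
  is_derive z (1 : C R) F L -> is_derive z (1 : C R) G 0 -> L = 0.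
Proof.
move=> e0 FG dF dG.
have h1 := is_derive_compC dF (is_derive_cexp (F z)).
have h2 := is_derive_compC dG (is_derive_scale c (G z)).
have h3 := near_is_deriveC e0 FG h2.
apply: (mulfI (cexp_neq0 (F z))).
by rewrite (is_derive_uniqueC h1 h3) !mulr0.
Qed.

Lemma cauchy_scale (F : fieldType) (r s : F) : r != 0 -> 1 - s != 0 ->
  s * r * (s * r) * (r^-1 ^+ 2 * (r / (r - s * r))) = s ^+ 2 / (1 - s).
Proof.
move=> r0 s1; have -> : r - s * r = (1 - s) * r by ring.
by field; rewrite r0 s1.
Qed.

(* Taylor expansion to order 2 of the Cayley transform of [log G], which is bounded by 1
   and vanishes to second order at the critical point. *)
Lemma critical_harnack (R : realType) (G : C R -> C R) (t0 : C R) (r : R) : 0 < r ->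
  (forall t, box t0 r t -> derivable G t 1) ->
  (forall t, box t0 r t -> 1 < modulus (G t)) ->
  is_derive t0 (1 : C R) G 0 ->
  forall t (s q : R), modulus (t - t0) = s * r -> s < 1 -> q = s ^+ 2 / (1 - s) ->
  ln (modulus (G t)) * (1 - q) <= ln (modulus (G t0)) * (1 + q).
Proof.
move=> r0 dG G1 dG0.
have m1 t : box t0 r t -> 0 < modulus (G t) by move=> /G1; exact: lt_trans.
have GN t : box t0 r t -> G t != 0 by move=> /m1; rewrite modulus_gt0.
have K0 : box t0 r t0 by apply: ball_sub_box; rewrite subrr modulus0 ltW.
have [F0 [dF0 F0K F00]] := holomorphic_log r0 dG GN.
pose c0 := ln (modulus (G t0)); have c00 : 0 < c0 by rewrite ln_gt0// G1.
(* The added constant makes the real part of [F] equal to [ln (modulus (G t))], hence positive, and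
   [F t0] real. *)
pose F (t : C R) := F0 t + toC c0.
have ReF t : box t0 r t -> Re (F t) = ln (modulus (G t)).
  move=> Kt; rewrite ReD /= -[Re (F0 t)]expRK -modulus_cexp F0K// modulusM modulusV.
  by rewrite ln_div ?posrE ?m1// subrK.
have Fpos t : box t0 r t -> 0 < Re (F t) by move=> Kt; rewrite ReF// ln_gt0// G1.
have Ft0 : F t0 = toC c0 by rewrite /F F00 add0r.
have dF t : box t0 r t -> derivable F t 1 by move=> /dF0 h; rewrite /F; derivC.
have dF00 : is_derive t0 (1 : C R) F0 0.
  have /derivable_ex[L dL] := dF0 t0 K0.
  suff L0 : L = 0 by rewrite L0 in dL.
  apply: (@log_derivative0 R F0 G t0 (G t0)^-1 L r r0 _ dL dG0) => w wr.
  by apply: F0K; apply: ball_sub_box; exact: ltW.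
pose psi (w : C R) := (F (t0 + w) - toC c0) / (F (t0 + w) + toC c0).
have bx w : modulus w <= r -> box t0 r (t0 + w).
  by move=> wr; apply: ball_sub_box; rewrite addrAC subrr add0r.
have den w : modulus w <= r -> c0 <= modulus (F (t0 + w) + toC c0).
  move=> /bx/Fpos h; apply: le_trans (ler_Re_modulus _).
  by rewrite ReD /= ger0_norm; clear -h c00; lra.
have denN w : modulus w <= r -> F (t0 + w) + toC c0 != 0.
  by move=> /den h; rewrite -modulus_gt0; exact: lt_le_trans h.
have dpsi w : modulus w <= r -> derivable psi w 1.
  move=> wr; have h0 : derivable (fun w => t0 + w) w 1 by derivC.
  have h : derivable (fun w => F (t0 + w)) w 1 := derivable_compC h0 (dF _ (bx w wr)).
  apply: (derivableMC (f := fun w => F (t0 + w) - toC c0)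
                      (g := fun w => (F (t0 + w) + toC c0)^-1)).
    by apply: derivableBC h _; exact: derivable_cstC.
  apply: (derivableVC (f := fun w => F (t0 + w) + toC c0)); first exact: denN.
  by apply: derivableDC h _; exact: derivable_cstC.
have psi1 w : modulus w <= r -> modulus (psi w) <= 1.
  move=> wr; rewrite modulusM modulusV ler_pdivrMr ?modulus_gt0 ?denN// mul1r.
  have h := Fpos _ (bx w wr).
  rewrite !modulusE ler_wsqrtr// ReB ImB ReD ImD /= subr0 addr0 lerD2r.
  by clear -h c00; nra.
have psi0 : psi 0 = 0 by rewrite /psi addr0 Ft0 subrr mul0r.
have coef0 : taylor_coef psi r 0 = 0 by rewrite (taylor_coef0 r0 dpsi).
have rest1 w : modulus w < r -> psi w = w * (taylor_coef psi r 1 + w * taylor_rest psi r 2 w).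
  move=> wr; rewrite (@taylor_expansion _ psi r 1 w wr dpsi) big_ord1 coef0 mul0r add0r expr1.
  by rewrite taylor_restS// => z zr; apply: dpsi; rewrite zr.
have rest2 w : modulus w < r -> modulus (taylor_rest psi r 2 w) <= r^-1 ^+ 2 * (r / (r - modulus w)).
  move=> wr; rewrite -[r^-1 ^+ 2]mul1r; apply: taylor_rest_bound => // z zr.
    by apply: dpsi; rewrite zr.
  by apply: psi1; rewrite zr.
(* This coefficient is the derivative of [psi] at 0. It is found to vanish by comparing, at a small
   real increment [h], the estimate of [F0] near [t0] with the Taylor expansion. *)
have coef1 : taylor_coef psi r 1 = 0.
  apply: complex_eq_eps => e e0; rewrite subr0.
  have /derivable_modulusP/(_ (e / 2 * c0)) := dF00.
  rewrite mulr_gt0 ?divr_gt0// => /(_ isT)[d d0 dP].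
  (* With [h <= r / 2] the remainder is at most [2 / r ^ 2]; the last entry then makes [h] times the
     remainder at most [e / 2]. *)
  pose h := Num.min (Num.min (d / 2) (r / 2)) (e * r ^+ 2 / 4).
  have h0 : 0 < h by rewrite !lt_min !divr_gt0// mulr_gt0// exprn_gt0.
  have hd : h < d.
    have : h <= d / 2 by rewrite !ge_min lexx.
    by clear -d0; lra.
  have hr2 : h <= r / 2 by rewrite !ge_min lexx orbT.
  have hr : h < r by clear -hr2 r0; lra.
  have her : h <= e * r ^+ 2 / 4 by rewrite !ge_min lexx !orbT.
  have mh : modulus (toC h) = h by rewrite modulus_real ger0_norm// ltW.
  have hr' : modulus (toC h) < r by rewrite mh.
  have hle : modulus (toC h) <= r by rewrite ltW.
  have A := dP (t0 + toC h); rewrite addrAC subrr add0r mh F00 subr0 mul0r subr0 in A.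
  have {}A := A hd.
  have B : modulus (psi (toC h)) <= e / 2 * h.
    rewrite modulusM modulusV ler_pdivrMr ?modulus_gt0 ?denN//.
    have -> : F (t0 + toC h) - toC c0 = F0 (t0 + toC h) by rewrite addrK.
    apply: le_trans A _; rewrite mulrAC ler_wpM2l ?den//.
    by rewrite mulr_ge0 ?divr_ge0// ltW.
  have C1 := rest2 _ hr'; rewrite mh in C1.
  have C2 : modulus (taylor_rest psi r 2 (toC h)) <= r^-1 ^+ 2 * 2.
    apply: le_trans C1 _; rewrite ler_wpM2l ?exprn_ge0 ?invr_ge0 ?(ltW r0)//.
    by rewrite ler_pdivrMr ?subr_gt0//; clear -hr2; lra.
  rewrite rest1// modulusM mh in B.
  have {}B : modulus (taylor_coef psi r 1 + toC h * taylor_rest psi r 2 (toC h)) <= e / 2.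
    by rewrite -(ler_pM2l h0) [leRHS]mulrC.
  have D : modulus (toC h * taylor_rest psi r 2 (toC h)) <= e / 2.
    rewrite modulusM mh; apply: le_trans (ler_pM (ltW h0) (modulus_ge0 _) her C2) _.
    by rewrite le_eqVlt; apply/orP; left; apply/eqP; field; rewrite gt_eqF.
  have := lerB_modulus (taylor_coef psi r 1) (- (toC h * taylor_rest psi r 2 (toC h))).
  by rewrite opprK modulusN; clear -B D; lra.
move=> t s q ts s1 qE.
have s0 : 0 <= s by rewrite -(ler_pM2r r0) mul0r -ts modulus_ge0.
have wr : modulus (t - t0) < r by rewrite ts -[ltRHS]mul1r ltr_pM2r.
have Kt : box t0 r t by apply: ball_sub_box; exact: ltW.
have psiq : modulus (psi (t - t0)) <= q.
  rewrite rest1// coef1 add0r mulrA modulusM modulusM.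
  apply: le_trans (ler_wpM2l _ (rest2 _ wr)) _; first by rewrite mulr_ge0 ?modulus_ge0.
  by rewrite ts qE cauchy_scale ?gt_eqF// subr_gt0.
have FE : F (t0 + (t - t0)) = F t by rewrite addrC subrK.
have : modulus (F t - toC c0) <= q * modulus (F t + toC c0).
  have := psiq; rewrite /psi FE modulusM modulusV ler_pdivrMr// modulus_gt0 -FE denN//.
  exact: ltW.
have q0 : 0 <= q by rewrite qE divr_ge0 ?exprn_ge0// subr_ge0 ltW.
have := ler_modulusD (F t) (toC c0); have := lerB_modulus (F t) (toC c0).
rewrite !modulus_real (ger0_norm (ltW c00)) -/c0 -(ReF t Kt).
have := ler_Re_modulus (F t); rewrite (ger0_norm (ltW (Fpos t Kt))).
set m := modulus (F t); set X := modulus (F t - _); set Y := modulus (F t + _).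
move=> h1 h2 h3 h4.
have h5 : q * Y <= q * (m + c0) by rewrite ler_wpM2l.
(* Replacing [m] by the smaller real part of [F t] needs [1 - q >= 0]. For [q > 1] the left side of
   the claim is negative and the right side positive. *)
have [q1|q1] := leP q 1; last by have := Fpos t Kt; clear -q1 c00 q0; nra.
have : Re (F t) * (1 - q) <= m * (1 - q) by rewrite ler_wpM2r// subr_ge0.
by clear -h2 h4 h5; lra.
Qed.

(** * Normal families *)

Lemma cvg_loc_unifP (R : realType) (V : set (C R)) (g : nat -> C R -> C R) (h : C R -> C R) :
  cvg_loc_unif V g h <-> forall K, K `<=` V -> compact K -> forall e : R, 0 < e ->
    exists N, forall n, (N <= n)%N -> forall z, K z -> modulus (g n z - h z) < e.
Proof.
split=> [gh K KV cK e e0|H].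
  have KV' : compactly_in V K by split.
  have gK := (fam_cvgP (F := g @ \oo) _ _ _).1 gh K KV'.
  have ee : entourage [set xy : C R * C R | ball xy.1 (toC e) xy.2].
    by rewrite -entourage_ballE; exists (toC e) => //=; rewrite ltcR.
  have nh : nbhs (h : {uniform` K -> C R})
      [set g' : C R -> C R | forall y, K y -> ball (h y) (toC e) (g' y)].
    by apply/uniform_nbhs; eexists; split; [exact: ee|].
  have [N _ NP] := gK (fmap_filter _ _) _ nh.
  exists N => n Nn z Kz; have := NP n Nn z Kz.
  by rewrite /ball /= distrC norm_modulus ltcR.
apply/fam_cvgP => K [KV cK] P /uniform_nbhs[E [entE EP]].
have := entE; rewrite -entourage_ballE => -[e /= e0 eE].
have eC : e = toC (Re e) by rewrite RRe_real ?gtr0_real.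
have e0' : 0 < Re e by rewrite -ltcR -[X in _ < X]eC.
have [N NP] := H K KV cK _ e0'.
exists N => // n Nn; apply: EP => y Ky; apply: eE => /=.
by rewrite /ball /= distrC norm_modulus eC ltcR; exact: NP.
Qed.

Lemma open_modulusP (R : realType) (W : set (C R)) :
  (forall c, W c -> exists2 d : R, 0 < d & forall w, modulus (w - c) < d -> W w) -> open W.
Proof. by move=> H; rewrite openE => c Wc; apply/nbhs_modulus; exact: H. Qed.

Lemma open_modulus_ball (R : realType) (p : C R) (d : R) : open [set z : C R | modulus (z - p) < d].
Proof.
apply: open_modulusP => c /= cd; exists (d - modulus (c - p)); first by rewrite subr_gt0.
move=> w wc; have := ler_modulus_distD c w p; clear -wc; lra.
Qed.

Lemma open_nbhs_box (R : realType) (z : C R) (V : set (C R)) :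
  open_nbhs z V -> exists2 r : R, 0 < r & box z r `<=` V.
Proof.
move=> [oV Vz]; have /nbhs_modulus[e e0 eV] : nbhs z V by apply: open_nbhs_nbhs.
exists (e / 3); first by rewrite divr_gt0.
by move=> w /box_sub_ball wz; apply: eV; clear -e0 wz; lra.
Qed.

Lemma entire_iter (R : realType) (f : C R -> C R) (n : nat) : entire f -> entire (iter n f).
Proof.
move=> ef; elim: n => [|n IH] z; first exact: derivable_idC.
exact: (derivable_compC (IH z) (ef _)).
Qed.

Lemma entire_continuous (R : realType) (f : C R -> C R) : entire f -> continuous f.
Proof. by move=> ef z; exact: derivable_continuousC. Qed.

Lemma not_polynomial_not_const (R : realType) (f : C R -> C R) (z : C R) :
  transcendental_entire f -> exists w, f (z + w) != f (z + 0).
Proof.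
move=> [_ np]; apply: contrapT => H; apply: np; exists (f z)%:P => w.
rewrite hornerC; apply/eqP/negPn/negP => fwz; apply: H; exists (w - z).
by rewrite addrC subrK addr0.
Qed.

(** As [f] is open, a neighbourhood of [f z] is covered by the image of a box about [z]; composing
    iterates with [f] gives iterates again, so convergence on the box passes to the image. *)
Lemma fatou_forward (R : realType) (f : C R -> C R) (z : C R) :
  transcendental_entire f -> fatou_set f z -> fatou_set f (f z).
Proof.
move=> tf [V zV nV]; have ef := tf.1.
have [r r0 rV] := open_nbhs_box zV.
have [d d0 dP] := open_mapping (@entire_shift R f z ef) (@not_polynomial_not_const R f z tf) r0.
rewrite addr0 in dP.
pose W : set (C R) := [set c | modulus (c - f z) < d].
exists W; first by split; [exact: open_modulus_ball|rewrite /W /= subrr modulus0].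
have lift c : W c -> exists w, box z r w /\ f w = c.
  move=> /dP[h hr fh]; exists (z + h); split=> //.
  by apply: ball_sub_box; rewrite addrAC subrr add0r ltW.
have cK := @compact_box R z r.
move=> g gF.
have [|phi [phi_incr conv]] := nV (fun k => g k \o f).
  move=> k; have [n /= n0 <-] := gF k; exists n.+1 => //.
  by apply/funext => w; rewrite iterSr.
exists phi; split=> //; case: conv => [inf|[h hc]].
  left => K [KW cK'] M; have [N _ NP] := inf _ (conj rV cK) M.
  exists N => // n Nn c /KW/lift[w [Kw <-]]; exact: NP.
(* The section [s] need not be continuous: convergence is uniform on the whole box, hence uniform in
   [c] whichever preimage is taken. *)
right; pose s (c : C R) := xget 0 [set w | box z r w /\ f w = c].
exists (fun c => h (s c)); apply/cvg_loc_unifP => K KW cK' e e0.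
have [N NP] := (cvg_loc_unifP V _ h).1 hc _ rV cK e e0.
exists N => n Nn c /KW/lift[w Hw].
have [Ks fs] : [set w | box z r w /\ f w = c] (s c) by apply: xgetI Hw.
by rewrite -{1}fs; exact: NP.
Qed.

Lemma homo_lt_ge (phi : nat -> nat) : {homo phi : i j / (i < j)%N} -> forall n, (n <= phi n)%N.
Proof. by move=> H; elim=> // n IH; exact: leq_ltn_trans IH (H _ _ (ltnSn n)). Qed.

Definition iterates (R : realType) (f : C R -> C R) : set (C R -> C R) :=
  [set iter n f | n in [set n | (0 < n)%N]].

(** Normality gives subsequences near each point; compactness of the circle merges them. The bound
    [K] excludes divergence to infinity. *)
Lemma subsequence_cauchy_circle (R : realType) (f : C R -> C R) (r K : R) :
  0 <= r -> (forall z, modulus z = r -> fatou_set f z) ->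
  (forall n z, (0 < n)%N -> modulus z = r -> modulus (iter n f z) <= K) ->
  forall g : nat -> C R -> C R, (forall k, iterates f (g k)) ->
  exists phi : nat -> nat, {homo phi : i j / (i < j)%N} /\
    forall e : R, 0 < e -> exists N, forall n m, (N <= n)%N -> (N <= m)%N ->
      forall z, modulus z = r -> modulus (g (phi n) z - g (phi m) z) < e.
Proof.
move=> r0 Fr bK.
(* All sequences of iterates are quantified over, so that for a union a second subsequence can be
   extracted from the first. *)
pose P (S : set (C R)) := forall g : nat -> C R -> C R, (forall k, iterates f (g k)) ->
  exists phi : nat -> nat, {homo phi : i j / (i < j)%N} /\
    forall e : R, 0 < e -> exists N, forall n m, (N <= n)%N -> (N <= m)%N ->
      forall z, S z -> modulus z = r -> modulus (g (phi n) z - g (phi m) z) < e.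
suff PK : P [set circle_pt r s | s in `[0, 1]].
  move=> g gF; have [phi [pi_ H]] := PK g gF; exists phi; split=> // e e0.
  have [N NP] := H e e0; exists N => n m Nn Nm z zr; apply: NP => //.
  by have [s s01 ->] := circle_ptP z; exists s; rewrite ?zr//= in_itv.
apply: compact_local; first exact: compact_circle.
- by move=> g _; exists id; split=> // e e0; exists 0%N.
- move=> A B AB PB g gF; have [phi [pi_ H]] := PB g gF; exists phi; split=> // e e0.
  by have [N NP] := H e e0; exists N => n m Nn Nm z /AB Bz; exact: NP.
- move=> A B PA PB g gF; have [phi [pi_ H]] := PA g gF.
  have [psi [qi_ H']] := PB (g \o phi) (fun k => gF (phi k)).
  exists (phi \o psi); split=> [i j ij|e e0]; first exact/pi_/qi_.
  have [N NP] := H e e0; have [M MP] := H' e e0.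
  exists (maxn N M) => n m; rewrite !geq_max => /andP[Nn Mn] /andP[Nm Mm] z [Az|Bz] zr.
    by apply: NP => //; exact: leq_trans (homo_lt_ge qi_ _).
  exact: MP.
move=> _ [s0 _ <-]; set c := circle_pt r s0.
have cr : modulus c = r by exact: modulus_circle_pt.
have [V cV nV] := Fr c cr; have [d d0 dV] := open_nbhs_box cV.
exists (box c d).
  by apply/nbhs_modulus; exists d => // w wc; apply: ball_sub_box; exact: ltW.
have cb := @compact_box R c d; have bc : box c d c.
  by apply: ball_sub_box; rewrite subrr modulus0 ltW.
move=> g gF; have [phi [pi_ [inf|[h hc]]]] := nV g gF.
  have [N _ NP] := inf _ (conj dV cb) K.
  have [k /= k0 gk] := gF (phi N).
  have := NP N (leqnn N) c bc; rewrite /= -gk ltNge bK//.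
exists phi; split=> // e e0; have e20 : 0 < e / 2 by rewrite divr_gt0.
have [N NP] := (cvg_loc_unifP V _ h).1 hc _ dV cb _ e20.
exists N => n m Nn Nm z bz _.
apply: le_lt_trans (ler_modulus_distD (h z) _ _) _.
rewrite [modulus (h z - _)]modulus_distC [ltRHS]splitr ltrD//; exact: NP.
Qed.

(* By the maximum principle, uniform convergence on the circle propagates to the disc. *)
Lemma fatou_fill (R : realType) (f : C R -> C R) (r K : R) :
  entire f -> 0 <= r -> (forall z, modulus z = r -> fatou_set f z) ->
  (forall n z, (0 < n)%N -> modulus z = r -> modulus (iter n f z) <= K) ->
  forall z, modulus z < r -> fatou_set f z.
Proof.
move=> ef r0 Fr bK z zr.
exists [set w | modulus (w - 0) < r].
  by split; [exact: open_modulus_ball|rewrite /= subr0].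
move=> g gF; have [phi [pi_ H]] := subsequence_cauchy_circle r0 Fr bK gF.
have eg k : entire (g k) by have [n _ <-] := gF k; exact: entire_iter.
exists phi; split=> //; right.
have cauchy e : 0 < e -> exists N, forall n m, (N <= n)%N -> (N <= m)%N ->
    forall z, modulus z < r -> modulus (g (phi n) z - g (phi m) z) <= e.
  move=> e0; have [N NP] := H e e0; exists N => n m Nn Nm w wr.
  apply: (@maximum_modulus R (fun z => g (phi n) z - g (phi m) z) r e (ltW e0)) (ltW wr).
    by move=> u _; apply: derivableBC; exact: eg.
  by move=> u ur; apply/ltW/NP.
have /choice[h hP] : forall w, exists l, modulus w < r -> cvg_seqC (fun n => g (phi n) w) l.
  move=> w; have [wr|] := pselect (modulus w < r); last by exists 0.
  have [e e0|l Hl] := @cauchy_seqC_cvg R (fun n => g (phi n) w); last by exists l.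
  have e20 : 0 < e / 2 by rewrite divr_gt0.
  have [N NP] := cauchy _ e20; exists N => n m Nn Nm.
  by apply: le_lt_trans (NP n m Nn Nm w wr) _; clear -e0; lra.
exists h; apply/cvg_loc_unifP => S SV _ e e0; have e20 : 0 < e / 2 by rewrite divr_gt0.
have [N NP] := cauchy _ e20; exists N => n Nn w /SV; rewrite /= subr0 => wr.
have e40 : 0 < e / 2 by [].
have [M MP] := hP w wr _ e20.
have := NP n (maxn N M) Nn (leq_maxl _ _) w wr; have := MP _ (leq_maxr N M) => A B.
apply: le_lt_trans (ler_modulus_distD (g (phi (maxn N M)) w) _ _) _.
by rewrite [ltRHS]splitr ler_ltD.
Qed.

(** * The orbit of a wandering domain *)

Definition fatou_comp (R : realType) (f : C R -> C R) (z : C R) : set (C R) :=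
  connected_component (fatou_set f) z.

Lemma connected_modulus (R : realType) (A : set (C R)) (z w : C R) (r : R) :
  connected A -> A z -> A w -> modulus z <= r <= modulus w ->
  exists2 u, A u & modulus u = r.
Proof.
move=> cA Az Aw zrw.
have cm : connected (@modulus R @` A).
  apply: connected_continuous_connected => //.
  by apply: continuous_subspaceT; exact: continuous_modulus.
have /connected_intervalP iA := cm.
have [u Au ur] := iA _ _ (ex_intro2 _ _ z Az erefl) (ex_intro2 _ _ w Aw erefl) r zrw.
by exists u.
Qed.

Lemma fatou_forward_iter (R : realType) (f : C R -> C R) (z : C R) (n : nat) :
  transcendental_entire f -> fatou_set f z -> fatou_set f (iter n f z).
Proof. by move=> tf Fz; elim: n => [//|n IH]; exact: fatou_forward. Qed.

Lemma fatou_comp_iter (R : realType) (f : C R -> C R) (n : nat) (z u : C R) :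
  transcendental_entire f -> fatou_set f z ->
  fatou_comp f z u -> fatou_comp f (iter n f z) (iter n f u).
Proof.
move=> tf Fz zu.
have cn : connected (iter n f @` fatou_comp f z).
  apply: connected_continuous_connected; first exact: component_connected.
  apply: continuous_subspaceT; apply: entire_continuous; exact: entire_iter tf.1.
apply: (@connected_component_max _ (fatou_set f) (iter n f @` fatou_comp f z)) => //.
- by exists z => //; exact: connected_component_refl.
- move=> _ [v zv <-]; apply: fatou_forward_iter => //.
  exact: connected_component_sub zv.
Qed.

Lemma fatou_comp_eq (R : realType) (f : C R -> C R) (z w u : C R) :
  fatou_comp f z u -> fatou_comp f w u -> fatou_comp f z = fatou_comp f w.
Proof.
by move=> /same_connected_component zu /same_connected_component wu; rewrite /fatou_comp zu wu.
Qed.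

Lemma disc_fatou_comp (R : realType) (f : C R -> C R) (r : R) (z w : C R) :
  (forall u, modulus u <= r -> fatou_set f u) -> modulus z <= r -> modulus w <= r ->
  fatou_comp f z w.
Proof.
move=> Fr zr wr; pose h (s : R) : C R := z + toC s * (w - z).
have ch : continuous h.
  move=> s; apply/continuous_RCP => e e0; have m1 : 0 < modulus (w - z) + 1.
    by rewrite ltr_wpDl ?modulus_ge0.
  exists (e / (modulus (w - z) + 1)); first by rewrite divr_gt0.
  move=> y; rewrite ltr_pdivlMr// => ys.
  rewrite /h opprD addrACA subrr add0r -mulrBl -rmorphB modulusM modulus_real.
  by apply: le_lt_trans ys; rewrite ler_wpM2l// lerDl.
apply: (@connected_component_max _ (fatou_set f) (h @` `[0, 1])).
- by exists 0; rewrite /= ?in_itv/= ?lexx ?ler01// /h rmorph0 mul0r addr0.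
- move=> _ [s /= + <-]; rewrite in_itv /= => s01; apply: Fr.
  have -> : h s = toC (1 - s) * z + toC s * w.
    by rewrite /h rmorphB rmorph1; ring.
  apply: le_trans (ler_modulusD _ _) _; rewrite !modulusM !modulus_real !ger0_norm; last 2 first.
  - by clear -s01; lra.
  - by clear -s01; lra.
  have s0 : 0 <= s by clear -s01; lra.
  have s1 : 0 <= 1 - s by clear -s01; lra.
  have := ler_wpM2l s1 zr; have := ler_wpM2l s0 wr; clear; lra.
- apply: connected_continuous_connected; first exact: segment_connected.
  exact: continuous_subspaceT.
- by exists 1; rewrite /= ?in_itv/= ?lexx ?ler01// /h rmorph1 mul1r addrC subrK.
Qed.

(** It serves for the remainders modulo [p] when an iterate of [f] maps a disc into itself and all
    iterates have to be bounded there. *)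
Lemma iter_bounded (R : realType) (f : C R -> C R) (r : R) (p : nat) : entire f ->
  exists K : R, forall n z, (n < p)%N -> modulus z <= r -> modulus (iter n f z) <= K.
Proof.
move=> ef; elim: p => [|p [K KP]]; first by exists 0.
have [M M0 MP] := compact_bounded_modulus (@compact_box R 0 r)
  (fun z _ => @entire_continuous R (iter p f) (@entire_iter R f p ef) z).
exists (Num.max K M) => n z; rewrite ltnS leq_eqVlt => /orP[/eqP -> zr|np zr].
  rewrite le_max MP ?orbT//; apply: ball_sub_box; first by rewrite subr0.
by rewrite le_max KP.
Qed.

(* The orbit data extracted from the hypotheses: [w] is a late point of the orbit, and the
   Fatou components of its iterates are pairwise distinct and contain the circles through
   the iterates. *)
Definition ring_orbit (R : realType) (f : C R -> C R) (w : C R) : Prop :=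
  [/\ transcendental_entire f,
      forall n z, modulus z = modulus (iter n f w) -> fatou_comp f (iter n f w) z &
      forall n m, (n < m)%N -> fatou_comp f (iter n f w) <> fatou_comp f (iter m f w)].

(** If the bound with slope [k] held on a larger circle, then together with the bound at [y] the
    three circles theorem would impose it at [z1]. *)
Lemma exceeds_persists (R : realType) (g : C R -> C R) (y x1 k : R) (z1 : C R) :
  entire g -> 0 <= y -> y <= x1 -> 0 <= k ->
  (forall z, modulus z = expR y -> modulus (g z) <= expR (k * y)) ->
  modulus z1 = expR x1 -> expR (k * x1) < modulus (g z1) ->
  forall x, x1 <= x -> exists2 z, modulus z = expR x & expR (k * x) < modulus (g z).
Proof.
move=> eg y0 yx1 k0 gy z1x gz1 x x1x; apply: contrapT => H.
suff : modulus (g z1) <= expR (k * x1) by rewrite leNgt gz1.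
apply: (@three_circles R g y x k y0 k0 _ gy _ x1 z1 _ z1x).
- by move=> z _; exact: eg.
- by move=> z zx; rewrite leNgt; apply/negP => h; apply: H; exists z.
- by rewrite yx1.
Qed.

(** By Liouville's argument no power of the modulus bounds [f] near infinity; a single point where
    [f] exceeds a power suffices, as the excess persists. *)
Lemma transcendental_growth (R : realType) (f : C R -> C R) (k : R) :
  transcendental_entire f -> exists X : R, forall x, X <= x ->
    exists2 z, modulus z = expR x & expR (k * x) < modulus (f z).
Proof.
move=> [ef np].
have [M M0 MP] := compact_bounded_modulus (@compact_circle R (expR 1))
  (fun z _ => @entire_continuous R f ef z).
have fb z : modulus z = expR 1 -> modulus (f z) <= M.
  by move=> zr; apply: MP; have [s s01 ->] := circle_ptP z; exists s; rewrite ?zr//= in_itv.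
(* The exponent dominates [k] for the conclusion and [ln M] so that the bound required at the inner
   circle [y = 1] holds. *)
pose n := (Num.truncn (Num.max k (ln M))).+1.
have nk : Num.max k (ln M) < n%:R by exact: truncnS_gt.
have kn : k <= n%:R by rewrite ltW// (le_lt_trans _ nk)// le_max lexx.
have Mn : ln M <= n%:R by rewrite ltW// (le_lt_trans _ nk)// le_max lexx orbT.
have {}fb z : modulus z = expR 1 -> modulus (f z) <= expR (n%:R * 1).
  by move=> /fb h; apply: le_trans h _; rewrite mulr1 -[M]lnK ?posrE// ler_expR.
have [z1 z1e fz1] : exists2 z1, expR 1 <= modulus z1 & modulus z1 ^+ n < modulus (f z1).
  apply: contrapT => H; apply: np; apply: (@entire_growth_polynomial R f (expR 1) n) => // z ze.
  by rewrite leNgt; apply/negP => h; apply: H; exists z.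
have z10 : 0 < modulus z1 by apply: lt_le_trans z1e; exact: expR_gt0.
have z1E : modulus z1 = expR (ln (modulus z1)) by rewrite lnK.
have x11 : 1 <= ln (modulus z1) by rewrite -ler_expR -z1E.
have fz1' : expR (n%:R * ln (modulus z1)) < modulus (f z1) by rewrite expRM_natl -z1E.
exists (Num.max (ln (modulus z1)) 0) => x; rewrite ge_max => /andP[x1x x0].
have [z zx fz] := exceeds_persists ef ler01 x11 (ler0n _ n) fb z1E fz1' x1x.
exists z => //; apply: le_lt_trans fz; rewrite ler_expR ler_wpM2r//.
Qed.

(** * Moduli along the orbit *)

Section RingOrbit.
Context (R : realType) (f : C R -> C R) (w : C R) (ro : ring_orbit f w).

Let tf : transcendental_entire f. Proof. by case: ro. Qed.
Let ef : entire f. Proof. by case: tf. Qed.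
Local Notation V n := (fatou_comp f (iter n f w)).
Local Notation r n := (modulus (iter n f w)).

Let circ n z : modulus z = r n -> V n z. Proof. by case: ro => _ + _; exact. Qed.

Lemma ring_orbit_inj n m u : V n u -> V m u -> n = m.
Proof.
case: ro => _ _ dist nu mu; have E := fatou_comp_eq nu mu.
case: (ltngtP n m) => // h; first by case: (dist n m h).
by case: (dist m n h).
Qed.

Lemma ring_orbit_fatou n z : V n z -> fatou_set f z.
Proof. exact: connected_component_sub. Qed.

Lemma ring_orbit_iter n k z : V n z -> V (n + k)%N (iter k f z).
Proof.
move=> nz; rewrite addnC iterD; apply: fatou_comp_iter => //.
by apply: (@ring_orbit_fatou n); exact: circ.
Qed.

(** The connected set [V n] cannot meet the circle of radius [r m], which lies in the disjoint
    component [V m]. *)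
Lemma ring_orbit_side n m z : n <> m -> V n z -> (modulus z < r m) = (r n < r m).
Proof.
move=> nm nz; have cV : connected (V n) by exact: component_connected.
have nn : V n (iter n f w) by exact: circ.
have avoid u : V n u -> modulus u != r m.
  by move=> nu; apply/eqP => /circ mu; apply: nm; exact: ring_orbit_inj nu mu.
have := avoid _ nz; have := avoid _ nn; move=> h1 h2.
have [zm|mz] := ltP (modulus z) (r m).
  apply/esym; rewrite ltNge; apply/negP => mn.
  have [|u nu /eqP] := connected_modulus cV nz nn (r := r m); first by rewrite (ltW zm).
  by apply/negP/avoid.
apply/esym/negbTE; rewrite -leNgt leNgt; apply/negP => nm'.
have [|u nu /eqP] := connected_modulus cV nn nz (r := r m); first by rewrite (ltW nm').
by apply/negP/avoid.
Qed.

(* If [r j < r i] with [i < j], an iterate of [f] maps the closed disc of radius [r i] into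
   itself, so that the disc lies in the Fatou set and the two components agree. *)
Lemma ring_orbit_lt i j : (i < j)%N -> r i < r j.
Proof.
move=> ij; have ne : i <> j by move=> E; rewrite E ltnn in ij.
have neq : r i != r j.
  apply/eqP => E; apply: ne; apply: (@ring_orbit_inj i j (iter i f w)); first exact: circ.
  exact: circ.
rewrite lt_neqAle neq /= leNgt; apply/negP => ji.
pose p := (j - i)%N; have p0 : (0 < p)%N by rewrite subn_gt0.
have r0 : 0 <= r i by exact: modulus_ge0.
have self z : modulus z <= r i -> modulus (iter p f z) <= r i.
  apply: (@maximum_modulus R (iter p f) (r i) (r i)) => // [u _|u ur].
    exact: entire_iter.
  have := ring_orbit_iter p (circ ur); rewrite subnKC ?(ltnW ij)// => Vj.
  by apply: ltW; rewrite (@ring_orbit_side j i)//; exact/nesym.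
have selfn l z : modulus z <= r i -> modulus (iter (l * p) f z) <= r i.
  by move=> zr; elim: l => [|l IH]; rewrite ?mul0n// mulSn iterD; exact: self.
(* An exponent is divided by [p]: the multiple of [p] keeps the point in the disc, and finitely many
   remainders are left to bound. *)
have [K KP] := iter_bounded (r i) p ef.
have bnd n z : (0 < n)%N -> modulus z = r i -> modulus (iter n f z) <= K.
  move=> _ zr; rewrite (divn_eq n p) addnC iterD; apply: KP; first exact: ltn_pmod.
  by apply: selfn; rewrite zr.
have fill := fatou_fill ef r0 (fun z zr => ring_orbit_fatou (circ zr)) bnd.
have fill' z : modulus z <= r i -> fatou_set f z.
  by rewrite le_eqVlt => /orP[/eqP/circ/ring_orbit_fatou//|]; exact: fill.
have Vij : V i (iter j f w) by apply: (disc_fatou_comp fill'); rewrite ?lexx// ltW.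
by apply: ne; apply: ring_orbit_inj Vij _; exact: circ.
Qed.

Lemma ring_orbit_le i j : (i <= j)%N -> r i <= r j.
Proof. by rewrite leq_eqVlt => /orP[/eqP->//|/ring_orbit_lt/ltW]. Qed.

Lemma ring_orbit_above n m z : (n < m)%N -> V n z -> modulus z < r m.
Proof.
move=> nm nz; rewrite (ring_orbit_side _ nz); first exact: ring_orbit_lt.
by move=> E; rewrite E ltnn in nm.
Qed.

Lemma ring_orbit_below n m z : (m < n)%N -> V n z -> r m < modulus z.
Proof.
move=> mn nz; have ne : n <> m by move=> E; rewrite E ltnn in mn.
rewrite lt_neqAle leNgt (ring_orbit_side ne nz) -leNgt (ltW (ring_orbit_lt mn)) andbT.
by apply/eqP => /esym/circ mz; apply: ne; exact: ring_orbit_inj nz mz.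
Qed.

(** If the radii stayed bounded, so would all iterates on one of the circles; its disc would lie in
    the Fatou set and merge two components. *)
Lemma ring_orbit_unbounded (K : R) : exists N, forall n, (N <= n)%N -> K < r n.
Proof.
have [N KN] : exists N, K < r N.
  apply: contrapT => H.
  have rK n : r n <= K by rewrite leNgt; apply/negP => h; apply: H; exists n.
  (* Index 1 is chosen because the disc of radius [r 1] contains the earlier point [w], whose
     component is [V 0]. *)
  have bnd n z : (0 < n)%N -> modulus z = r 1%N -> modulus (iter n f z) <= K.
    move=> _ /circ/(ring_orbit_iter n) h.
    apply: le_trans (rK (1 + n).+1); apply: ltW; exact: ring_orbit_above h.
  have fill := fatou_fill ef (modulus_ge0 _) (fun z zr => ring_orbit_fatou (circ zr)) bnd.
  have fill' z : modulus z <= r 1%N -> fatou_set f z.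
    by rewrite le_eqVlt => /orP[/eqP/circ/ring_orbit_fatou//|]; exact: fill.
  have V10 : V 1%N (iter 0 f w).
    by apply: (disc_fatou_comp fill'); rewrite ?lexx// ltW// (@ring_orbit_lt 0 1).
  by have := ring_orbit_inj V10 (circ (n := 0) erefl).
by exists N => n /ring_orbit_le; exact: lt_le_trans.
Qed.

Local Notation l n := (ln (r n)).

(** Somewhere on the circle of radius [r n] the function exceeds the power [k] of the radius, and
    the value taken there lies in [V n.+1], hence inside the circle of radius [r (n + 2)]. *)
Lemma ring_orbit_growth (k : R) : exists N, forall n, (N <= n)%N -> k * l n < l (n + 2)%N.
Proof.
have [X XP] := transcendental_growth k tf.
have [N NP] := ring_orbit_unbounded (expR X).
exists N => n /NP rn; have rn0 : 0 < r n by apply: lt_trans rn; exact: expR_gt0.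
have [|z zr fz] := XP (l n); first by rewrite -ler_expR lnK ?posrE// ltW.
rewrite lnK ?posrE// in zr.
have := ring_orbit_iter 1 (circ zr); rewrite addn1 => /(ring_orbit_above (ltnSn _)) /= h.
rewrite -ltr_expR lnK; first by rewrite addn2; exact: lt_trans fz h.
by rewrite posrE; apply: lt_le_trans rn0 _; apply: ring_orbit_le; exact: leq_addr.
Qed.

(* For large [m] the comparison holds already at the radius [r (i + 3)]; the finitely many
   other values of [m] are treated one by one. *)
Lemma ring_orbit_uniform_growth : exists y X : R, [/\ 0 < y, y <= X &
  forall m, (0 < m)%N -> exists k : R, [/\ 0 <= k,
    forall z, modulus z = expR y -> modulus (iter m f z) <= expR (k * y) &
    forall x, X <= x -> exists2 z, modulus z = expR x & expR (k * x) < modulus (iter m f z)]].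
Proof.
have [i iP] := ring_orbit_unbounded 1.
have r1 n : (i <= n)%N -> 0 < r n by move=> /iP; exact: lt_trans.
have l0 n : (i <= n)%N -> 0 < l n by move=> /iP; exact: ln_gt0.
have l_lt n m : (i <= n)%N -> (n < m)%N -> l n < l m.
  move=> le_in nm; rewrite ltr_ln ?posrE ?r1//; first exact: ring_orbit_lt.
  by rewrite (leq_trans le_in)// ltnW.
have l_le n m : (i <= n)%N -> (n <= m)%N -> l n <= l m.
  by move=> le_in; rewrite leq_eqVlt => /orP[/eqP->//|h]; exact/ltW/l_lt.
pose y := l i; have y0 : 0 < y by exact: l0.
(* The slope for which [k m * y] is the logarithm of [r (i + m).+1], a bound for the [m]-th iterate
   on the circle of radius [r i]. *)
pose k m := l (i + m).+1 / y.
have k0 m : 0 <= k m by rewrite divr_ge0 ?ltW// l0// -addnS leq_addr.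
have ky m : k m * y = l (i + m).+1 by rewrite divfK// gt_eqF.
have low m z : modulus z = expR y -> modulus (iter m f z) <= expR (k m * y).
  rewrite ky lnK ?posrE ?r1 -?addnS ?leq_addr// lnK ?posrE ?r1// => zr.
  apply: ltW; rewrite addnS; apply: (@ring_orbit_above (i + m)) => //.
  by apply: ring_orbit_iter; exact: circ.
have up m n : (i <= n)%N -> k m * l n < l (n + m)%N -> forall x, l n <= x ->
    exists2 z, modulus z = expR x & expR (k m * x) < modulus (iter m f z).
  move=> le_in kn; apply: (@exceeds_persists R (iter m f) y (l n) (k m) (iter n f w)).
  - exact: entire_iter.
  - exact: ltW.
  - exact: l_le.
  - exact: k0.
  - exact: low.
  - by rewrite lnK ?posrE ?r1.
  - rewrite -iterD addnC -[ltRHS]lnK ?ltr_expR// posrE r1//.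
    by rewrite (leq_trans le_in)// leq_addr.
(* Multiplying [l (i + m).+1] by this factor gives [k m * l (i + 3)], which the growth statement at
   index [(i + m).+1] puts below [l (i + 3 + m)]. *)
have [N NP] := ring_orbit_growth (l (i + 3)%N / y).
have large m : (N <= m)%N -> forall x, l (i + 3)%N <= x ->
    exists2 z, modulus z = expR x & expR (k m * x) < modulus (iter m f z).
  move=> Nm; apply: up; first exact: leq_addr.
  have Nim : (N <= i + m.+1)%N by rewrite (leq_trans Nm)// addnS leqW// leq_addl.
  have h := NP _ Nim.
  have -> : (i + 3 + m = i + m.+1 + 2)%N by rewrite !addnS !addn0 !addSn.
  by rewrite /k -addnS mulrAC [X in X / _]mulrC mulrAC.
have small m : (0 < m)%N -> exists X, forall x, X <= x ->
    exists2 z, modulus z = expR x & expR (k m * x) < modulus (iter m f z).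
  (* For [m = 1] the transcendence of [f] is applied directly; from 2 on, the growth over two steps
     of the orbit suffices because [l] increases. *)
  case: m => [//|[_|m _]]; first exact: transcendental_growth.
  have [N' N'P] := ring_orbit_growth (k m.+2).
  exists (l (i + N')%N); apply: up; first exact: leq_addr.
  apply: lt_le_trans (N'P _ (leq_addl _ _)) _; apply: l_le; first by rewrite -addnA leq_addr.
  by rewrite leq_add2l.
have [X XP] : exists X, forall m, (0 < m)%N -> (m < N)%N -> forall x, X <= x ->
    exists2 z, modulus z = expR x & expR (k m * x) < modulus (iter m f z).
  elim: (N) => [|M [X XP]]; first by exists 0.
  have [->|M0] := eqVneq M 0%N; first by exists 0; case.
  have [|X' X'P] := small M; first by rewrite lt0n.
  exists (Num.max X X') => m m0; rewrite ltnS leq_eqVlt => /orP[/eqP->|mM] x; rewrite ge_max => /andP[h1 h2].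
    exact: X'P.
  exact: XP.
exists y, (Num.max X (l (i + 3)%N)); split=> //.
  by rewrite le_max; apply/orP; right; apply: l_le => //; exact: leq_addr.
move=> m m0; exists (k m); split=> //; first exact: low.
move=> x; rewrite ge_max => /andP[h1 h2].
by have [mN|Nm] := ltnP m N; [exact: XP|exact: large].
Qed.

End RingOrbit.

(** * Absence of critical points *)

Lemma pi_lt4 (R : realType) : pi < 4 :> R.
Proof. by have := @pihalf_lt2 R; lra. Qed.

(** Since [2 * p ^ 2 < 32], [m] is below 6, and [9 / 10 * d] is at least 900. *)
Lemma harnack_radius_small (R : realType) (p d m s : R) :
  2 <= p < 4 -> 1000 <= d -> 0 <= m -> m ^+ 2 <= 2 * p ^+ 2 ->
  m = s * (9 / 10 * d) -> 0 <= s <= 1 / 150.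
Proof.
move=> p24 d1000 m0 m2 mE.
have m6 : m <= 6.
  rewrite leNgt; apply/negP => h.
  by clear -h m2 p24; have : 36 < m ^+ 2; nra.
have s0 : 0 <= s.
  rewrite leNgt; apply/negP => h; move: m0; rewrite mE; clear -h d1000; nra.
by rewrite s0 /=; move: m6; rewrite mE; clear -s0 d1000; nra.
Qed.

(** Here [s ^ 2 <= 200 / 81 * T], [q <= 150 / 149 * s ^ 2], and
    [(1 + q) / (1 - q) <= 1 + 41 / 20 * q] for [q <= 1 / 100]; the product of the three constants is
    below [257 / 50]. *)
Lemma harnack_numerics (R : realType) (p d m q u B T s : R) :
  1000 <= d -> m ^+ 2 <= 2 * p ^+ 2 -> T * d ^+ 2 = p ^+ 2 ->
  0 < B -> m = s * (9 / 10 * d) -> 0 <= s <= 1 / 150 -> q = s ^+ 2 / (1 - s) ->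
  u * (1 - q) <= B * (1 + q) -> u <= B * (1 + 257 / 50 * T).
Proof.
move=> d1000 m2 TE B0 mE /andP[s0 s1] qE uq.
have d0 : 0 < d ^+ 2 by rewrite exprn_gt0//; clear -d1000; lra.
have sT : 81 / 200 * s ^+ 2 <= T.
  rewrite -(ler_pM2r d0) TE.
  have E : m ^+ 2 = 81 / 100 * s ^+ 2 * d ^+ 2 by rewrite mE; field.
  by rewrite E in m2; clear -m2; lra.
have qs : q * (1 - s) = s ^+ 2.
  by rewrite qE divfK// gt_eqF//; clear -s1; lra.
have q0 : 0 <= q by rewrite qE divr_ge0 ?exprn_ge0//; clear -s1; lra.
have ss : s ^+ 2 <= 1 / 150 * (1 / 150) by rewrite expr2; apply: ler_pM.
have T0 : 0 <= T.
  by apply: le_trans sT; apply: mulr_ge0; [exact: divr_ge0|exact: exprn_ge0].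
have q1 : q <= 1 / 100.
  have : q * (149 / 150) <= q * (1 - s) by rewrite ler_wpM2l//; clear -s1; lra.
  by rewrite qs; clear -ss; lra.
have qT : 41 / 20 * q <= 257 / 50 * T.
  have : q * (149 / 150) <= q * (1 - s) by rewrite ler_wpM2l//; clear -s1; lra.
  by rewrite qs; clear -sT T0; lra.
apply: (@le_trans _ _ (B * (1 + 41 / 20 * q))); last first.
  by rewrite ler_pM2l//; clear -qT; lra.
have q2 : 0 < 1 - q by clear -q1; lra.
rewrite -(ler_pM2r q2); apply: le_trans uq _.
rewrite -[leRHS]mulrA ler_pM2l//; clear -q0 q1; nra.
Qed.

(** As [T = p ^ 2 / d ^ 2], the bound on [x] gives [T * x <= 1 / 4 + T * d] with
    [T * d <= 16 / 1000]; multiplied by [257 / 50] this stays below 2, hence below [p]. *)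
Lemma radius_numerics (R : realType) (p d x T : R) :
  2 <= p < 4 -> 1000 <= d -> T * d ^+ 2 = p ^+ 2 -> 0 < x ->
  x <= d ^+ 2 / (4 * p ^+ 2) + d -> (1 + 257 / 50 * T) * x < x + p.
Proof.
move=> /andP[p2 p4] d1000 TE x0 xle.
have d0 : 0 < d by clear -d1000; lra.
have T0 : 0 < T.
  have : 0 < T * d ^+ 2 by rewrite TE exprn_gt0//; clear -p2; lra.
  by rewrite pmulr_lgt0// exprn_gt0.
have p0 : p ^+ 2 != 0 by rewrite expf_neq0// gt_eqF//; clear -p2; lra.
have Td : T * d <= 16 / 1000.
  have h1 : T * d * d <= 16.
    by rewrite -mulrA -expr2 TE; clear -p2 p4; nra.
  have h2 : T * d * 1000 <= T * d * d by rewrite ler_wpM2l// mulr_ge0// ltW.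
  by clear -h1 h2; lra.
have : T * x <= 4^-1 + T * d.
  apply: le_trans (ler_wpM2l (ltW T0) xle) _.
  rewrite mulrDr lerD2r mulrA TE invfM mulrCA divff// mulr1.
  exact: lexx.
by clear -Td p2; lra.
Qed.

(* Near a critical point [cexp t0], Harnack's inequality improved to second order makes
   [ln |g|] grow by a factor less than [(x0 + pi) / x0] between the radii [expR x0] and
   [expR (x0 + pi)], whereas convexity (the three circles theorem) forces at least that. *)
Lemma no_critical_point (R : realType) (g : C R -> C R) (y X k d : R) (t0 : C R) :
  entire g -> 0 < y -> y <= X -> 0 <= k ->
  (forall z, modulus z = expR y -> modulus (g z) <= expR (k * y)) ->
  (forall x, X <= x -> exists2 z, modulus z = expR x & expR (k * x) < modulus (g z)) ->
  X <= Re t0 -> 1000 <= d -> Re t0 <= d ^+ 2 / (4 * pi ^+ 2) + d ->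
  (forall t, `|Re t - Re t0| < d -> 1 < modulus (g (cexp t))) ->
  ~ critical_point g (cexp t0).
Proof.
move=> eg y0 yX k0 low up Xx d1000 xd strip crit.
have d0 : 0 < d by clear -d1000; lra.
set x := Re t0 in Xx xd strip *.
have x0 : 0 < x by clear -y0 yX Xx; lra.
have p4 := @pi_lt4 R; have p2 := @pi_ge2 R.
have p0 : 0 < pi :> R by exact: pi_gt0.
have pp : 2 <= (pi : R) < 4 by rewrite p2 p4.
pose T := pi ^+ 2 / d ^+ 2; have TE : T * d ^+ 2 = pi ^+ 2 by rewrite divfK// expf_neq0// gt_eqF.
pose G t := g (cexp t).
have dG t : derivable G t 1.
  apply: (@derivable_compC R (@cexp R) g t); first exact: derivable_cexp.
  exact: eg.
(* The closed box of half-side [rho] has to fit into the open strip of half-width [d]. *)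
pose rho := 9 / 10 * d; have rho0 : 0 < rho by rewrite mulr_gt0.
have G1 t : box t0 rho t -> 1 < modulus (G t).
  move=> [h _]; apply: strip; rewrite /x; apply: le_lt_trans h _.
  by rewrite /rho; clear -d0; lra.
have dG0 : is_derive t0 (1 : C R) G 0.
  have h1 : is_derive (cexp t0) (1 : C R) g 0.
    have h := derivableP (eg (cexp t0)).
    by rewrite -derive1E crit in h.
  have h2 := is_derive_compC (is_derive_cexp t0) h1.
  by rewrite mul0r in h2.
have harnack := critical_harnack rho0 (fun t _ => dG t) G1 dG0.
pose B := ln (modulus (G t0)).
have G01 : 1 < modulus (G t0) by apply: G1; apply: ball_sub_box; rewrite subrr modulus0 ltW.
have B0 : 0 < B by exact: ln_gt0.
have xp0 : 0 < x + pi by rewrite addr_gt0.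
(* The slope at which the Harnack bound on the outer circle reads [beta * (x + pi)]. By the
   numerical lemma the line of slope [beta] passes strictly below [B] at [x]. *)
pose beta := B * (1 + 257 / 50 * T) / (x + pi).
have T0 : 0 <= T by rewrite divr_ge0// exprn_ge0// ltW.
have betaE : beta * (x + pi) = B * (1 + 257 / 50 * T) by rewrite divfK// gt_eqF.
have b1 : 0 <= 1 + 257 / 50 * T by clear -T0; lra.
have beta0 : 0 <= beta by rewrite divr_ge0 ?mulr_ge0// ltW.
have betax : beta * x < B.
  rewrite /beta mulrAC ltr_pdivrMr// -[ltLHS]mulrA ltr_pM2l//.
  exact: (radius_numerics pp d1000 TE x0 xd).
(* Every point of the outer circle has a logarithm displaced from [t0] by [pi] horizontally and at
   most [pi] vertically, so by at most [sqrt 2 * pi]. *)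
have outer z : modulus z = expR (x + pi) -> modulus (g z) <= expR (beta * (x + pi)).
  move=> zx; pose t1 := t0 + toC pi.
  have z1 : modulus (z / cexp t1) = 1.
    rewrite modulusM modulusV modulus_cexp ReD /= -/x zx mulfV//.
    by rewrite gt_eqF// expR_gt0.
  have zN0 : z / cexp t1 != 0 by rewrite -modulus_gt0 z1.
  have [v vb zE] := polarP zN0.
  rewrite z1 rmorph1 mul1r in zE.
  pose t := t1 + 'i%C * toC v.
  have zt : z = cexp t by rewrite cexpD -zE mulrCA divff ?mulr1// cexp_neq0.
  have tt : t - t0 = Complex pi v.
    rewrite /t /t1 [t0 + _]addrC addrAC addrK.
    by apply/eqP; rewrite eq_complex /= !mul0r !mul1r subr0 !add0r addr0 !eqxx.
  have m2 : modulus (t - t0) ^+ 2 <= 2 * pi ^+ 2.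
    rewrite tt modulusE sqr_sqrtr ?addr_ge0 ?sqr_ge0//=.
    by clear -vb p0; nra.
  have m0 := modulus_ge0 (t - t0).
  pose s := modulus (t - t0) / rho.
  have sE : modulus (t - t0) = s * rho by rewrite divfK// gt_eqF.
  have s01 := harnack_radius_small pp d1000 m0 m2 sE.
  have s1 : s < 1 by clear -s01; lra.
  have h := harnack t s _ sE s1 erefl.
  have ub := harnack_numerics d1000 m2 TE B0 sE s01 erefl h.
  have Kt : box t0 rho t.
    by apply: ball_sub_box; rewrite sE -[leRHS]mul1r ler_pM2r// ltW.
  have Gt : 0 < modulus (G t) by apply: lt_trans (G1 t Kt).
  by rewrite zt -[leLHS]lnK ?posrE// ler_expR betaE.
(* If [beta < k], the growth hypothesis contradicts the outer bound. Otherwise the bound at [y] also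
   holds with slope [beta], and three circles forces [B <= beta * x]. *)
have [bk|kb] := ltP beta k.
  have [|z zx gz] := up (x + pi); first by clear -Xx p0; lra.
  have := lt_le_trans gz (outer z zx).
  by rewrite ltr_expR ltr_pM2r// ltNge (ltW bk).
have inner z : modulus z = expR y -> modulus (g z) <= expR (beta * y).
  by move=> /low h; apply: le_trans h _; rewrite ler_expR ler_wpM2r// ltW.
have := @three_circles R g y (x + pi) beta (ltW y0) beta0 (fun z _ => eg z) inner outer
  x (cexp t0) _ (modulus_cexp t0).
have yx : y <= x <= x + pi by clear -yX Xx p0; lra.
move=> /(_ yx); rewrite -[leLHS]lnK ?posrE ?(lt_trans _ G01)// ler_expR -/B.
by rewrite leNgt betax.
Qed.

(** * From the hypotheses on the wandering domain to the orbit *)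

Lemma component_iterE (R : realType) (f : C R -> C R) (U : set (C R)) (z0 : C R) (n : nat) :
  U z0 -> component_iter f U n !=set0 ->
  component_iter f U n = fatou_comp f (iter n f z0) /\ fatou_set f (iter n f z0).
Proof.
move=> Uz0 [u [V [FV fUV] Vu]].
(* Every member of the union contains the [n]-th iterate of [z0] and is therefore its component;
   nonemptiness provides at least one member. *)
have VE V' : fatou_component f V' -> iter n f @` U `<=` V' ->
    V' = fatou_comp f (iter n f z0) /\ fatou_set f (iter n f z0).
  move=> [z Fz ->] sub; have zn : connected_component (fatou_set f) z (iter n f z0).
    by apply: sub; exists z0.
  split; first exact: same_connected_component zn.
  exact: connected_component_sub zn.
have [EV Fn] := VE V FV fUV; split=> //; apply/seteqP; split=> [v [V' [FV' fUV'] V'v]|v nv].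
  by have [<-] := VE V' FV' fUV'.
by exists V => //; rewrite EV.
Qed.

Lemma annulus_circle (R : realType) (V : set (C R)) (w z : C R) (r s : R) :
  maximal_annulus V w r s -> modulus z = modulus w -> V z.
Proof. by case=> _ sub aw _ zw; apply: sub; rewrite /annulus /= zw. Qed.

(** The maximal annuli contain the circles through the orbit. If two late components coincided,
    applying further iterates would make the sequence periodic from then on, with period [m - n]. *)
Lemma ring_orbit_of_wandering (R : realType) (f : C R -> C R) (U : set (C R)) (z0 : C R)
    (r s : nat -> R) (N : nat) :
  transcendental_entire f -> wandering_domain f U -> U z0 ->
  (forall n, (N <= n)%N -> maximal_annulus (component_iter f U n) (iter n f z0) (r n) (s n)) ->
  ring_orbit f (iter N f z0).
Proof.
move=> tf [_ nper] Uz0 max.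
have comp n : (N <= n)%N ->
    component_iter f U n = fatou_comp f (iter n f z0) /\ fatou_set f (iter n f z0).
  move=> Nn; apply: component_iterE => //; exists (iter n f z0).
  exact: annulus_circle (max n Nn) erefl.
have itN n : iter n f (iter N f z0) = iter (n + N) f z0 by rewrite iterD.
split=> // [n z|n m nm E].
  rewrite itN => zn; have [<- _] := comp (n + N)%N (leq_addl _ _).
  exact: annulus_circle (max _ (leq_addl _ _)) zn.
apply: nper; exists (m - n)%N; split; first by rewrite subn_gt0.
exists (n + N)%N => // k /= nk.
have Nk : (N <= k)%N := leq_trans (leq_addl _ _) nk.
have [-> _] := comp k Nk.
have [-> _] := comp (k + (m - n))%N (leq_trans Nk (leq_addr _ _)).
rewrite !itN in E.
have [_ Fn] := comp (n + N)%N (leq_addl _ _).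
have [_ Fm] := comp (m + N)%N (leq_addl _ _).
have nn : fatou_comp f (iter (n + N) f z0) (iter (m + N) f z0).
  by rewrite E; exact: connected_component_refl.
have := fatou_comp_iter (k - (n + N)) tf Fn nn.
rewrite -!iterD (subnK nk) => h.
have [p pE] : exists p, m = (n + p)%N by exists (m - n)%N; rewrite subnKC// ltnW.
have kE : (k - (n + N) + (m + N) = k + (m - n))%N.
  by rewrite pE addKn addnAC addnA subnK.
by rewrite kE in h; apply/esym; exact: same_connected_component h.
Qed.

Lemma powR_expR (R : realType) (r x : R) : 0 < r -> r `^ x = expR (x * ln r).
Proof. by move=> r0; rewrite /powR gt_eqF. Qed.

(** With [S ^ 2 = ln r_n] the strip is [a * S ^ 2 < x < b * S ^ 2]. If the inner edge is nearer,
    [d > 2 * p * S], so [d ^ 2 / (4 * p ^ 2) >= S ^ 2 >= a * S ^ 2 = x - d]. If the outer edge is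
    nearer, [d > 3 * p * b * S], so the same quotient is at least
    [(b * S) ^ 2 >= b * S ^ 2 = x + d]. The value 250 for [S] ensures [2 * p * S >= 1000]. *)
Lemma distance_numerics (R : realType) (p a b S x : R) : 2 <= p -> 250 <= S ->
  a < 1 < b -> a * S ^+ 2 + 2 * p * S < x -> x < b * S ^+ 2 - 3 * p * b * S ->
  let d := Num.min (x - a * S ^+ 2) (b * S ^+ 2 - x) in
  1000 <= d /\ x <= d ^+ 2 / (4 * p ^+ 2) + d.
Proof.
move=> p2 S250 /andP[a1 b1] ax xb d.
have p0 : 0 < p by clear -p2; lra.
have S0 : 0 < S by clear -S250; lra.
have pS : 500 <= p * S by clear -p2 S250; nra.
have bpS : p * S <= b * (p * S) by rewrite ler_peMl ?ltW// mulr_gt0.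
have p4 : 0 < 4 * p ^+ 2 by rewrite mulr_gt0// exprn_gt0.
have xb' : x < b * S ^+ 2 - 3 * (b * (p * S)).
  by apply: lt_le_trans xb _; rewrite le_eqVlt; apply/orP; left; apply/eqP; ring.
have ax' : a * S ^+ 2 + 2 * (p * S) < x.
  by apply: le_lt_trans ax; rewrite le_eqVlt; apply/orP; left; apply/eqP; ring.
have d1 : 1000 <= x - a * S ^+ 2 by clear -ax' pS; lra.
have d2 : 1000 <= b * S ^+ 2 - x by clear -xb' pS bpS; lra.
split; first by rewrite le_min d1.
rewrite /d; case: (leP (x - a * S ^+ 2) (b * S ^+ 2 - x)) => _.
  set e := x - a * S ^+ 2.
  have Se : S ^+ 2 <= e ^+ 2 / (4 * p ^+ 2).
    rewrite ler_pdivlMr// (_ : S ^+ 2 * (4 * p ^+ 2) = (2 * (p * S)) ^+ 2); last by ring.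
    by rewrite lerXn2r// ?nnegrE /e; clear -ax' pS; lra.
  have aS : a * S ^+ 2 <= S ^+ 2 by rewrite ler_piMl ?exprn_ge0 ?ltW.
  by rewrite /e in Se *; clear -Se aS; lra.
set e := b * S ^+ 2 - x.
have Se : (b * S) ^+ 2 <= e ^+ 2 / (4 * p ^+ 2).
  rewrite ler_pdivlMr// (_ : (b * S) ^+ 2 * (4 * p ^+ 2) = (2 * (b * (p * S))) ^+ 2); last by ring.
  by rewrite lerXn2r// ?nnegrE /e; clear -xb' pS bpS; lra.
have bS : b * S ^+ 2 <= (b * S) ^+ 2.
  by rewrite exprMn ler_wpM2r ?exprn_ge0 ?(ltW S0)// expr2 ler_peMl// ltW// (lt_trans ltr01).
have e0 : 0 <= e by rewrite /e; clear -d2; lra.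
by rewrite /e in Se e0 *; clear -Se bS e0 d2; lra.
Qed.

Unset Implicit Arguments.

Theorem theorem1p4 (R : realType) (f : C R -> C R) (U : set (C R)) (z0 : C R)
    (a b : nat -> R) :
  transcendental_entire f ->
  wandering_domain f U ->
  multiply_connected U ->
  U z0 ->
  let r n := modulus (iter n f z0) in
  let delta n := 1 / Num.sqrt (ln (r n)) in
  (\forall n \near \oo, maximal_annulus (component_iter f U n) (iter n f z0)
                          (r n `^ a n) (r n `^ b n)) ->
  exists N : nat, forall n m : nat, (N <= n)%N -> (0 < m)%N ->
    forall z, annulus (r n `^ (a n + 2 * pi * delta n))
                      (r n `^ (b n * (1 - 3 * pi * delta n))) z ->
      ~ critical_point (iter m f) z.
Proof.
move=> tf wd _ Uz0 r delta [N0 _ max].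
have ro := ring_orbit_of_wandering tf wd Uz0 max.
set w := iter N0 f z0 in ro.
have rE n : modulus (iter n f w) = r (n + N0)%N by rewrite /r /w -iterD.
have [y [X [y0 yX growth]]] := ring_orbit_uniform_growth ro.
(* Three thresholds: [expR X] for the uniform growth, 1 for the positivity of [ln |f^m|], and
   [expR (250 ^+ 2)] for the numerical estimates. *)
have [I IP] := ring_orbit_unbounded ro (Num.max (expR X) (Num.max 1 (expR (250 ^+ 2)))).
(* The shift by [N0] passes from the orbit of [z0] to that of [w]. The extra 1 puts the preceding
   circle, which bounds the component from inside, beyond the thresholds as well. *)
exists (I.+1 + N0)%N => n m In m0 z.
pose i := (n - N0)%N.
have N0n : (N0 <= n)%N := leq_trans (leq_addl _ _) In.
have nE : (i + N0)%N = n by rewrite subnK.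
have Ii : (I < i)%N by rewrite -(ltn_add2r N0) nE.
have I1 : (I <= i.-1)%N by rewrite -ltnS prednK//; exact: leq_ltn_trans Ii.
have i1i : (i.-1 < i)%N by rewrite prednK//; exact: leq_ltn_trans Ii.
have := IP _ I1; rewrite !gt_max => /and3P[rX r1 _].
have := IP i (ltnW Ii); rewrite rE nE !gt_max => /and3P[_ rn1 rn250].
have r0 : 0 < r n by apply: lt_trans rn1.
have L0 : 0 < ln (r n) by exact: ln_gt0.
pose S := Num.sqrt (ln (r n)).
have SE : S ^+ 2 = ln (r n) by rewrite sqr_sqrtr// ltW.
have S250 : 250 <= S.
  have h : 250 = Num.sqrt (250 ^+ 2) :> R by rewrite sqrtr_sqr ger0_norm.
  by rewrite h ler_wsqrtr// -ler_expR lnK ?posrE// ltW.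
have S0 : S != 0 by rewrite gt_eqF// (lt_le_trans _ S250).
have dS : delta n * ln (r n) = S by rewrite /delta -/S -SE expr2 mulrA div1r mulVf// mul1r.
have [/andP[_ _] sub aw _] := max n N0n.
have pE c : r n `^ c = expR (c * ln (r n)) by exact: powR_expR.
have rL : r n = expR (ln (r n)) by rewrite lnK ?posrE.
have ab : a n < 1 < b n.
  have /andP[h1 h2] : r n `^ a n < r n < r n `^ b n := aw.
  move: h1 h2; rewrite !pE [X in _ < X -> _]rL [X in _ -> X < _ -> _]rL !ltr_expR.
  by rewrite -[X in _ < X -> _]mul1r -[X in _ -> X < _ -> _]mul1r !ltr_pM2r// => -> ->.
move=> /andP[]; rewrite !pE => z1 z2.
have mz : 0 < modulus z by apply: lt_trans z1; exact: expR_gt0.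
have zx : modulus z = expR (ln (modulus z)) by rewrite lnK ?posrE.
move: z1 z2; rewrite zx !ltr_expR => z1 z2.
have zN0 : z != 0 by rewrite -modulus_gt0.
have [u _ zu] := polarP zN0.
pose t0 := toC (ln (modulus z)) + 'i%C * toC u.
have zt0 : z = cexp t0 by rewrite cexpD cexp_real -zx.
have ret0 : Re t0 = ln (modulus z) by rewrite ReD Re_i_real addr0.
have p2 := @pi_ge2 R.
have e1 : a n * S ^+ 2 + 2 * pi * S < ln (modulus z).
  apply: le_lt_trans z1; rewrite SE -dS.
  by move: (ln _) (delta n) => L D; rewrite le_eqVlt; apply/orP; left; apply/eqP; ring.
have e2 : ln (modulus z) < b n * S ^+ 2 - 3 * pi * b n * S.
  apply: lt_le_trans z2 _; rewrite SE -dS.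
  by move: (ln _) (delta n) => L D; rewrite le_eqVlt; apply/orP; left; apply/eqP; ring.
have [d1000 xd] := distance_numerics p2 S250 ab e1 e2.
set d := Num.min _ _ in d1000 xd.
(* The vertical strip of half-width [d] about [t0] is mapped by the exponential into the maximal
   annulus, hence into the component. *)
have inV t : `|Re t - Re t0| < d -> fatou_comp f (iter i f w) (cexp t).
  rewrite ret0 lt_min => /andP[]; rewrite !ltr_norml => h1 h2.
  have An : annulus (r n `^ a n) (r n `^ b n) (cexp t).
    apply/andP; rewrite !pE modulus_cexp !ltr_expR -SE; split.
      by clear -h1; lra.
    by clear -h2; lra.
  have := sub _ An; have ne : component_iter f U n !=set0 by exists (cexp t); exact: sub.
  by have [-> _] := component_iterE Uz0 ne; rewrite /w -iterD nE.
have Xz : X <= Re t0.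
  have h : fatou_comp f (iter i f w) (cexp t0).
    by apply: inV; rewrite subrr normr0; clear -d1000; lra.
  have := ring_orbit_below ro i1i h; rewrite modulus_cexp => h'.
  by rewrite -ler_expR ltW// (lt_trans rX).
have [k [k0 low up]] := growth m m0.
rewrite zt0; apply: (@no_critical_point R (iter m f) y X k d t0 _ y0 yX k0 low up Xz d1000).
- by apply: entire_iter; exact: tf.1.
- by rewrite ret0.
(* The [m]-th iterate maps the component of index [i] into that of index [i + m], which lies outside
   the circle of index [i.-1], of radius greater than 1. *)
- move=> t /inV h; apply: lt_trans r1 _.
  apply: (ring_orbit_below ro _ (ring_orbit_iter ro m h)).
  exact: leq_trans i1i (leq_addr _ _).
Qed.
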